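(* Let $G$ be a cycle $v_1,v_2,\dots,v_n,v_1$ whose nodes are annotated with operations on real numbers $x_{v_i}$ (each node is one of $\mathtt{insert}(x_{v_i})$, $\mathtt{delete}(x_{v_i})$, $\mathtt{query}(x_{v_i})$). For every fixed $\varepsilon>0$ there is a data structure using $O(n^{1+\varepsilon})$ storage that processes the requests of an arbitrary (adversarial) walk on $G$ in constant time per step; in particular each query $\mathtt{query}(x_{v^t})$ is answered with $\mathrm{succ}_{X^t}(x_{v^t})$ in $O(1)$ time.
   Context: A walk on $G$ starts at a designated node and at each step moves to a neighbor of the current node on the cycle; in the adversarial model the neighbor may be chosen arbitrarily. Let $v^t$ be the node visited at time $t$. The active set $X^t\subseteq\mathbb R$ evolves by $X^t=X^{t-1}\cup\{x_{v^t}\}$ if $v^t$ is an insertion node, $X^t=X^{t-1}\setminus\{x_{v^t}\}$ if $v^t$ is a deletion node, and $X^t=X^{t-1}$ if $v^t$ is a query node. A query at time $t$ must return $\mathrm{succ}_{X^t}(x_{v^t})=\min\{x\in X^t : x\ge x_{v^t}\}$ (or $\infty$ if no such element exists). *)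

(* Defs.v *)
From Stdlib Require Import Reals Arith List.
Open Scope R_scope.

Inductive opkind := OpInsert | OpDelete | OpQuery.

(* Nodes of the cycle v_1..v_n are numbered 0..n-1; node a is adjacent to
   (a+1) mod n and (a-1) mod n. *)
Definition cycle_adj (n a b : nat) : Prop :=
  b = ((a + 1) mod n)%nat \/ a = ((b + 1) mod n)%nat.

Definition is_walk (n s : nat) (w : nat -> nat) : Prop :=
  w 0%nat = s /\ (forall t, (w t < n)%nat) /\ (forall t, cycle_adj n (w t) (w (S t))).

Definition apply_op (op : nat -> opkind) (x : nat -> R) (v : nat)
  (X : R -> Prop) : R -> Prop :=
  match op v with
  | OpInsert => fun y => X y \/ y = x v
  | OpDelete => fun y => X y /\ y <> x v
  | OpQuery  => X
  end.

Fixpoint active_set (op : nat -> opkind) (x : nat -> R) (w : nat -> nat)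
  (t : nat) : R -> Prop :=
  match t with
  | O => apply_op op x (w O) (fun _ => False)
  | S t' => apply_op op x (w (S t')) (active_set op x w t')
  end.

(* The answer u (a natural number) encodes succ_X(q): either u < n is a node
   whose value x_u equals min {y in X | y >= q}, or u = n encodes +infinity
   (no element of X is >= q). *)
Definition succ_answer (n : nat) (x : nat -> R) (X : R -> Prop) (q : R)
  (u : nat) : Prop :=
  ((u < n)%nat /\ X (x u) /\ q <= x u /\ (forall y, X y -> q <= y -> x u <= y))
  \/ (u = n /\ forall y, X y -> y < q).

Inductive binop := BAdd | BSub | BMul | BDiv | BMod | BAnd | BOr | BXor
                 | BShl | BShr.

Definition eval_binop (f : binop) (a b : nat) : nat :=
  match f with
  | BAdd => a + b | BSub => a - b | BMul => a * b
  | BDiv => Nat.div a b | BMod => Nat.modulo a b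
  | BAnd => Nat.land a b | BOr => Nat.lor a b | BXor => Nat.lxor a b
  | BShl => Nat.shiftl a b | BShr => Nat.shiftr a b
  end%nat.

Inductive instr :=
  | IConst (i k : nat)              (* m[i] := k *)
  | IBin (f : binop) (i j l : nat)  (* m[i] := m[j] f m[l] *)
  | ILoad (i j : nat)               (* m[i] := m[m[j]] *)
  | IStore (i j : nat)              (* m[m[i]] := m[j] *)
  | IJlt (i j p : nat)              (* if m[i] < m[j] then goto p *)
  | IHalt.

Definition program := list instr.

Definition upd (m : nat -> nat) (a v : nat) : nat -> nat :=
  fun b => if Nat.eqb b a then v else m b.

(* One instruction; None if an address >= S is touched or a value >= W is
   written (space / word-size violation). *)
Definition exec1 (S W : nat) (ins : instr) (pc : nat) (m : nat -> nat)
  : option (nat * (nat -> nat)) :=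
  let ok_a a := Nat.ltb a S in
  let ok_v v := Nat.ltb v W in
  match ins with
  | IConst i k => if ok_a i && ok_v k then Some (Datatypes.S pc, upd m i k) else None
  | IBin f i j l =>
      let v := eval_binop f (m j) (m l) in
      if ok_a i && ok_a j && ok_a l && ok_v v then Some (Datatypes.S pc, upd m i v) else None
  | ILoad i j =>
      if ok_a i && ok_a j && ok_a (m j) then Some (Datatypes.S pc, upd m i (m (m j))) else None
  | IStore i j =>
      if ok_a i && ok_a j && ok_a (m i) then Some (Datatypes.S pc, upd m (m i) (m j)) else None
  | IJlt i j p =>
      if ok_a i && ok_a j then Some ((if Nat.ltb (m i) (m j) then p else Datatypes.S pc), m)
      else None
  | IHalt => Some (pc, m)
  end%bool.

(* Run program P from pc with at most [fuel] instructions (the final IHalt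
   included); Some m' iff it halts properly within the budget. *)
Fixpoint run (P : program) (S W : nat) (fuel pc : nat) (m : nat -> nat)
  : option (nat -> nat) :=
  match fuel with
  | O => None
  | Datatypes.S f =>
      match nth_error P pc with
      | None => None
      | Some IHalt => Some m
      | Some ins =>
          match exec1 S W ins pc m with
          | None => None
          | Some (pc', m') => run P S W f pc' m'
          end
      end
  end.

(* Memory after processing steps w 0, ..., w (t-1): for each step, the
   visited node is written to cell 0, the program is run from pc 0 with at
   most c+1 instructions; its answer is then read from cell 1. *)
Fixpoint ds_state (P : program) (c S W : nat) (M0 : nat -> nat)
  (w : nat -> nat) (t : nat) : option (nat -> nat) :=
  match t with
  | O => Some M0
  | Datatypes.S t' =>
      match ds_state P c S W M0 w t' with
      | None => None
      | Some m => run P S W (Datatypes.S c) 0 (upd m 0 (w t'))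
      end
  end.

(* Main.v *)
(* The values are replaced by their ranks, and the ranks are put in a trie of depth d whose branching
   m is about n^(1/d). The walk, restricted to the nodes with rank below a given trie node, is again
   a walk on a (shorter) cycle, and the successor of x_v is the minimum, over the d + 1 ancestors of
   the rank of v, of the least active rank below that ancestor that exceeds one of only m thresholds.

   This reduces the problem to cycles with m thresholds. Unroll such a cycle to Z. What is active is
   determined by the current run of the walker and a stack of earlier turning points, which
   alternate between both sides, enclose each other and span less than one turn: the first run that
   meets a value decides about it, by the occurrence nearest to the walker. The least active value
   on neither of the last two runs is stored with the stack, one row of m numbers per level; it
   does not change until its level is popped. The contribution of a run is the least value of a
   position z in an interval such that z is an insertion and its value does not recur in (z, b],
   where b is the walker's end of the run. Cut the interval into blocks of size m^h. As b grows, the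
   set of such z in a block changes only when b is the next occurrence of some z in the block, so each
   b causes at most one change per h. There are thus O(N) different sets for each h, and tables of
   size O(m^3) for each set answer a query in O(d) steps. The storage is O(n m^3) = O(n^(1 + 3/d)). *)
Require Import Defs.
From Stdlib Require Import Reals Arith List ZArith Lia Lra Bool FunctionalExtensionality.
Import ListNotations.
Open Scope nat_scope.

(** * A compiled imperative language *)

(** A row of stored minima has m entries, but a turn must cost constant time. Rows are therefore
    filled lazily: a step writes only the entry of the class of its own node, and to this end the
    query code runs at updates too. This suffices because a run that has not yet popped its
    predecessor stays between the ends of that predecessor, so it asks only for classes of nodes
    that the predecessor has visited. Entries left behind by popped levels do no harm, as nothing is
    claimed about an entry until its own level writes it. All runs are made to go right by
    reflecting the coordinates at every turn, which costs a second set of tables. Memory holds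
    residues only; the walker is lifted to the middle third of a window of 3 N positions, and the
    turning points in use lie less than one turn away from it. The program may depend on eps but not
    on n. Hence it reads sizes, table addresses and powers of m from memory, and it is free of
    loops, so that both its running time and the growth of the numbers in one step can be read off
    its text. *)

Inductive aop := AAdd | ASub | AMul | ADiv | AMod.

Definition binop_of (f : aop) : binop :=
  match f with AAdd => BAdd | ASub => BSub | AMul => BMul | ADiv => BDiv | AMod => BMod end.

(* [ER] reads a register, [EL] a heap cell; [CSto] writes the heap, [CIf a b] tests [a < b].
   Registers and heap are kept apart, so that heap writes never change a register. *)
Inductive expr :=
  | EK (k : nat)
  | ER (r : nat)
  | EB (f : aop) (a b : expr)
  | EL (a : expr).

Inductive cmd :=
  | CSkip
  | CSet (r : nat) (e : expr)
  | CSto (a e : expr)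
  | CIf (a b : expr) (c1 c2 : cmd)
  | CSeq (c1 c2 : cmd).

Fixpoint ev (g h : nat -> nat) (e : expr) : nat :=
  match e with
  | EK k => k
  | ER r => g r
  | EB f a b => eval_binop (binop_of f) (ev g h a) (ev g h b)
  | EL a => h (ev g h a)
  end.

Fixpoint safe (H0 S : nat) (g h : nat -> nat) (e : expr) : Prop :=
  match e with
  | EK _ | ER _ => True
  | EB _ a b => safe H0 S g h a /\ safe H0 S g h b
  | EL a => safe H0 S g h a /\ H0 <= ev g h a < S
  end.

(** Weakest precondition. Heap addresses must be at least [H0], which keeps heap accesses off the
    registers and temporaries in the common machine memory. *)
Fixpoint wp (H0 S : nat) (c : cmd) (Q : (nat -> nat) -> (nat -> nat) -> Prop)
  (g h : nat -> nat) : Prop :=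
  match c with
  | CSkip => Q g h
  | CSet r e => safe H0 S g h e /\ Q (upd g r (ev g h e)) h
  | CSto a e => safe H0 S g h a /\ safe H0 S g h e /\ H0 <= ev g h a < S /\
                Q g (upd h (ev g h a) (ev g h e))
  | CIf a b c1 c2 => safe H0 S g h a /\ safe H0 S g h b /\
      if ev g h a <? ev g h b then wp H0 S c1 Q g h else wp H0 S c2 Q g h
  | CSeq c1 c2 => wp H0 S c1 (wp H0 S c2 Q) g h
  end.

Lemma wp_seq H0 S c1 c2 Q g h : wp H0 S c1 (wp H0 S c2 Q) g h -> wp H0 S (CSeq c1 c2) Q g h.
Proof. auto. Qed.

Lemma wp_set H0 S r e (Q : (nat -> nat) -> (nat -> nat) -> Prop) g h v :
  safe H0 S g h e -> ev g h e = v -> Q (upd g r v) h -> wp H0 S (CSet r e) Q g h.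
Proof. intros A <- B. split; auto. Qed.

Lemma wp_sto H0 S a e (Q : (nat -> nat) -> (nat -> nat) -> Prop) g h x v :
  safe H0 S g h a -> safe H0 S g h e -> ev g h a = x -> ev g h e = v ->
  H0 <= x < S -> Q g (upd h x v) -> wp H0 S (CSto a e) Q g h.
Proof. intros A B <- <- C D. repeat split; auto; apply C. Qed.

Lemma wp_if H0 S a b c1 c2 (Q : (nat -> nat) -> (nat -> nat) -> Prop) g h x y :
  safe H0 S g h a -> safe H0 S g h b -> ev g h a = x -> ev g h b = y ->
  (x < y -> wp H0 S c1 Q g h) -> (y <= x -> wp H0 S c2 Q g h) ->
  wp H0 S (CIf a b c1 c2) Q g h.
Proof.
  intros A B <- <- C D. split; [auto|split; [auto|]].
  destruct (Nat.ltb_spec (ev g h a) (ev g h b)); auto.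
Qed.

(** The value ends up in cell [t], and the temporaries from [t] on are scratch. The machine has no
    move instruction; the bitwise or of a cell with itself takes its place. *)
Fixpoint compile_expr (e : expr) (t : nat) : list instr :=
  match e with
  | EK k => [IConst t k]
  | ER r => [IBin BOr t r r]
  | EB f a b => compile_expr a t ++ compile_expr b (t + 1) ++ [IBin (binop_of f) t t (t + 1)]
  | EL a => compile_expr a t ++ [ILoad t t]
  end.

Fixpoint clen (T0 : nat) (c : cmd) : nat :=
  match c with
  | CSkip => 0
  | CSet r e => length (compile_expr e T0) + 1
  | CSto a e => length (compile_expr a T0) + length (compile_expr e (T0 + 1)) + 1
  | CIf a b c1 c2 => length (compile_expr a T0) + length (compile_expr b (T0 + 1)) + 1
                     + clen T0 c2 + 3 + clen T0 c1
  | CSeq c1 c2 => clen T0 c1 + clen T0 c2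
  end.

(** The second branch comes first, as the fall-through of [IJlt]; the jump over the first branch is
    the always true test 0 < 1. All jumps go forward, so the code length also bounds the running
    time. *)
Fixpoint compile (T0 pc : nat) (c : cmd) : list instr :=
  match c with
  | CSkip => []
  | CSet r e => compile_expr e T0 ++ [IBin BOr r T0 T0]
  | CSto a e => compile_expr a T0 ++ compile_expr e (T0 + 1) ++ [IStore T0 (T0 + 1)]
  | CIf a b c1 c2 =>
      let l := length (compile_expr a T0) + length (compile_expr b (T0 + 1)) + 1 in
      let pthen := pc + l + clen T0 c2 + 3 in
      compile_expr a T0 ++ compile_expr b (T0 + 1) ++ [IJlt T0 (T0 + 1) pthen]
      ++ compile T0 (pc + l) c2
      ++ [IConst T0 0; IConst (T0 + 1) 1; IJlt T0 (T0 + 1) (pthen + clen T0 c1)]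
      ++ compile T0 pthen c1
  | CSeq c1 c2 => compile T0 pc c1 ++ compile T0 (pc + clen T0 c1) c2
  end.

Lemma compile_length T0 c : forall pc, length (compile T0 pc c) = clen T0 c.
Proof.
  induction c; simpl; intros; repeat rewrite length_app; simpl;
    repeat rewrite length_app; simpl; repeat rewrite length_app; simpl;
    rewrite ?IHc1, ?IHc2; lia.
Qed.

Fixpoint depth (e : expr) : nat :=
  match e with
  | EK _ | ER _ => 1
  | EB _ a b => Nat.max (depth a) (depth b + 1)
  | EL a => depth a
  end.

Lemma depth_pos e : 1 <= depth e.
Proof. induction e; simpl; lia. Qed.

Fixpoint wfe (T0 : nat) (e : expr) : bool :=
  match e with
  | EK _ => true
  | ER r => r <? T0
  | EB _ a b => wfe T0 a && wfe T0 b
  | EL a => wfe T0 a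
  end.

Fixpoint wfc (T0 TN : nat) (c : cmd) : bool :=
  match c with
  | CSkip => true
  | CSet r e => (r <? T0) && wfe T0 e && (depth e <? TN)
  | CSto a e => wfe T0 a && wfe T0 e && (depth a <? TN) && (depth e <? TN)
  | CIf a b c1 c2 => wfe T0 a && wfe T0 b && (depth a <? TN) && (depth b <? TN)
                     && wfc T0 TN c1 && wfc T0 TN c2
  | CSeq c1 c2 => wfc T0 TN c1 && wfc T0 TN c2
  end.

Fixpoint esize (e : expr) : nat :=
  match e with
  | EK _ | ER _ => 1
  | EB _ a b => esize a + esize b
  | EL a => esize a
  end.

Fixpoint econst (e : expr) : nat :=
  match e with
  | EK k => k
  | ER _ => 0
  | EB _ a b => Nat.max (econst a) (econst b)
  | EL a => econst a
  end.

(* If all cells start at most [B], everything computed by [c] is at most [B ^ growth c]. *)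
Fixpoint growth (c : cmd) : nat :=
  match c with
  | CSkip => 1
  | CSet _ e => esize e
  | CSto a e => esize a + esize e
  | CIf a b c1 c2 => esize a + esize b + growth c1 + growth c2
  | CSeq c1 c2 => growth c1 * growth c2
  end.

Fixpoint cconst (c : cmd) : nat :=
  match c with
  | CSkip => 0
  | CSet _ e => econst e
  | CSto a e => Nat.max (econst a) (econst e)
  | CIf a b c1 c2 => Nat.max (Nat.max (econst a) (econst b)) (Nat.max (cconst c1) (cconst c2))
  | CSeq c1 c2 => Nat.max (cconst c1) (cconst c2)
  end.

Lemma esize_pos e : 1 <= esize e.
Proof. induction e; simpl; lia. Qed.

Lemma growth_pos c : 1 <= growth c.
Proof.
  induction c; simpl; try pose proof (esize_pos e); try pose proof (esize_pos a);
    try pose proof (esize_pos b); try lia; nia.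
Qed.

(** A sum is at most the product because both bounds are at least 2, and quotients and remainders do
    not exceed [x], even for [y = 0]. A left shift would break such a bound, hence its absence from
    [aop]. *)
Lemma eval_aop_bound f x y a b B : 2 <= B -> 1 <= a -> 1 <= b -> x <= B ^ a -> y <= B ^ b ->
  eval_binop (binop_of f) x y <= B ^ (a + b).
Proof.
  intros HB Ha Hb Hx Hy. rewrite Nat.pow_add_r.
  assert (2 <= B ^ a).
  { etransitivity; [|apply Nat.pow_le_mono_r with (b := 1); lia]. simpl; lia. }
  assert (2 <= B ^ b).
  { etransitivity; [|apply Nat.pow_le_mono_r with (b := 1); lia]. simpl; lia. }
  destruct f; simpl.
  - nia.
  - nia.
  - nia.
  - destruct y as [|y]; [simpl; nia|].
    pose proof (Nat.Div0.div_le_upper_bound x (S y) x ltac:(nia)). nia.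
  - pose proof (Nat.Div0.mod_le x y). nia.
Qed.

Lemma ev_bound g h B e : 2 <= B -> (forall r, g r <= B) -> (forall a, h a <= B) ->
  econst e <= B -> ev g h e <= B ^ esize e.
Proof.
  intros HB Hg Hh. induction e; simpl; intros Hc; rewrite ?Nat.mul_1_r; auto.
  - apply eval_aop_bound; auto using esize_pos; [apply IHe1|apply IHe2]; lia.
  - etransitivity; [apply Hh|].
    etransitivity; [|apply Nat.pow_le_mono_r with (b := 1); [lia|apply esize_pos]].
    simpl; lia.
Qed.

(** * Correctness of the compiler *)

Definition code_at (P : program) (pc : nat) (l : list instr) : Prop :=
  forall i ins, nth_error l i = Some ins -> nth_error P (pc + i) = Some ins.

Lemma code_at_app P pc l1 l2 :
  code_at P pc (l1 ++ l2) -> code_at P pc l1 /\ code_at P (pc + length l1) l2.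
Proof.
  intros H; split; intros i ins Hi.
  - apply H. rewrite nth_error_app1; auto. apply nth_error_Some. congruence.
  - rewrite <- Nat.add_assoc. apply H. rewrite nth_error_app2 by lia.
    replace (length l1 + i - length l1) with i by lia. auto.
Qed.

Lemma code_at_cons P pc x l :
  code_at P pc (x :: l) -> nth_error P pc = Some x /\ code_at P (pc + 1) l.
Proof.
  intros H. change (x :: l) with ([x] ++ l) in H. apply code_at_app in H.
  destruct H as [H1 H2]. split; auto. specialize (H1 0 x eq_refl).
  rewrite Nat.add_0_r in H1; auto.
Qed.

(** Quantified over the remaining fuel, so that code fragments compose although [run] yields a
    result only at [IHalt]. *)
Definition reaches P Sz W k pc m pc' m' : Prop :=
  forall f, run P Sz W (k + f) pc m = run P Sz W f pc' m'.

Lemma reaches_trans P Sz W k1 k2 pc m pc1 m1 pc2 m2 :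
  reaches P Sz W k1 pc m pc1 m1 -> reaches P Sz W k2 pc1 m1 pc2 m2 ->
  reaches P Sz W (k1 + k2) pc m pc2 m2.
Proof. intros A B f. rewrite <- Nat.add_assoc, A, B. auto. Qed.

Lemma reaches_refl P Sz W pc m : reaches P Sz W 0 pc m pc m.
Proof. intros f; auto. Qed.

Lemma reaches_one P Sz W pc m ins pc' m' :
  nth_error P pc = Some ins -> ins <> IHalt -> exec1 Sz W ins pc m = Some (pc', m') ->
  reaches P Sz W 1 pc m pc' m'.
Proof.
  intros H1 H2 H3 f. simpl. rewrite H1. destruct ins; try rewrite H3; auto. congruence.
Qed.

Lemma upd_same m a v : upd m a v a = v.
Proof. unfold upd. rewrite Nat.eqb_refl. auto. Qed.

Lemma upd_other m a v b : b <> a -> upd m a v b = m b.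
Proof. unfold upd. intros H. apply Nat.eqb_neq in H. rewrite H. auto. Qed.

Definition represents (T0 H0 : nat) (m g h : nat -> nat) : Prop :=
  (forall r, r < T0 -> m r = g r) /\ (forall a, H0 <= a -> m a = h a).

Lemma represents_temp T0 H0 m g h t v :
  T0 <= t < H0 -> represents T0 H0 m g h -> represents T0 H0 (upd m t v) g h.
Proof.
  intros Ht [A B]; split; intros r Hr; rewrite upd_other by lia; auto.
Qed.

(** The frame condition below [t] keeps the left operand intact in [t] while the right one is
    evaluated from [t + 1] on. *)
Lemma compile_expr_correct P Sz W T0 H0 B g h :
  2 <= B -> (forall r, g r <= B) -> (forall a, h a <= B) -> H0 <= Sz -> T0 <= H0 ->
  forall e t pc m,
  code_at P pc (compile_expr e t) -> T0 <= t -> t + depth e <= H0 ->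
  wfe T0 e = true -> safe H0 Sz g h e -> econst e <= B -> B ^ esize e < W ->
  represents T0 H0 m g h ->
  exists m', reaches P Sz W (length (compile_expr e t)) pc m
                     (pc + length (compile_expr e t)) m' /\
    m' t = ev g h e /\ (forall a, a < t \/ H0 <= a -> m' a = m a).
Proof.
  intros HB Hg Hh HSz HT0. induction e as [k|r|f a IHa b IHb|a IHa]; simpl;
    intros t pc m Hc Ht Hd Hwf Hs Hk HW HR.
  - apply code_at_cons in Hc. exists (upd m t k). split.
    + eapply reaches_one; [apply Hc|discriminate|]. simpl.
      assert (k < W) by (rewrite Nat.mul_1_r in HW; lia).
      rewrite (proj2 (Nat.ltb_lt t Sz)) by lia. rewrite (proj2 (Nat.ltb_lt k W)) by lia.
      simpl. do 2 f_equal. lia.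
    + rewrite upd_same. split; auto. intros; apply upd_other; lia.
  - apply code_at_cons in Hc. exists (upd m t (g r)). apply Nat.ltb_lt in Hwf. split.
    + eapply reaches_one; [apply Hc|discriminate|]. simpl.
      rewrite (proj1 HR r) by auto. rewrite Nat.lor_diag.
      assert (g r < W) by (specialize (Hg r); rewrite Nat.mul_1_r in HW; lia).
      rewrite (proj2 (Nat.ltb_lt t Sz)) by lia. rewrite (proj2 (Nat.ltb_lt r Sz)) by lia.
      rewrite (proj2 (Nat.ltb_lt (g r) W)) by lia.
      simpl. do 2 f_equal. lia.
    + rewrite upd_same. split; auto. intros; apply upd_other; lia.
  - apply andb_true_iff in Hwf. destruct Hwf as [Wa Wb]. destruct Hs as [Sa Sb].
    apply code_at_app in Hc. destruct Hc as [Ca Hc]. apply code_at_app in Hc.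
    destruct Hc as [Cb Cc]. apply code_at_cons in Cc. destruct Cc as [Cc _].
    assert (B ^ esize a <= B ^ (esize a + esize b)) by (apply Nat.pow_le_mono_r; lia).
    assert (B ^ esize b <= B ^ (esize a + esize b)) by (apply Nat.pow_le_mono_r; lia).
    destruct (IHa t pc m) as (m1 & R1 & V1 & F1); auto; try lia.
    destruct (IHb (t + 1) (pc + length (compile_expr a t)) m1) as (m2 & R2 & V2 & F2);
      auto; try lia.
    { split; intros x Hx; rewrite F1 by lia; apply HR; auto. }
    exists (upd m2 t (eval_binop (binop_of f) (ev g h a) (ev g h b))). split.
    + repeat rewrite length_app. simpl. eapply reaches_trans; [apply R1|].
      rewrite !Nat.add_assoc. eapply reaches_trans; [apply R2|].
      eapply reaches_one; [apply Cc|discriminate|]. simpl.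
      rewrite V2. rewrite (F2 t) by lia. rewrite V1.
      assert (Hb : eval_binop (binop_of f) (ev g h a) (ev g h b) < W).
      { eapply Nat.le_lt_trans; [|apply HW]. apply eval_aop_bound; auto using esize_pos;
        apply ev_bound; auto; lia. }
      rewrite (proj2 (Nat.ltb_lt t Sz)) by lia.
      rewrite (proj2 (Nat.ltb_lt (t + 1) Sz)) by (destruct b; simpl in *; lia).
      rewrite (proj2 (Nat.ltb_lt _ W)) by apply Hb. simpl. do 2 f_equal. lia.
    + rewrite upd_same. split; auto. intros x Hx. pose proof (depth_pos a). rewrite upd_other by lia.
      rewrite F2 by lia. apply F1; auto.
  - destruct Hs as [Sa Ha]. apply code_at_app in Hc. destruct Hc as [Ca Cc].
    apply code_at_cons in Cc. destruct Cc as [Cc _].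
    destruct (IHa t pc m) as (m1 & R1 & V1 & F1); auto.
    exists (upd m1 t (h (ev g h a))). split.
    + rewrite length_app. simpl. rewrite Nat.add_assoc. eapply reaches_trans; [apply R1|].
      eapply reaches_one; [apply Cc|discriminate|]. simpl. rewrite V1.
      assert (depth a >= 1) by (clear; induction a; simpl; lia).
      rewrite (proj2 (Nat.ltb_lt t Sz)) by lia.
      rewrite (proj2 (Nat.ltb_lt (ev g h a) Sz)) by lia. simpl.
      rewrite F1 by lia. rewrite (proj2 HR) by lia. rewrite Nat.add_1_r. reflexivity.
    + rewrite upd_same. split; auto. intros x Hx. pose proof (depth_pos a). rewrite upd_other by lia.
      apply F1; auto.
Qed.

(** The value bound takes part in the induction: it excludes overflow of the word size, and each
    command has to hand a bound on to the next one. *)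
Lemma compile_correct P Sz W T0 TN :
  T0 + TN <= Sz -> 2 <= TN ->
  forall c B pc m g h Q,
  code_at P pc (compile T0 pc c) -> wfc T0 TN c = true -> cconst c <= B -> 2 <= B ->
  B ^ growth c < W ->
  (forall r, g r <= B) -> (forall a, h a <= B) ->
  represents T0 (T0 + TN) m g h ->
  wp (T0 + TN) Sz c Q g h ->
  exists k m' g' h', k <= clen T0 c /\ reaches P Sz W k pc m (pc + clen T0 c) m' /\
    represents T0 (T0 + TN) m' g' h' /\ Q g' h' /\
    (forall r, g' r <= B ^ growth c) /\ (forall a, h' a <= B ^ growth c).
Proof.
  intros HSz HTN.
  assert (pow1 : forall B k, 2 <= B -> 1 <= k -> B <= B ^ k).
  { intros B k HB Hk. etransitivity; [|apply Nat.pow_le_mono_r with (b := 1); lia]. simpl; lia. }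
  induction c as [|r e|a e|a b c1 IH1 c2 IH2|c1 IH1 c2 IH2]; simpl;
    intros B pc m g h Q Hc Hwf Hk HB HW Hg Hh HR Hwp.
  - exists 0, m, g, h. rewrite Nat.mul_1_r, Nat.add_0_r.
    repeat split; auto using reaches_refl; apply HR.
  - rewrite !andb_true_iff, !Nat.ltb_lt in Hwf. destruct Hwf as [[W1 W2] W3].
    destruct Hwp as [S1 HQ]. apply code_at_app in Hc. destruct Hc as [C1 C2].
    apply code_at_cons in C2. destruct C2 as [C2 _].
    destruct (compile_expr_correct P Sz W T0 (T0 + TN) B g h HB Hg Hh ltac:(lia) ltac:(lia)
                e T0 pc m) as (m1 & R1 & V1 & F1); auto; try lia.
    assert (Hb : ev g h e <= B ^ esize e) by (apply ev_bound; auto).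
    exists (length (compile_expr e T0) + 1), (upd m1 r (ev g h e)), (upd g r (ev g h e)), h.
    split; [lia|]. split; [|split; [|split; [auto|split]]].
    + rewrite Nat.add_assoc. eapply reaches_trans; [apply R1|].
      eapply reaches_one; [apply C2|discriminate|]. simpl.
      rewrite Nat.lor_diag, V1. rewrite (proj2 (Nat.ltb_lt r Sz)) by lia.
      rewrite (proj2 (Nat.ltb_lt T0 Sz)) by lia.
      rewrite (proj2 (Nat.ltb_lt _ W)) by lia. simpl. do 2 f_equal. lia.
    + split; intros x Hx; unfold upd; destruct (Nat.eqb_spec x r); auto; try lia;
        rewrite F1 by lia; apply HR; auto.
    + intros x. unfold upd. destruct (x =? r); auto. specialize (Hg x).
      pose proof (pow1 B (esize e) HB (esize_pos e)). lia.
    + intros x. specialize (Hh x). pose proof (pow1 B (esize e) HB (esize_pos e)). lia.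
  - rewrite !andb_true_iff, !Nat.ltb_lt in Hwf. destruct Hwf as [[[W1 W2] W3] W4].
    destruct Hwp as [S1 [S2 [S3 HQ]]]. apply code_at_app in Hc. destruct Hc as [C1 C2].
    apply code_at_app in C2. destruct C2 as [C2 C3].
    apply code_at_cons in C3. destruct C3 as [C3 _].
    assert (B ^ esize a <= B ^ (esize a + esize e)) by (apply Nat.pow_le_mono_r; lia).
    assert (B ^ esize e <= B ^ (esize a + esize e)) by (apply Nat.pow_le_mono_r; lia).
    destruct (compile_expr_correct P Sz W T0 (T0 + TN) B g h HB Hg Hh ltac:(lia) ltac:(lia)
                a T0 pc m) as (m1 & R1 & V1 & F1); auto; try lia.
    destruct (compile_expr_correct P Sz W T0 (T0 + TN) B g h HB Hg Hh ltac:(lia) ltac:(lia)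
                e (T0 + 1) (pc + length (compile_expr a T0)) m1) as (m2 & R2 & V2 & F2);
      auto; try lia.
    { split; intros x Hx; rewrite F1 by lia; apply HR; auto. }
    assert (Hb : ev g h e <= B ^ esize e) by (apply ev_bound; auto; lia).
    exists (length (compile_expr a T0) + length (compile_expr e (T0 + 1)) + 1),
      (upd m2 (ev g h a) (ev g h e)), g, (upd h (ev g h a) (ev g h e)).
    split; [lia|]. split; [|split; [|split; [auto|split]]].
    + rewrite !Nat.add_assoc. eapply reaches_trans; [|
      eapply reaches_one; [apply C3|discriminate|]].
      { eapply reaches_trans; [apply R1|]. apply R2. }
      simpl.
      rewrite V2. rewrite (F2 T0) by lia. rewrite V1.
      rewrite (proj2 (Nat.ltb_lt T0 Sz)) by lia. rewrite (proj2 (Nat.ltb_lt (T0 + 1) Sz)) by lia.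
      rewrite (proj2 (Nat.ltb_lt _ Sz)) by lia. simpl. do 2 f_equal. lia.
    + split; intros x Hx; unfold upd; destruct (Nat.eqb_spec x (ev g h a)); auto; try lia;
        rewrite F2, F1 by lia; apply HR; auto.
    + intros x. specialize (Hg x). pose proof (pow1 B (esize a + esize e) HB).
      pose proof (esize_pos a). lia.
    + intros x. unfold upd. destruct (_ =? _); auto; [lia|]. specialize (Hh x).
      pose proof (pow1 B (esize a + esize e) HB). pose proof (esize_pos a). lia.
  - rewrite !andb_true_iff, !Nat.ltb_lt in Hwf. destruct Hwf as [[[[[W1 W2] W3] W4] W5] W6].
    destruct Hwp as [S1 [S2 HQ]]. apply code_at_app in Hc. destruct Hc as [C1 C2].
    apply code_at_app in C2. destruct C2 as [C2 C3].
    apply code_at_cons in C3. destruct C3 as [C3 C4].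
    apply code_at_app in C4. destruct C4 as [C4 C5]. rewrite compile_length in C5.
    apply (code_at_app P _ [_; _; _]) in C5. destruct C5 as [C5 C6].
    apply code_at_cons in C5. destruct C5 as [C5 C5'].
    apply code_at_cons in C5'. destruct C5' as [C5' C5''].
    apply code_at_cons in C5''. destruct C5'' as [C5'' _].
    pose proof (growth_pos c1) as Gp1. pose proof (growth_pos c2) as Gp2.
    pose proof (esize_pos a) as Ep1. pose proof (esize_pos b) as Ep2.
    set (G := esize a + esize b + growth c1 + growth c2) in *.
    assert (B ^ esize a <= B ^ G) by (apply Nat.pow_le_mono_r; lia).
    assert (B ^ esize b <= B ^ G) by (apply Nat.pow_le_mono_r; lia).
    assert (E1 : B ^ growth c1 <= B ^ G) by (apply Nat.pow_le_mono_r; lia).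
    assert (E2 : B ^ growth c2 <= B ^ G) by (apply Nat.pow_le_mono_r; lia).
    pose proof (pow1 B G HB ltac:(lia)).
    destruct (compile_expr_correct P Sz W T0 (T0 + TN) B g h HB Hg Hh ltac:(lia) ltac:(lia)
                a T0 pc m) as (m1 & R1 & V1 & F1); auto; try lia.
    destruct (compile_expr_correct P Sz W T0 (T0 + TN) B g h HB Hg Hh ltac:(lia) ltac:(lia)
                b (T0 + 1) (pc + length (compile_expr a T0)) m1) as (m2 & R2 & V2 & F2);
      auto; try lia.
    { split; intros x Hx; rewrite F1 by lia; apply HR; auto. }
    assert (HR2 : represents T0 (T0 + TN) m2 g h).
    { split; intros x Hx; rewrite F2, F1 by lia; apply HR; auto. }
    set (l := length (compile_expr a T0) + length (compile_expr b (T0 + 1)) + 1) in *.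
    replace (pc + length (compile_expr a T0) + length (compile_expr b (T0 + 1)) + 1)
      with (pc + l) in * by (unfold l; lia).
    set (pth := pc + l + clen T0 c2 + 3) in *.
    assert (R3 : reaches P Sz W l pc m (if ev g h a <? ev g h b then pth else pc + l) m2).
    { unfold l. eapply reaches_trans; [eapply reaches_trans; [apply R1|apply R2]|].
      eapply reaches_one; [apply C3|discriminate|]. simpl.
      rewrite V2. rewrite (F2 T0) by lia. rewrite V1.
      rewrite (proj2 (Nat.ltb_lt T0 Sz)) by lia. rewrite (proj2 (Nat.ltb_lt (T0 + 1) Sz)) by lia.
      simpl. do 2 f_equal. destruct (_ <? _); auto. unfold l; lia. }
    destruct (ev g h a <? ev g h b).
    + change (length [_; _; _]) with 3 in C6.
      destruct (IH1 B pth m2 g h Q) as (k & m' & g' & h' & Hk' & Rr & HR' & HQ' & Hg' & Hh');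
        auto; try lia.
      exists (l + k), m', g', h'. split; [lia|]. split.
      { replace (pc + (l + clen T0 c2 + 3 + clen T0 c1)) with (pth + clen T0 c1)
          by (unfold pth; lia).
        eapply reaches_trans; [apply R3|apply Rr]. }
      split; [auto|]. split; [auto|]. split; intros x; [specialize (Hg' x)|specialize (Hh' x)]; lia.
    + destruct (IH2 B (pc + l) m2 g h Q) as (k & m' & g' & h' & Hk' & Rr & HR' & HQ' & Hg' & Hh');
        auto; try lia.
      exists (l + k + 3), (upd (upd m' T0 0) (T0 + 1) 1), g', h'.
      split; [lia|]. split.
      { eapply reaches_trans; [eapply reaches_trans; [apply R3|apply Rr]|].
        replace 3 with (1 + (1 + 1)) by lia.
        assert (1 < W).
        { pose proof (pow1 B G HB ltac:(lia)). lia. }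
        eapply reaches_trans; [eapply reaches_one; [apply C5|discriminate|]|].
        { simpl. rewrite (proj2 (Nat.ltb_lt T0 Sz)) by lia.
          rewrite (proj2 (Nat.ltb_lt 0 W)) by lia. reflexivity. }
        rewrite Nat.add_1_r in C5', C5''.
        eapply reaches_trans; [eapply reaches_one; [apply C5'|discriminate|]|].
        { simpl. rewrite (proj2 (Nat.ltb_lt (T0 + 1) Sz)) by lia.
          rewrite (proj2 (Nat.ltb_lt 1 W)) by lia. reflexivity. }
        eapply reaches_one.
        { rewrite Nat.add_1_r in C5''. apply C5''. }
        { discriminate. }
        simpl. rewrite (proj2 (Nat.ltb_lt T0 Sz)) by lia.
        rewrite (proj2 (Nat.ltb_lt (T0 + 1) Sz)) by lia. simpl.
        rewrite upd_same. rewrite upd_other by lia. rewrite upd_same. simpl.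
        do 2 f_equal. unfold pth. lia. }
      split.
      { apply represents_temp; [lia|]. apply represents_temp; [lia|auto]. }
      split; [auto|]. split; intros x; [specialize (Hg' x)|specialize (Hh' x)]; lia.
  - rewrite andb_true_iff in Hwf. destruct Hwf as [W1 W2].
    apply code_at_app in Hc. destruct Hc as [C1 C2]. rewrite compile_length in C2.
    pose proof (growth_pos c1) as Gp1. pose proof (growth_pos c2) as Gp2.
    assert (B ^ growth c1 <= B ^ (growth c1 * growth c2)) by (apply Nat.pow_le_mono_r; nia).
    pose proof (pow1 B (growth c1) HB ltac:(lia)).
    destruct (IH1 B pc m g h _ C1 W1 ltac:(lia) HB ltac:(lia) Hg Hh HR Hwp)
      as (k1 & m1 & g1 & h1 & K1 & R1 & HR1 & Q1 & G1 & H1).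
    (* The second command starts from the bound [B ^ growth c1]; this is why exponents multiply in a
       sequence. *)
    rewrite Nat.pow_mul_r in HW.
    destruct (IH2 (B ^ growth c1) (pc + clen T0 c1) m1 g1 h1 Q C2 W2 ltac:(lia) ltac:(lia)
                HW G1 H1 HR1 Q1)
      as (k2 & m2 & g2 & h2 & K2 & R2 & HR2 & Q2 & G2 & H2).
    exists (k1 + k2), m2, g2, h2. split; [lia|]. split.
    { rewrite Nat.add_assoc. eapply reaches_trans; [apply R1|apply R2]. }
    rewrite Nat.pow_mul_r. auto.
Qed.

Definition program_of (T0 : nat) (c : cmd) : program := compile T0 0 c ++ [IHalt].

Theorem program_of_correct Sz W T0 TN c B m g h Q :
  T0 + TN <= Sz -> 2 <= TN -> wfc T0 TN c = true -> cconst c <= B -> 2 <= B ->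
  B ^ growth c < W ->
  (forall r, g r <= B) -> (forall a, h a <= B) ->
  represents T0 (T0 + TN) m g h ->
  wp (T0 + TN) Sz c Q g h ->
  exists m' g' h', run (program_of T0 c) Sz W (S (clen T0 c)) 0 m = Some m' /\
    represents T0 (T0 + TN) m' g' h' /\ Q g' h'.
Proof.
  intros HSz HTN Hwf Hk HB HW Hg Hh HR Hwp.
  destruct (compile_correct (program_of T0 c) Sz W T0 TN HSz HTN c B 0 m g h Q)
    as (k & m' & g' & h' & Hk' & Rr & HR' & HQ' & _ & _); auto.
  { intros i ins Hi. unfold program_of. simpl. rewrite nth_error_app1; auto.
    apply nth_error_Some. congruence. }
  exists m', g', h'. split; [|auto].
  replace (S (clen T0 c)) with (k + S (clen T0 c - k)) by lia. rewrite Rr. simpl.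
  unfold program_of. rewrite nth_error_app2; rewrite compile_length; [|lia].
  rewrite Nat.sub_diag. reflexivity.
Qed.

(** * The static automaton *)

Section LeastElement.
Variable NONE : nat.

(** [NONE] plays infinity, so that the answers for the parts of a set combine by [Nat.min]. *)
Definition ismin (P : nat -> Prop) (t r : nat) : Prop :=
  r <= NONE /\ (r = NONE \/ P r /\ t <= r) /\ forall r', P r' -> t <= r' -> r <= r'.

Lemma ismin_or P Q t a b :
  ismin P t a -> ismin Q t b -> ismin (fun r => P r \/ Q r) t (Nat.min a b).
Proof.
  intros (A1 & A2 & A3) (B1 & B2 & B3). split; [lia|split].
  - destruct (Nat.min_spec a b) as [[? ->]|[? ->]].
    + destruct A2 as [|[]]; auto; right; auto.
    + destruct B2 as [|[]]; auto; right; auto.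
  - intros r' [H|H] Hr; [specialize (A3 r' H Hr)|specialize (B3 r' H Hr)]; lia.
Qed.

Lemma ismin_ext P Q t a : (forall r, P r <-> Q r) -> ismin P t a -> ismin Q t a.
Proof.
  intros H (A1 & A2 & A3). split; [auto|split].
  - destruct A2 as [|[A A']]; auto. right. split; auto. apply H; auto.
  - intros r' Hq; apply A3, H; auto.
Qed.

Lemma ismin_empty P t : (forall r, ~ P r) -> ismin P t NONE.
Proof. intros H. split; [auto|split; auto]. intros r Hr; exfalso; eapply H; eauto. Qed.

Fixpoint least (t : nat) (l : list nat) : nat :=
  match l with
  | [] => NONE
  | x :: l => if t <=? x then Nat.min x (least t l) else least t l
  end.

Lemma least_ismin t l : (forall x, In x l -> x < NONE) -> ismin (fun r => In r l) t (least t l).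
Proof.
  induction l as [|x l IH]; intros H; simpl.
  - apply ismin_empty. auto.
  - assert (IH' := IH (fun y Hy => H y (or_intror Hy))).
    specialize (H x (or_introl eq_refl)).
    destruct (Nat.leb_spec t x).
    + apply (ismin_or (fun r => x = r)); auto. split; [lia|split; auto].
      intros; subst; auto.
    + destruct IH' as (A1 & A2 & A3). split; [auto|split].
      * intuition.
      * intros r' [->|Hr] Ht; [lia|]. apply A3; auto.
Qed.

End LeastElement.

Section Static.
Variables (N m NONE : nat) (ub ib : nat -> bool) (vl th : nat -> nat).
(** Three turns of the unrolled cycle: the walker is placed in the middle one, and runs reach less
    than one turn to either side. *)
Let M := 3 * N.

Definition hit (z y : nat) : bool := ub (z mod N) && (vl (z mod N) =? y).

Definition nohit (z b y : nat) : bool :=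
  negb (existsb (fun z' => hit z' y) (seq (S z) (b - z))).

(** For [z > b] the range is empty and every insertion counts as good. Hence the set of good
    positions only shrinks as [b] grows, and each position leaves it at most once. The intervals
    searched contain no positions beyond [b]. *)
Definition good (z b : nat) : bool := ib (z mod N) && nohit z b (vl (z mod N)).

(* [b] is the first occurrence after [z] of the value of [z], so that [z] is good up to [b - 1] only. *)
Definition isnext (z b : nat) : bool :=
  (z <? b) && ib (z mod N) && hit b (vl (z mod N)) && nohit z (b - 1) (vl (z mod N)).

Definition blocked (h w b : nat) : bool :=
  existsb (fun z => (z / m ^ h =? w) && isnext z b) (seq 0 b).

Fixpoint last_blocked (h w b : nat) : option nat :=
  match b with
  | 0 => None
  | S b' => if blocked h w b then Some b else last_blocked h w b'
  end.

(* The states of the static automaton are the sets {z : z / m^h = w, good z b}.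
   As b grows such a set only changes when b = next(z) for some z in the block w, so it is named
   by the last such b, or by w itself before the first change. *)
Definition state_id (h w b : nat) : nat :=
  h * (2 * M) + match last_blocked h w b with Some b' => b' | None => M + w end.

(** Decoding of a name into height, representative time and block. A remainder [M + w] names block
    [w] before its first change, represented at time 0; a remainder [r < M] names the block of the
    only insertion whose value recurs next at [r]. *)
Definition st_h (s : nat) : nat := s / (2 * M).
Definition st_b (s : nat) : nat := let r := s mod (2 * M) in if r <? M then r else 0.
Definition st_w (s : nat) : nat :=
  let r := s mod (2 * M) in
  if r <? M then
    match find (fun z => isnext z r) (seq 0 r) with Some z => z / m ^ st_h s | None => 0 end
  else r - M.

Definition denotes (s h w b : nat) : Prop :=
  st_h s = h /\ st_w s = w /\ forall z, z / m ^ h = w -> good z (st_b s) = good z b.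

Lemma nohit_spec z b y :
  nohit z b y = true <-> forall z', z < z' <= b -> hit z' y = false.
Proof.
  unfold nohit. rewrite negb_true_iff. split; intros H.
  - intros z' Hz. destruct (hit z' y) eqn:E; auto.
    exfalso. eapply eq_true_false_abs; [|apply H]. apply existsb_exists.
    exists z'. split; auto. apply in_seq. lia.
  - apply not_true_is_false. intros E. apply existsb_exists in E.
    destruct E as (z' & Hin & Hh). apply in_seq in Hin. rewrite H in Hh by lia. discriminate.
Qed.

Hypothesis HN : 1 <= N.
Hypothesis Hm : 2 <= m.
Hypothesis Hib : forall j, ib j = true -> ub j = true.
Hypothesis Hvl : forall j, vl j < NONE.

Lemma isnext_spec z b :
  isnext z b = true <-> z < b /\ ib (z mod N) = true /\ hit b (vl (z mod N)) = true /\
    forall z', z < z' < b -> hit z' (vl (z mod N)) = false.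
Proof.
  unfold isnext. rewrite !andb_true_iff, Nat.ltb_lt, nohit_spec. split.
  - intros [[[A B] C] D]. repeat split; auto. intros; apply D; lia.
  - intros (A & B & C & D). repeat split; auto. intros; apply D; lia.
Qed.

(** Both positions carry the value found at [b], so the later one would be a recurrence of the
    earlier one before [b]. This bounds the number of changes per height by the number of times. *)
Lemma isnext_inj z z' b : isnext z b = true -> isnext z' b = true -> z = z'.
Proof.
  rewrite !isnext_spec. intros (A1 & A2 & A3 & A4) (B1 & B2 & B3 & B4).
  assert (E : vl (z mod N) = vl (z' mod N)).
  { unfold hit in A3, B3. apply andb_true_iff in A3, B3. rewrite !Nat.eqb_eq in *. lia. }
  assert (Hz : hit z (vl (z mod N)) = true).
  { unfold hit. rewrite Nat.eqb_refl, Hib; auto. }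
  assert (Hz' : hit z' (vl (z' mod N)) = true).
  { unfold hit. rewrite Nat.eqb_refl, Hib; auto. }
  destruct (Nat.lt_trichotomy z z') as [H|[H|H]]; auto.
  - rewrite <- E, A4 in Hz' by lia. discriminate.
  - rewrite E, B4 in Hz by lia. discriminate.
Qed.

Lemma good_blocked h z b :
  blocked h (z / m ^ h) (S b) = false -> good z (S b) = good z b.
Proof.
  intros Hb. unfold good. destruct (ib (z mod N)) eqn:Ei; auto. simpl.
  destruct (nohit z b (vl (z mod N))) eqn:E1.
  - rewrite nohit_spec in *. intros z' Hz'.
    destruct (Nat.eq_dec z' (S b)) as [->|]; [|apply E1; lia].
    destruct (hit (S b) (vl (z mod N))) eqn:Eh; auto. exfalso.
    eapply eq_true_false_abs; [|apply Hb]. apply existsb_exists. exists z.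
    split; [apply in_seq; lia|]. rewrite Nat.eqb_refl. simpl. apply isnext_spec.
    repeat split; auto; try lia. intros; apply E1; lia.
  - apply not_true_is_false. intros E2. rewrite nohit_spec in E2.
    assert (nohit z b (vl (z mod N)) = true); [|congruence].
    apply nohit_spec. intros; apply E2; lia.
Qed.

Lemma last_blocked_spec h w b :
  match last_blocked h w b with
  | Some b' => b' <= b /\ 0 < b' /\ blocked h w b' = true /\
               forall z, z / m ^ h = w -> good z b = good z b'
  | None => forall z, z / m ^ h = w -> good z b = good z 0
  end.
Proof.
  induction b as [|b IH]; simpl; auto.
  destruct (blocked h w (S b)) eqn:E.
  - repeat split; auto; lia.
  - destruct (last_blocked h w b) as [b'|].
    + destruct IH as (A & B & C & D). repeat split; auto; try lia.
      intros z Hz. rewrite <- D by auto. subst w; apply (good_blocked h); auto.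
    + intros z Hz. rewrite <- IH by auto. subst w; apply (good_blocked h); auto.
Qed.

Lemma state_id_denotes h w b : w < M -> b < M -> denotes (state_id h w b) h w b.
Proof.
  intros Hw Hb. pose proof (last_blocked_spec h w b) as H.
  unfold denotes, state_id, st_h, st_w, st_b.
  set (r := match last_blocked h w b with Some b' => b' | None => M + w end).
  assert (Hr : r < 2 * M).
  { unfold r. destruct (last_blocked h w b); lia. }
  assert (E1 : (h * (2 * M) + r) / (2 * M) = h).
  { rewrite Nat.div_add_l by lia. rewrite Nat.div_small by lia. lia. }
  assert (E2 : (h * (2 * M) + r) mod (2 * M) = r).
  { rewrite Nat.add_comm, Nat.Div0.mod_add. apply Nat.mod_small; auto. }
  unfold st_h. rewrite E1, E2. split; auto.
  destruct (last_blocked h w b) as [b'|] eqn:E; unfold r.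
  - destruct H as (A & B & C & D). rewrite (proj2 (Nat.ltb_lt b' M)) by lia.
    split; [|intros; symmetry; auto].
    apply existsb_exists in C. destruct C as (z & Hin & Hz).
    apply andb_true_iff in Hz. destruct Hz as [Hz1 Hz2]. apply Nat.eqb_eq in Hz1.
    destruct (find (fun z => isnext z b') (seq 0 b')) as [z'|] eqn:Ef.
    + apply find_some in Ef. rewrite (isnext_inj z' z b'); auto; apply Ef.
    + eapply find_none in Ef; eauto. simpl in Ef. congruence.
  - rewrite (proj2 (Nat.ltb_ge (M + w) M)) by lia. split; [lia|].
    intros; symmetry; auto.
Qed.

Lemma state_id_bound h w b : w < M -> b < M -> state_id h w b < (h + 1) * (2 * M).
Proof.
  intros Hw Hb. unfold state_id. pose proof (last_blocked_spec h w b) as H.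
  destruct (last_blocked h w b); lia.
Qed.

(** The child is named at the representative time of [s] instead of the actual time. Both times give
    the same good positions on the whole block, hence also on its children. *)
Definition st_trans (s k : nat) : nat := state_id (st_h s - 1) (st_w s * m + k) (st_b s).

(** Tabulated for all ranges [lo], [hi] of children and all thresholds [c]; these three indices are
    the source of the factor m^3. *)
Definition st_out (s lo hi c : nat) : nat :=
  least NONE (th c) (map (fun z => vl (z mod N))
    (filter (fun z => (z / m ^ st_h s =? st_w s) && good z (st_b s) &&
                      (lo <=? (z / m ^ (st_h s - 1)) mod m) &&
                      ((z / m ^ (st_h s - 1)) mod m <? hi)) (seq 0 M))).

Lemma div_pow_succ z h : z / m ^ S h = z / m ^ h / m.
Proof.
  rewrite Nat.Div0.div_div. f_equal. rewrite Nat.pow_succ_r'. lia.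
Qed.

Lemma div_pow_split z h : z / m ^ h = z / m ^ S h * m + (z / m ^ h) mod m.
Proof.
  rewrite div_pow_succ. pose proof (Nat.div_mod_eq (z / m ^ h) m). lia.
Qed.

Lemma st_b_bound s : st_b s < M.
Proof.
  unfold st_b. destruct (Nat.ltb_spec (s mod (2 * M)) M); lia.
Qed.

Lemma st_trans_denotes s h a b : a < M -> denotes s (S h) (a / m ^ S h) b ->
  denotes (st_trans s ((a / m ^ h) mod m)) h (a / m ^ h) b.
Proof.
  intros Ha (E1 & E2 & E3). unfold st_trans. rewrite E1, E2.
  replace (S h - 1) with h by lia. rewrite <- div_pow_split.
  assert (Hw : a / m ^ h < M).
  { eapply Nat.le_lt_trans; [|apply Ha]. apply Nat.Div0.div_le_upper_bound.
    assert (1 <= m ^ h) by (pose proof (Nat.pow_nonzero m h); lia). nia. }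
  destruct (state_id_denotes h (a / m ^ h) (st_b s) Hw (st_b_bound s)) as (F1 & F2 & F3).
  split; [auto|split; auto]. intros z Hz. rewrite F3 by auto. apply E3.
  rewrite !div_pow_succ, Hz. auto.
Qed.

Lemma st_trans_bound s h a b : a < M -> denotes s (S h) (a / m ^ S h) b ->
  st_trans s ((a / m ^ h) mod m) < (h + 1) * (2 * M).
Proof.
  intros Ha (E1 & E2 & E3). unfold st_trans. rewrite E1, E2.
  replace (S h - 1) with h by lia. rewrite <- div_pow_split.
  apply state_id_bound; [|apply st_b_bound].
  eapply Nat.le_lt_trans; [|apply Ha]. apply Nat.Div0.div_le_upper_bound.
  assert (1 <= m ^ h) by (pose proof (Nat.pow_nonzero m h); lia). nia.
Qed.

Lemma st_out_ismin s h w b lo hi c : denotes s (S h) w b ->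
  ismin NONE (fun r => exists z, z < M /\ z / m ^ S h = w /\ good z b = true /\
                lo <= (z / m ^ h) mod m < hi /\ vl (z mod N) = r)
        (th c) (st_out s lo hi c).
Proof.
  intros (E1 & E2 & E3). unfold st_out. rewrite E1, E2.
  replace (S h - 1) with h by lia.
  eapply ismin_ext; [|apply least_ismin].
  - intros r. rewrite in_map_iff. split.
    + intros (z & Hz & Hf). apply filter_In in Hf. destruct Hf as [Hs Hf].
      rewrite !andb_true_iff in Hf. destruct Hf as [[[F1 F2] F3] F4].
      apply Nat.eqb_eq in F1. apply Nat.leb_le in F3. apply Nat.ltb_lt in F4.
      apply in_seq in Hs. exists z. rewrite E3 in F2 by auto. repeat split; auto; lia.
    + intros (z & Hz & Hw & Hg & [Hl Hh] & Hr). exists z. split; auto.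
      apply filter_In. split; [apply in_seq; lia|]. rewrite E3 by auto.
      rewrite Hw, Nat.eqb_refl, Hg. simpl.
      apply andb_true_iff; rewrite Nat.leb_le, Nat.ltb_lt; auto.
  - intros x Hx. apply in_map_iff in Hx. destruct Hx as (z & <- & _). apply Hvl.
Qed.

(** The blocks of [a] and [e] themselves are left out. At the top both are block 0 and nothing
    qualifies; at [h = 0] blocks are single positions and the set is that of the open interval. The
    search descends from one to the other. *)
Definition between_at (h a e b r : nat) : Prop :=
  exists z, a / m ^ h < z / m ^ h < e / m ^ h /\ good z b = true /\ vl (z mod N) = r.

(** Going down one level, the new blocks are the later siblings in the parent of [a] and the earlier
    siblings in the parent of [e]. *)
Lemma between_at_lt h a e b c s1 s2 r0 : e < M ->
  a / m ^ S h < e / m ^ S h ->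
  denotes s1 (S h) (a / m ^ S h) b -> denotes s2 (S h) (e / m ^ S h) b ->
  ismin NONE (between_at (S h) a e b) (th c) r0 ->
  ismin NONE (between_at h a e b) (th c)
    (Nat.min (Nat.min r0 (st_out s1 ((a / m ^ h) mod m + 1) m c))
             (st_out s2 0 ((e / m ^ h) mod m) c)).
Proof.
  intros He Hlt D1 D2 H0.
  eapply ismin_ext; [|eapply ismin_or; [eapply ismin_or; [apply H0|]|]];
    [|eapply st_out_ismin; eauto|eapply st_out_ismin; eauto].
  intros r. unfold between_at.
  assert (SP : forall z, z / m ^ h = z / m ^ S h * m + (z / m ^ h) mod m /\ (z / m ^ h) mod m < m).
  { intros z. split; [apply div_pow_split|apply Nat.mod_upper_bound; lia]. }
  (* The tables range over positions in the window only; everything before [e] lies in it. *)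
  assert (MO : forall z, z / m ^ h < e / m ^ h -> z < M).
  { intros z Hz. destruct (Nat.lt_ge_cases z e); [lia|].
    pose proof (Nat.Div0.div_le_mono e z (m ^ h) ltac:(auto)). lia. }
  pose proof (SP a) as [Sa La]. pose proof (SP e) as [Se Le].
  split.
  - intros [[(z & Hz & Hg & Hr)|(z & Hz & Hw & Hg & Hd & Hr)]|(z & Hz & Hw & Hg & Hd & Hr)];
      exists z; (split; [|auto]); pose proof (SP z) as [Sz Lz]; nia.
  - intros (z & Hz & Hg & Hr). pose proof (SP z) as [Sz Lz].
    destruct (Nat.lt_trichotomy (a / m ^ S h) (z / m ^ S h)) as [H1|[H1|H1]].
    + destruct (Nat.lt_trichotomy (z / m ^ S h) (e / m ^ S h)) as [H2|[H2|H2]].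
      * left; left. exists z. auto.
      * right. exists z. repeat split; auto; try lia; first [apply MO; lia|nia].
      * exfalso. nia.
    + left; right. exists z. repeat split; auto; try lia; first [apply MO; lia|nia].
    + exfalso. nia.
Qed.

Lemma between_at_eq h a e b c s1 r0 : e < M ->
  a / m ^ S h = e / m ^ S h ->
  denotes s1 (S h) (a / m ^ S h) b ->
  ismin NONE (between_at (S h) a e b) (th c) r0 ->
  ismin NONE (between_at h a e b) (th c)
    (Nat.min r0 (st_out s1 ((a / m ^ h) mod m + 1) ((e / m ^ h) mod m) c)).
Proof.
  intros He Heq D1 H0.
  eapply ismin_ext; [|eapply ismin_or; [apply H0|]]; [|eapply st_out_ismin; eauto].
  intros r. unfold between_at.
  assert (SP : forall z, z / m ^ h = z / m ^ S h * m + (z / m ^ h) mod m /\ (z / m ^ h) mod m < m).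
  { intros z. split; [apply div_pow_split|apply Nat.mod_upper_bound; lia]. }
  assert (MO : forall z, z / m ^ h < e / m ^ h -> z < M).
  { intros z Hz. destruct (Nat.lt_ge_cases z e); [lia|].
    pose proof (Nat.Div0.div_le_mono e z (m ^ h) ltac:(auto)). lia. }
  pose proof (SP a) as [Sa La]. pose proof (SP e) as [Se Le].
  split.
  - intros [(z & Hz & Hg & Hr)|(z & Hz & Hw & Hg & Hd & Hr)];
      exists z; (split; [|auto]); pose proof (SP z) as [Sz Lz]; [lia|].
    rewrite Heq in *. lia.
  - intros (z & Hz & Hg & Hr). pose proof (SP z) as [Sz Lz].
    rewrite <- Heq in *.
    assert (Hq : z / m ^ S h = a / m ^ S h).
    { destruct (Nat.lt_trichotomy (a / m ^ S h) (z / m ^ S h)) as [H1|[H1|H1]]; auto;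
        exfalso; nia. }
    right. exists z. rewrite Hq in Sz. repeat split; auto; first [apply MO; lia|lia].
Qed.

Lemma between_at_top h a e b c : a < m ^ h -> e < m ^ h ->
  ismin NONE (between_at h a e b) (th c) NONE.
Proof.
  intros Ha He. apply ismin_empty. intros r (z & Hz & _).
  rewrite (Nat.div_small a), (Nat.div_small e) in Hz by auto. lia.
Qed.

Lemma between_at_0 a e b r :
  between_at 0 a e b r <-> exists z, a < z < e /\ good z b = true /\ vl (z mod N) = r.
Proof.
  unfold between_at. change (m ^ 0) with 1. split; intros (z & Hz & H); exists z.
  - rewrite !Nat.div_1_r in Hz; auto.
  - rewrite !Nat.div_1_r; auto.
Qed.

End Static.

(** * Walks as stacks of turning points *)

(* The nodes of a cycle of length N, unrolled to Z: update flag, insertion flag, value, query class. *)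
Record labels := Labels { lu : Z -> bool; li : Z -> bool; lv : Z -> nat; lk : Z -> nat }.

Definition opp_labels (L : labels) : labels :=
  Labels (fun z => lu L (- z)%Z) (fun z => li L (- z)%Z) (fun z => lv L (- z)%Z)
         (fun z => lk L (- z)%Z).

Open Scope Z_scope.

Section Ghost.
Variable L : labels.

Definition occurs (z : Z) (y : nat) : Prop := lu L z = true /\ lv L z = y.

Definition seg (v x z : Z) : Prop := v <= z <= x \/ x <= z <= v.

Definition free (v x : Z) (y : nat) : Prop := forall z, seg v x z -> ~ occurs z y.

Definition near (v x : Z) (y : nat) : Prop :=
  exists z, seg v x z /\ occurs z y /\ li L z = true /\
    forall z', seg v z z' -> z' <> z -> ~ occurs z' y.

(* The walker stands at [v]; the list holds its past turning points, most recent first. The first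
   one that has an occurrence of [y] between itself and [v] decides, by the occurrence nearest
   to [v], whether [y] is active. *)
Fixpoint act (v : Z) (l : list Z) (y : nat) : Prop :=
  match l with
  | [] => False
  | x :: l => near v x y \/ (free v x y /\ act v l y)
  end.

(** What the stack says about values missed by the last two runs. Since [[x0, x1]] is free of such a
    value, [x0] may stand for any position of the walker in between; so this does not change while
    the walker stays there. *)
Definition old (l : list Z) (y : nat) : Prop :=
  match l with
  | x0 :: x1 :: l => free x0 x1 y /\ act x0 l y
  | _ => False
  end.

Lemma occurs_dec z y : occurs z y \/ ~ occurs z y.
Proof.
  unfold occurs. destruct (lu L z), (Nat.eq_dec (lv L z) y); intuition congruence.
Qed.

(** Moving the base across a stretch without [y] passes no occurrence, so the nearest one stays the
    same. *)
Lemma near_base v w x y : free v w y -> near v x y -> near w x y.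
Proof.
  intros Hf (z & Hz & Ho & Hi & Hn). exists z.
  assert (~ seg v w z) by (intros Hs; eapply Hf; eauto).
  repeat split; auto; try apply Ho.
  - unfold seg in *; lia.
  - intros z' Hz' Hne Ho'. destruct (Z.eq_dec z' z); auto.
    assert (~ seg v w z') by (intros Hs; eapply Hf; eauto).
    eapply Hn; eauto. unfold seg in *; lia.
Qed.

Lemma free_base v w x y : free v w y -> free v x y -> free w x y.
Proof.
  intros Hf Hx z Hz Ho.
  assert (~ seg v w z) by (intros Hs; eapply Hf; eauto).
  eapply Hx; eauto. unfold seg in *; lia.
Qed.

Lemma free_sym v w y : free v w y -> free w v y.
Proof. intros H z Hz. apply H. unfold seg in *; lia. Qed.

Lemma act_base v w l y : free v w y -> act v l y <-> act w l y.
Proof.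
  intros Hf. pose proof (free_sym _ _ _ Hf) as Hf'.
  induction l as [|x l IH]; simpl; [tauto|]. rewrite IH.
  split; (intros [H|[H1 H2]]; [left|right; split]); eauto using near_base, free_base.
Qed.

Lemma act_here v x l y : occurs v y -> act v (x :: l) y <-> li L v = true.
Proof.
  intros Ho. simpl. split.
  - intros [(z & Hz & Hoz & Hi & Hn)|[Hf _]].
    + destruct (Z.eq_dec v z) as [->|]; auto. exfalso. apply (Hn v); auto. unfold seg; lia.
    + exfalso. apply (Hf v); auto. unfold seg; lia.
  - intros Hi. left. exists v. repeat split; try apply Ho; auto; [unfold seg; lia|].
    intros z' Hz' Hne. exfalso. unfold seg in *; lia.
Qed.

Lemma act_next v v' x l y : occurs v y -> ~ occurs v' y -> (v' = v + 1 \/ v' = v - 1) ->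
  seg v' x v -> act v' (x :: l) y <-> li L v = true.
Proof.
  intros Ho Ho' Hv Hs. simpl. split.
  - intros [(z & Hz & Hoz & Hi & Hn)|[Hf _]].
    + destruct (Z.eq_dec v z) as [->|]; auto.
      destruct (Z.eq_dec v' z) as [->|]; [contradiction|].
      exfalso. apply (Hn v); auto. unfold seg in *; lia.
    + exfalso. apply (Hf v); auto.
  - intros Hi. left. exists v. repeat split; try apply Ho; auto.
    intros z' Hz' Hne. assert (z' = v') by (unfold seg in *; lia). subst; auto.
Qed.

Definition step_act (v : Z) (A : nat -> Prop) (y : nat) : Prop :=
  (occurs v y /\ li L v = true) \/ (~ occurs v y /\ A y).

Lemma act_forward v v' x l y : (v' = v + 1 \/ v' = v - 1) -> seg v' x v ->
  act v' (x :: l) y <-> step_act v' (act v (x :: l)) y.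
Proof.
  intros Hv Hs. unfold step_act. destruct (occurs_dec v' y) as [H'|H'].
  - rewrite act_here by auto. tauto.
  - destruct (occurs_dec v y) as [H|H].
    + rewrite (act_next v) by auto. rewrite (act_here v) by auto. tauto.
    + rewrite (act_base v' v); [tauto|]. intros z Hz.
      assert (z = v \/ z = v') as [->| ->] by (unfold seg in *; lia); auto.
Qed.

(** The pushed entry [v] speaks about the two nodes [v] and [v'] only. An occurrence at [v] was the
    last update of [y] anyway, and without one the older entries decide as before. *)
Lemma act_turn v v' x l y : (v' = v + 1 \/ v' = v - 1) ->
  act v' (v :: x :: l) y <-> step_act v' (act v (x :: l)) y.
Proof.
  intros Hv. unfold step_act. destruct (occurs_dec v' y) as [H'|H'].
  - rewrite act_here by auto. tauto.
  - destruct (occurs_dec v y) as [H|H].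
    + rewrite (act_next v); auto; [|unfold seg; lia]. rewrite (act_here v) by auto. tauto.
    + assert (Hf : free v' v y).
      { intros z Hz. assert (z = v \/ z = v') as [->| ->] by (unfold seg in *; lia); auto. }
      rewrite <- (act_base v' v) by auto.
      change (act v' (v :: x :: l) y) with (near v' v y \/ (free v' v y /\ act v' (x :: l) y)).
      assert (~ near v' v y).
      { intros (z & Hz & Hoz & _). eapply Hf; eauto. }
      tauto.
Qed.

Lemma step_act_same v x l y : act v (x :: l) y <-> step_act v (act v (x :: l)) y.
Proof.
  unfold step_act. destruct (occurs_dec v y) as [H|H]; [rewrite act_here by auto|]; tauto.
Qed.

(** Back at the turning point [v], everything seen since the walker was last there lies in [[v, e]],
    a part of the segment from [v] to [t]. The nearest occurrence in the larger segment therefore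
    decides for both. *)
Lemma act_absorb v e t l y : seg v t e -> act v (e :: v :: t :: l) y <-> act v (t :: l) y.
Proof.
  intros Hs. simpl.
  assert (N1 : near v e y -> near v t y).
  { intros (z & Hz & H). exists z. split; auto. unfold seg in *; lia. }
  assert (N2 : near v v y -> near v t y).
  { intros (z & Hz & H). exists z. split; auto. unfold seg in *; lia. }
  assert (F1 : free v t y -> free v e y).
  { intros Hf z Hz. apply Hf. unfold seg in *; lia. }
  assert (F2 : free v e y -> free v v y).
  { intros Hf z Hz. apply Hf. unfold seg in *; lia. }
  assert (D : near v t y -> near v e y \/ free v e y).
  { intros (z & Hz & Ho & Hi & Hn).
    assert (seg v e z \/ ~ seg v e z) as [Hd|Hd] by (unfold seg; lia).
    - left. exists z. auto.
    - right. intros z' Hz'. apply Hn; unfold seg in *; lia. }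
  tauto.
Qed.

Lemma act_absorb_last v e y : act v [e; v] y <-> act v [e] y.
Proof.
  simpl. assert (near v v y -> near v e y).
  { intros (z & Hz & H). exists z. split; auto. unfold seg in *; lia. }
  tauto.
Qed.

(** After a full turn [e] and [v] are the same node, so an occurrence at [e] is shadowed by the one
    at [v] and [e] can be forgotten. *)
Lemma act_clamp v e y : e < v -> (lu L e = lu L v) -> lv L e = lv L v ->
  act v [e] y <-> act v [e + 1] y.
Proof.
  intros Hlt Eu Ev. simpl.
  assert (near v e y <-> near v (e + 1) y); [|tauto].
  split; intros (z & Hz & Ho & Hi & Hn); exists z; (split; [|auto]); unfold seg in *; try lia.
  destruct (Z.eq_dec z e) as [->|]; [|lia]. exfalso.
  apply (Hn v); [lia|lia|]. unfold occurs in *. rewrite <- Eu, <- Ev. auto.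
Qed.

Hypothesis ins_upd : forall z, li L z = true -> lu L z = true.

Lemma near_left v e y : e <= v ->
  near v e y <-> exists z, e - 1 < z < v + 1 /\
    (li L z = true /\ forall z', z < z' <= v -> ~ occurs z' (lv L z)) /\ lv L z = y.
Proof.
  intros Hle. split.
  - intros (z & Hz & [Ho1 Ho2] & Hi & Hn). exists z. split; [unfold seg in *; lia|]. split; auto.
    split; auto. intros z' Hz'. rewrite Ho2. apply Hn; unfold seg in *; lia.
  - intros (z & Hz & [Hi Hn] & Hy). exists z. subst. split; [unfold seg; lia|].
    split; [split; auto|]. split; auto. intros z' Hz' Hne. apply Hn. unfold seg in *; lia.
Qed.

(** Absence from the current run [[e, v]] and being nearest in [[v, t]] merge into one condition,
    absence from [[e, z)]. After reflection this is the automaton's condition with time [- e]. *)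
Lemma near_right v e t y : e <= v <= t ->
  (free v e y /\ near v t y) <-> exists z, v < z < t + 1 /\
    (li L z = true /\ forall z', e <= z' < z -> ~ occurs z' (lv L z)) /\ lv L z = y.
Proof.
  intros Hle. split.
  - intros [Hf (z & Hz & [Ho1 Ho2] & Hi & Hn)].
    assert (z <> v). { intros ->. apply (Hf v); [unfold seg; lia|split; auto]. }
    exists z. split; [unfold seg in *; lia|]. split; auto.
    split; auto. intros z' Hz'. rewrite Ho2.
    destruct (Z_le_dec z' v); [apply Hf|apply Hn]; unfold seg in *; lia.
  - intros (z & Hz & [Hi Hn] & Hy). subst. split.
    + intros z' Hz'. apply Hn. unfold seg in *; lia.
    + exists z. split; [unfold seg; lia|].
      split; [split; auto|]. split; auto. intros z' Hz' Hne. apply Hn. unfold seg in *; lia.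
Qed.

Lemma act_cases0 v e y : act v [e] y <-> near v e y.
Proof. simpl. tauto. Qed.

Lemma act_cases v e t l y : e <= v <= t ->
  act v (e :: t :: l) y <->
  near v e y \/ (free v e y /\ near v t y) \/ old (e :: t :: l) y.
Proof.
  intros Hle. simpl.
  assert (E : (free v e y /\ free v t y) <-> free e t y).
  { split.
    - intros [H1 H2] z Hz. destruct (Z_le_dec z v); [apply H1|apply H2]; unfold seg in *; lia.
    - intros H; split; intros z Hz; apply H; unfold seg in *; lia. }
  assert (B : free v e y -> act v l y <-> act e l y) by (intros; apply act_base; auto).
  tauto.
Qed.

(** The run from [t2] to [t1] was retraced down to [e], so it still contributes its part [[t2, e)],
    limited to values absent up to [t1]. The rest was already old during the previous run, and its
    minimum is stored. *)
Lemma old_cases e t1 t2 l y : t2 < e -> e <= t1 ->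
  old (e :: t1 :: t2 :: l) y <->
  (exists z, t2 - 1 < z < e /\
     (li L z = true /\ forall z', z < z' <= t1 -> ~ occurs z' (lv L z)) /\ lv L z = y)
  \/ old (t1 :: t2 :: l) y.
Proof.
  intros H1 H2. simpl.
  assert (E : (free e t1 y /\ free e t2 y) <-> free t1 t2 y).
  { split.
    - intros [F1 F2] z Hz. destruct (Z_le_dec z e); [apply F2|apply F1]; unfold seg in *; lia.
    - intros H; split; intros z Hz; apply H; unfold seg in *; lia. }
  assert (B : free e t1 y -> act e l y <-> act t1 l y) by (intros; apply act_base; auto).
  assert (R : (free e t1 y /\ near e t2 y) <->
    exists z, t2 - 1 < z < e /\
     (li L z = true /\ forall z', z < z' <= t1 -> ~ occurs z' (lv L z)) /\ lv L z = y).
  { split.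
    - intros [Hf (z & Hz & [Ho1 Ho2] & Hi & Hn)].
      assert (z <> e). { intros ->. apply (Hf e); [unfold seg; lia|split; auto]. }
      exists z. split; [unfold seg in *; lia|]. split; auto.
      split; auto. intros z' Hz'. rewrite Ho2.
      destruct (Z_le_dec e z'); [apply Hf|apply Hn]; unfold seg in *; lia.
    - intros (z & Hz & [Hi Hn] & Hy). subst. split.
      + intros z' Hz'. apply Hn. unfold seg in *; lia.
      + exists z. split; [unfold seg; lia|].
        split; [split; auto|]. split; auto. intros z' Hz' Hne. apply Hn. unfold seg in *; lia. }
  tauto.
Qed.

(* The turning points alternate between the two sides and enclose each other; [b] tells whether
   the next one lies to the left. All of them fit in one turn of the cycle. *)
Fixpoint alternating (N : Z) (b : bool) (lo hi : Z) (l : list Z) : Prop :=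
  match l with
  | [] => hi - lo < N
  | x :: l => if b then x < lo /\ alternating N false x hi l
              else hi < x /\ alternating N true lo x l
  end.

Lemma alternating_bound N l : forall b lo hi, alternating N b lo hi l ->
  Z.of_nat (length l) + (hi - lo) < N.
Proof.
  induction l as [|x l IH]; intros b lo hi H; cbn [alternating length] in *; [lia|].
  destruct b; destruct H as [H1 H2]; apply IH in H2; lia.
Qed.

Lemma alternating_len N b lo hi l : alternating N b lo hi l -> hi - lo < N.
Proof. intros H. apply alternating_bound in H. lia. Qed.

Variables (NONE : nat) (th : nat -> nat).

(** An entry is claimed only for classes of nodes on the run from [x] to [w]. The start [x] is
    excluded: a later run that gets back to [x] pops this level instead of reading its row. *)
Fixpoint rows_ok (F : nat -> nat -> nat) (w : Z) (l : list Z) : Prop :=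
  match l with
  | [] => True
  | x :: l' => (forall u, x < u <= w \/ w <= u < x ->
                  ismin NONE (old l) (th (lk L u)) (F (length l') (lk L u)))
               /\ rows_ok F x l'
  end.

Lemma rows_ok_frame F F' l : forall w,
  (forall j c, (j < length l)%nat -> F' j c = F j c) -> rows_ok F w l -> rows_ok F' w l.
Proof.
  induction l as [|x l IH]; intros w HF H; simpl; auto.
  destruct H as [H1 H2]. split.
  - intros u Hu. rewrite HF by (simpl; lia). auto.
  - apply IH; auto. intros; apply HF; simpl; lia.
Qed.

End Ghost.

(** * Symmetry under reflection *)

Lemma seg_opp v x z : seg (- v) (- x) z <-> seg v x (- z).
Proof. unfold seg. lia. Qed.

Lemma free_opp L v x y : free (opp_labels L) (- v) (- x) y <-> free L v x y.
Proof.
  unfold free, occurs; simpl. split; intros H z Hz.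
  - specialize (H (- z)). rewrite Z.opp_involutive in H. apply H. apply seg_opp.
    rewrite Z.opp_involutive. auto.
  - apply H. apply seg_opp; auto.
Qed.

Lemma near_opp L v x y : near (opp_labels L) (- v) (- x) y <-> near L v x y.
Proof.
  unfold near, occurs; simpl. split; intros (z & Hz & Ho & Hi & Hn); exists (- z).
  - apply seg_opp in Hz. repeat split; auto; try apply Ho.
    intros z' Hz' Hne. specialize (Hn (- z')). rewrite Z.opp_involutive in Hn. apply Hn; [|lia].
    unfold seg in *; lia.
  - rewrite Z.opp_involutive. repeat split; auto; try apply Ho.
    + apply seg_opp. rewrite Z.opp_involutive; auto.
    + intros z' Hz' Hne. apply Hn; [|lia]. unfold seg in *; lia.
Qed.

Lemma act_opp L v l y : act (opp_labels L) (- v) (map Z.opp l) y <-> act L v l y.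
Proof.
  induction l as [|x l IH]; simpl; [tauto|]. rewrite near_opp, free_opp, IH. tauto.
Qed.

Lemma old_opp L l y : old (opp_labels L) (map Z.opp l) y <-> old L l y.
Proof.
  destruct l as [|x0 [|x1 l]]; simpl; try tauto. rewrite free_opp, act_opp. tauto.
Qed.

Lemma alternating_opp N l : forall b lo hi,
  alternating N b lo hi l -> alternating N (negb b) (- hi) (- lo) (map Z.opp l).
Proof.
  induction l as [|x l IH]; intros b lo hi H; simpl in *; [lia|].
  destruct b; simpl; destruct H as [H1 H2]; apply IH in H2; simpl in H2; split; auto; lia.
Qed.

Lemma rows_ok_opp L NONE th F l : forall w,
  rows_ok L NONE th F w l -> rows_ok (opp_labels L) NONE th F (- w) (map Z.opp l).
Proof.
  induction l as [|x l IH]; intros w H; simpl; auto. destruct H as [H1 H2].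
  split; auto. intros u Hu. rewrite length_map.
  eapply ismin_ext; [|apply H1; lia]. intros r. symmetry.
  apply (old_opp L (x :: l)).
Qed.

(* [ghost L A e v T]: the walker has run from [e] up to [v >= e], and before that turned at [T]. *)
Record ghost (L : labels) (N : Z) (A : nat -> Prop) (e v : Z) (T : list Z) : Prop := {
  g_le : e <= v;
  g_alt : alternating N false e v T;
  g_single : e = v -> T = [];
  g_act : forall y, A y <-> act L v (e :: T) y }.

Definition periodic (L : labels) (N : Z) : Prop := forall z,
  lu L (z + N) = lu L z /\ li L (z + N) = li L z /\ lv L (z + N) = lv L z /\ lk L (z + N) = lk L z.

Lemma ghost_init L N v A : 0 < N -> (forall y, ~ A y) ->
  ghost L N (step_act L v A) v v [].
Proof.
  intros HN HA. split; simpl; auto; try lia. intros y. unfold step_act.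
  destruct (occurs_dec L v y) as [H|H].
  - pose proof (act_here L v v [] y H). simpl in *. tauto.
  - split; [intros [[]|[_ Hy]]; [contradiction|exfalso; eapply HA; eauto]|].
    intros [(z & Hz & Ho & _)|[_ []]]. exfalso. apply H.
    assert (z = v) by (unfold seg in *; lia). subst; auto.
Qed.

Lemma ghost_same L N A e v T : ghost L N A e v T -> ghost L N (step_act L v A) e v T.
Proof.
  intros [H1 H2 H3 H4]. split; auto. intros y. rewrite (step_act_same L v e T y).
  unfold step_act. rewrite H4. tauto.
Qed.

Lemma step_act_ext L v A A' y : (forall y, A y <-> A' y) -> step_act L v A y <-> step_act L v A' y.
Proof. intros H. unfold step_act. rewrite H. tauto. Qed.

(** * Effect of single steps on the stack *)

Section Moves.
Variables (L : labels) (N : Z) (NONE : nat) (th : nat -> nat) (F : nat -> nat -> nat).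
Hypothesis Hper : periodic L N.
Hypothesis HF : forall j c, (j <= 1)%nat -> F j c = NONE.

Lemma row_short l c : (length l <= 1)%nat -> forall x,
  ismin NONE (old L (x :: l)) (th c) (F (length l) c).
Proof.
  intros H x. rewrite HF by auto. apply ismin_empty. intros r.
  destruct l as [|x1 [|x2 l]]; simpl in *; try tauto. lia.
Qed.

Lemma rows_ok_short w l : (length l <= 2)%nat -> rows_ok L NONE th F w l.
Proof.
  revert w. induction l as [|x l IH]; simpl; intros w H; auto.
  split; [|apply IH; lia]. intros u _. apply row_short; lia.
Qed.

(* The row of the current run is required only below [v]: the entry of [v] is filled in next. *)
Definition rows_pre (e v : Z) (T : list Z) : Prop :=
  (forall u, e < u < v -> ismin NONE (old L (e :: T)) (th (lk L u)) (F (length T) (lk L u)))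
  /\ rows_ok L NONE th F e T.

Lemma rows_ok_pre e v T : rows_ok L NONE th F v (e :: T) -> rows_pre e v T.
Proof. intros [H1 H2]. split; auto. intros u Hu. apply H1. lia. Qed.

Lemma forward_none A e v : ghost L N A e v [] -> 2 <= N ->
  ghost L N (step_act L (v + 1) A) (if v + 1 =? e + N then e + 1 else e) (v + 1) [].
Proof.
  intros [H1 H2 H3 H4] HN. simpl in H2.
  assert (E : forall y, step_act L (v + 1) A y <-> act L (v + 1) [e] y).
  { intros y. rewrite (act_forward L v) by (auto; unfold seg; lia). apply step_act_ext; auto. }
  destruct (Z.eqb_spec (v + 1) (e + N)) as [Hc|Hc].
  - split; simpl; auto; try lia. intros y. rewrite E.
    destruct (Hper e) as (P1 & P2 & P3 & _).
    rewrite act_clamp; [simpl; tauto|lia| |]; rewrite Hc; auto.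
  - split; simpl; auto; lia.
Qed.

Lemma forward_stay A e v t l : ghost L N A e v (t :: l) -> t <> v + 1 ->
  ghost L N (step_act L (v + 1) A) e (v + 1) (t :: l).
Proof.
  intros [H1 H2 H3 H4] Ht. simpl in H2. split; try lia.
  - simpl. split; [lia|apply H2].
  - intros y. rewrite (act_forward L v) by (auto; unfold seg; lia). apply step_act_ext; auto.
Qed.

Lemma forward_pop_last A e v : ghost L N A e v [v + 1] ->
  ghost L N (step_act L (v + 1) A) e (v + 1) [].
Proof.
  intros [H1 H2 H3 H4]. simpl in H2. split; auto; try lia.
  - simpl; lia.
  - intros y. rewrite <- act_absorb_last.
    rewrite (act_forward L v) by (auto; unfold seg; lia). apply step_act_ext; auto.
Qed.

(** Reaching the last turning point again cancels two turns at once, and the run that began at [t]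
    resumes. *)
Lemma forward_pop A e v t l : ghost L N A e v (v + 1 :: t :: l) ->
  ghost L N (step_act L (v + 1) A) t (v + 1) l.
Proof.
  intros [H1 H2 H3 H4]. simpl in H2. split; auto; try lia.
  - apply H2.
  - intros y. rewrite <- (act_absorb L (v + 1) e) by (unfold seg; lia).
    rewrite (act_forward L v) by (auto; unfold seg; lia). apply step_act_ext; auto.
Qed.

Lemma rows_pop e v t l :
  rows_ok L NONE th F v (e :: v + 1 :: t :: l) -> rows_pre t (v + 1) l.
Proof.
  intros (_ & _ & H). apply rows_ok_pre. apply H.
Qed.

End Moves.

(** [ghost] knows only runs to the right. A step back is a step to the right in reflected
    coordinates, of a new run that starts at [- v]. *)
Lemma backward_push L N A e v T : ghost L N A e v T -> e < v ->
  forall v' l, v' = - (v - 1) -> l = map Z.opp (e :: T) ->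
  (forall y, step_act (opp_labels L) v' A y <-> act (opp_labels L) v' (- v :: l) y) /\
  (- v <= v') /\ alternating N false (- v) (- v) l.
Proof.
  intros [H1 H2 H3 H4] Hlt v' l -> ->. split; [|split; [lia|]].
  - intros y. simpl map. rewrite (act_turn _ (- v)) by lia. apply step_act_ext.
    intros y'. rewrite H4. symmetry. apply (act_opp L v (e :: T)).
  - simpl. split; [lia|]. apply (alternating_opp N T false e v H2).
Qed.

Section Backward.
Variables (L : labels) (N : Z) (A : nat -> Prop) (e v : Z) (T : list Z).
Hypothesis HG : ghost L N A e v T.
Let v' := - (v - 1).
Let L' := opp_labels L.

Lemma backward_single : e = v -> 2 <= N -> ghost L' N (step_act L' v' A) (- v) v' [].
Proof.
  intros E HN. destruct HG as [H1 H2 H3 H4]. rewrite (H3 E) in *. subst e.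
  unfold v', L'. split; [lia|simpl; lia|auto|]. intros y.
  rewrite (act_forward _ (- v)) by (auto; unfold seg; lia). apply step_act_ext.
  intros y'. rewrite H4. symmetry. apply (act_opp L v [v]).
Qed.

Lemma backward_stay : e < v - 1 -> ghost L' N (step_act L' v' A) (- v) v' (map Z.opp (e :: T)).
Proof.
  intros E. destruct (backward_push L N A e v T HG ltac:(lia) v' _ eq_refl eq_refl) as (P1 & P2 & P3).
  split; auto; unfold v', L' in *; try lia.
  simpl in *. split; [lia|apply P3].
Qed.

Lemma backward_pop_last : e = v - 1 -> T = [] -> 2 <= N ->
  ghost L' N (step_act L' v' A) (- v) v' [].
Proof.
  intros E ET HN. destruct (backward_push L N A e v T HG ltac:(lia) v' _ eq_refl eq_refl) as (P1 & P2
      & P3).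
  split; auto; unfold v', L' in *; try lia.
  - simpl. lia.
  - intros y. rewrite P1. subst e T. simpl map. rewrite act_absorb_last. tauto.
Qed.

Lemma backward_pop t l : e = v - 1 -> T = t :: l ->
  ghost L' N (step_act L' v' A) (- t) v' (map Z.opp l).
Proof.
  intros E ET. destruct (backward_push L N A e v T HG ltac:(lia) v' _ eq_refl eq_refl) as (P1 & P2 & P3).
  subst e T. simpl in P3. destruct HG as [H1 H2 H3 H4]. simpl in H2.
  unfold v', L' in *. split; auto; try lia.
  - apply P3.
  - intros y. rewrite P1. simpl map. rewrite act_absorb by (unfold seg; lia). tauto.
Qed.

End Backward.

(** The row of the new run starts without obligations, as no position lies strictly between [- v]
    and the walker. This is what makes a turn cheap. *)
Lemma rows_turn L NONE th F e v T :
  rows_ok L NONE th F v (e :: T) ->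
  rows_pre (opp_labels L) NONE th F (- v) (- (v - 1)) (map Z.opp (e :: T)).
Proof.
  intros H. split; [intros u Hu; lia|]. apply rows_ok_opp. auto.
Qed.

Lemma rows_turn_pop L NONE th F v t l :
  rows_ok L NONE th F v (v - 1 :: t :: l) ->
  rows_pre (opp_labels L) NONE th F (- t) (- (v - 1)) (map Z.opp l).
Proof.
  intros [_ H]. apply rows_ok_pre. apply (rows_ok_opp L NONE th F (t :: l)). auto.
Qed.

Close Scope Z_scope.

(** * Table search in constant time *)

(* Register 0 holds the visited node, register 1 the answer. Registers below [T0] belong to the
   program, [T0 .. heap0 - 1] are expression temporaries, the heap starts at [heap0]. *)
Definition T0 := 40.
Definition TN := 10.
Definition heap0 := 50.

Definition rNode := 0.
Definition rAns := 1.
Definition rM := 2.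
Definition rNone := 3.
Definition rB := 4.
Definition rN := 5.
Definition rX := 6.
Definition rC := 7.
Definition rDir := 8.
Definition rV := 9.
Definition rE := 10.
Definition rK := 11.
Definition rD := 12.
Definition rXo := 13.
Definition rVo := 14.
Definition rPos := 15.
Definition rEpos := 16.
Definition rT1 := 17.
Definition rOut := 18.
Definition rBest := 19.
Definition rSize := 20.
Definition rRec := 21.
Definition qA := 22.
Definition qE := 23.
Definition qB := 24.
Definition qSide := 25.
Definition sS1 := 26.
Definition sS2 := 27.
Definition sRes := 28.
Definition sKa := 29.
Definition sKe := 30.
Definition sTmp := 31.

Declare Scope expr_scope.
Delimit Scope expr_scope with E.
Bind Scope expr_scope with expr.
Notation "a + b" := (EB AAdd a b) : expr_scope.
Notation "a - b" := (EB ASub a b) : expr_scope.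
Notation "a * b" := (EB AMul a b) : expr_scope.
Notation "a / b" := (EB ADiv a b) : expr_scope.
Notation "a 'mod' b" := (EB AMod a b) : expr_scope.
Coercion ER : nat >-> expr.
Notation "c1 ;;; c2" := (CSeq c1 c2) (at level 90, right associativity).

Definition cN := 0.
Definition cM := 1.
Definition cInfo := 2.
Definition cNodes := 3.
Definition cPow (h : nat) := 4 + h.

Definition const (j : nat) : expr := EL (EK (heap0 + j)).

Definition set_min (r : nat) (e : expr) : cmd := CIf e r (CSet r e) CSkip.

Definition emit (s : nat) (lo hi : expr) : cmd :=
  CSet sTmp (EL (qSide + EK 3 * rN + s * rRec + (rM + ((lo * (rM + EK 1) + hi) * rM + rC)))%E) ;;;
  set_min sRes sTmp.

(* Accounts for the blocks of size [m ^ h] that lie strictly between [qA] and [qE] but inside a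
   block of size [m ^ (h + 1)] containing one of them. *)
Definition search_body (h : nat) : cmd :=
  CSet sKa ((qA / const (cPow h)) mod rM)%E ;;;
  CSet sKe ((qE / const (cPow h)) mod rM)%E ;;;
  CIf (qA / const (cPow (S h)))%E (qE / const (cPow (S h)))%E
    (emit sS1 (sKa + EK 1)%E rM ;;; emit sS2 (EK 0) sKe)
    (emit sS1 (sKa + EK 1)%E sKe) ;;;
  CSet sS1 (EL (qSide + EK 3 * rN + sS1 * rRec + sKa)%E) ;;;
  CSet sS2 (EL (qSide + EK 3 * rN + sS2 * rRec + sKe)%E).

Fixpoint search_loop (h : nat) : cmd :=
  match h with
  | 0 => CSkip
  | S h => search_body h ;;; search_loop h
  end.

(** At height [D] there is a single block, because [3 N <= m ^ D]; both descents start from its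
    state at time [qB]. *)
Definition search (D : nat) : cmd :=
  CSet sS1 (EL (qSide + qB)%E) ;;;
  CSet sS2 sS1 ;;;
  CSet sRes rNone ;;;
  search_loop D.

Ltac regs := repeat first [rewrite upd_same | rewrite upd_other by discriminate].

Section Search.
Variables (Sz D N m NONE : nat) (ub ib : nat -> bool) (vl th : nat -> nat).
Hypothesis HN : 1 <= N.
Hypothesis Hm : 2 <= m.
Hypothesis Hib : forall j, ib j = true -> ub j = true.
Hypothesis Hvl : forall j, vl j < NONE.
Hypothesis HD : 3 * N <= m ^ D.

(** Record of one state: [m] transitions, then the outputs for [lo], [hi] in [0..m] and [c < m]. *)
Definition rec_size : nat := m + (m + 1) * (m + 1) * m.
Definition num_states : nat := (D + 1) * (2 * (3 * N)).

(** Transitions are promised only if they lead to a state number in range: a name that belongs to no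
    block of the window may lead outside, and the stored table then holds 0. *)
Definition tables_at (hp : nat -> nat) (SB : nat) : Prop :=
  (forall b, b < 3 * N -> hp (SB + b) = state_id N m ub ib vl D 0 b) /\
  (forall s k, s < num_states -> k < m -> st_trans N m ub ib vl s k < num_states ->
     hp (SB + 3 * N + s * rec_size + k) = st_trans N m ub ib vl s k) /\
  (forall s lo hi c, s < num_states -> lo <= m -> hi <= m -> c < m ->
     hp (SB + 3 * N + s * rec_size + (m + ((lo * (m + 1) + hi) * m + c))) =
     st_out N m NONE ub ib vl th s lo hi c).

Definition tables_end (SB : nat) : nat := SB + 3 * N + num_states * rec_size.

Lemma out_offset lo hi c : lo <= m -> hi <= m -> c < m ->
  m + ((lo * (m + 1) + hi) * m + c) < rec_size.
Proof. unfold rec_size. intros. nia. Qed.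

Lemma record_addr SB s o : s < num_states -> o < rec_size ->
  SB + 3 * N + s * rec_size + o < tables_end SB.
Proof. unfold tables_end. intros. nia. Qed.

Lemma tables_at_frame hp hp' SB :
  (forall a, SB <= a < tables_end SB -> hp' a = hp a) -> tables_at hp SB -> tables_at hp' SB.
Proof.
  intros H (A1 & A2 & A3). split; [|split].
  - intros b Hb. rewrite H; auto. unfold tables_end. lia.
  - intros s k Hs Hk Ht. rewrite H; auto. split; [lia|].
    apply record_addr; auto. unfold rec_size. lia.
  - intros s lo hi c Hs Hl Hh Hc. rewrite H; auto. split; [lia|].
    apply record_addr; auto. apply out_offset; auto.
Qed.

Variables (hp : nat -> nat) (SB a e b c : nat).
Hypothesis Htab : tables_at hp SB.
Hypothesis Hlo : heap0 <= SB.
Hypothesis Hhi : tables_end SB <= Sz.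
Hypothesis Hpow : forall h, h <= D -> hp (heap0 + cPow h) = m ^ h /\ heap0 + cPow h < Sz.
Hypothesis Hae : a < e.
Hypothesis He : e < 3 * N.
Hypothesis Hb : b < 3 * N.
Hypothesis Hc : c < m.

Definition search_regs (g : nat -> nat) : Prop :=
  g rM = m /\ g rNone = NONE /\ g rN = N /\ g rC = c /\ g rRec = rec_size /\
  g qA = a /\ g qE = e /\ g qB = b /\ g qSide = SB.

Definition scratch_only (g g' : nat -> nat) : Prop :=
  forall r, r < sS1 \/ sTmp < r -> g' r = g r.

Lemma search_regs_scratch g g' : scratch_only g g' -> search_regs g -> search_regs g'.
Proof.
  unfold scratch_only, search_regs, sS1, sTmp. intros H.
  rewrite !H by (cbv; lia). auto.
Qed.

Lemma scratch_upd g g' r v : sS1 <= r <= sTmp -> scratch_only g g' -> scratch_only g (upd g' r v).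
Proof. intros Hr H r' Hr'. rewrite upd_other by lia. apply H; auto. Qed.

Lemma scratch_refl g : scratch_only g g.
Proof. intros r Hr; auto. Qed.

Ltac scratch := repeat (apply scratch_upd; [cbv; lia|]); auto using scratch_refl.

Lemma wp_emit (r : nat) s (lo hi : expr) l u g (Q : (nat -> nat) -> (nat -> nat) -> Prop) :
  search_regs g -> g r = s -> s < num_states ->
  safe heap0 Sz g hp lo -> safe heap0 Sz g hp hi -> ev g hp lo = l -> ev g hp hi = u ->
  l <= m -> u <= m ->
  Q (let g1 := upd g sTmp (st_out N m NONE ub ib vl th s l u c) in
     if st_out N m NONE ub ib vl th s l u c <? g sRes
     then upd g1 sRes (st_out N m NONE ub ib vl th s l u c) else g1) hp ->
  wp heap0 Sz (emit r lo hi) Q g hp.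
Proof.
  intros (E1 & E2 & E3 & E4 & E5 & E6 & E7 & E8 & E9) Er Hs Sl Su El Eu Hl Hu HQ.
  unfold emit, set_min. cbn [wp safe ev eval_binop binop_of].
  rewrite E1, E3, E4, E5, E9, Er, El, Eu.
  rewrite (proj2 (proj2 Htab)) by auto. pose proof (out_offset l u c Hl Hu Hc) as Ho.
  pose proof (record_addr SB s _ Hs Ho) as Ha.
  split; [repeat split; auto; lia|]. regs. cbn [safe]. repeat split; auto.
  destruct (_ <? g sRes); cbn [wp safe ev]; auto.
Qed.

(** [sS1] and [sS2] follow the blocks containing [a] and [e], whose contents are not yet accounted
    for in [sRes]. *)
Definition loop_inv (h : nat) (g : nat -> nat) : Prop :=
  g sS1 < num_states /\ g sS2 < num_states /\
  denotes N m ub ib vl (g sS1) h (a / m ^ h) b /\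
  denotes N m ub ib vl (g sS2) h (e / m ^ h) b /\
  ismin NONE (between_at N m ub ib vl h a e b) (th c) (g sRes).

Lemma min_if x y : (if x <? y then x else y) = Nat.min y x.
Proof. destruct (Nat.ltb_spec x y); lia. Qed.

Lemma wp_search_body h g (Q : (nat -> nat) -> (nat -> nat) -> Prop) :
  S h <= D -> search_regs g -> loop_inv (S h) g ->
  (forall g', scratch_only g g' -> loop_inv h g' -> Q g' hp) ->
  wp heap0 Sz (search_body h) Q g hp.
Proof.
  intros HhD HR (B1 & B2 & D1 & D2 & HI) HQ.
  destruct (Hpow h ltac:(lia)) as [P1 P1']. destruct (Hpow (S h) ltac:(lia)) as [P2 P2'].
  pose proof HR as (E1 & E2 & E3 & E4 & E5 & E6 & E7 & E8 & E9).
  set (ka := (a / m ^ h) mod m). set (ke := (e / m ^ h) mod m).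
  assert (Lka : ka < m) by (apply Nat.mod_upper_bound; lia).
  assert (Lke : ke < m) by (apply Nat.mod_upper_bound; lia).
  unfold search_body, const.
  apply wp_seq. apply wp_set with (v := ka);
    [cbn [safe ev]; repeat split; auto; lia|cbn [ev eval_binop binop_of]; rewrite P1, E1, E6; auto|].
  apply wp_seq. apply wp_set with (v := ke);
    [cbn [safe ev]; repeat split; auto; lia|cbn [ev eval_binop binop_of]; regs; rewrite P1, E1, E7;
        auto|].
  set (g2 := upd (upd g sKa ka) sKe ke).
  assert (S2 : scratch_only g g2).
  { unfold g2. scratch. }
  assert (R2 : search_regs g2) by (eapply search_regs_scratch; eauto).
  assert (V1 : g2 sS1 = g sS1) by (unfold g2; regs; auto).
  assert (V2 : g2 sS2 = g sS2) by (unfold g2; regs; auto).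
  assert (V3 : g2 sRes = g sRes) by (unfold g2; regs; auto).
  assert (V4 : g2 sKa = ka) by (unfold g2; regs; auto).
  assert (V5 : g2 sKe = ke) by (unfold g2; regs; auto).
  assert (NS : num_states = (D + 1) * (2 * (3 * N))) by reflexivity.
  assert (T1 : st_trans N m ub ib vl (g sS1) ka < num_states).
  { eapply Nat.lt_le_trans; [eapply st_trans_bound; eauto; lia|]. rewrite NS.
    apply Nat.mul_le_mono_r. lia. }
  assert (T2 : st_trans N m ub ib vl (g sS2) ke < num_states).
  { eapply Nat.lt_le_trans; [eapply st_trans_bound; eauto; lia|]. rewrite NS.
    apply Nat.mul_le_mono_r. lia. }
  (* Both branches end by moving the two states one level down. *)
  assert (Fin : forall g3, scratch_only g g3 -> search_regs g3 -> g3 sS1 = g sS1 ->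
     g3 sS2 = g sS2 -> g3 sKa = ka -> g3 sKe = ke ->
     ismin NONE (between_at N m ub ib vl h a e b) (th c) (g3 sRes) ->
     wp heap0 Sz (CSet sS1 (EL (qSide + EK 3 * rN + sS1 * rRec + sKa)%E) ;;;
               CSet sS2 (EL (qSide + EK 3 * rN + sS2 * rRec + sKe)%E)) Q g3 hp).
  { intros g3 S3 R3 W1 W2 W4 W5 HI3.
    destruct R3 as (F1 & F2 & F3 & F4 & F5 & F6 & F7 & F8 & F9).
    pose proof (record_addr SB (g sS1) ka B1 ltac:(unfold rec_size; lia)).
    pose proof (record_addr SB (g sS2) ke B2 ltac:(unfold rec_size; lia)).
    apply wp_seq. eapply wp_set; [|cbn [ev eval_binop binop_of]; rewrite F3, F5, F9, W1, W4;
      apply (proj1 (proj2 Htab)); auto|].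
    { cbn [safe ev eval_binop binop_of]. rewrite F3, F5, F9, W1, W4. repeat split; auto; lia. }
    eapply wp_set; [|cbn [ev eval_binop binop_of]; regs; rewrite F3, F5, F9, W2, W5;
      apply (proj1 (proj2 Htab)); auto|].
    { cbn [safe ev eval_binop binop_of]. regs. rewrite F3, F5, F9, W2, W5.
      repeat split; auto; lia. }
    apply HQ.
    - scratch.
    - unfold loop_inv. regs. (split; [auto|split; [auto|split; [|split; [|auto]]]]);
        eapply st_trans_denotes; eauto; lia. }
  apply wp_seq.
  eapply wp_if with (x := a / m ^ S h) (y := e / m ^ S h);
    [cbn [safe ev]; repeat split; auto; lia|cbn [safe ev]; repeat split; auto; lia
    |cbn [ev eval_binop binop_of]; unfold g2; regs; rewrite P2, E6; auto
    |cbn [ev eval_binop binop_of]; unfold g2; regs; rewrite P2, E7; auto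
    |intros Hlt|intros Hge].
  - apply wp_seq.
    apply (wp_emit sS1 (g sS1) _ _ (ka + 1) m); auto;
      try (cbn [safe ev eval_binop binop_of]; rewrite ?V4; auto; try lia; exact (proj1 R2)).
    set (o1 := st_out N m NONE ub ib vl th (g sS1) (ka + 1) m c).
    cbv zeta.
    set (g3 := if o1 <? g2 sRes then _ else _).
    assert (S3 : scratch_only g g3).
    { unfold g3. destruct (_ <? _); scratch. }
    assert (R3 : search_regs g3) by (eapply search_regs_scratch; eauto).
    apply (wp_emit sS2 (g sS2) _ _ 0 ke); auto;
      try (cbn [safe ev]; auto; lia).
    { unfold g3. destruct (_ <? _); regs; auto. }
    { cbn [ev]. unfold g3. destruct (_ <? _); regs; auto. }
    cbv zeta.
    set (o2 := st_out N m NONE ub ib vl th (g sS2) 0 ke c).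
    assert (W : g3 sRes = Nat.min (g sRes) o1).
    { unfold g3. rewrite <- min_if, V3. destruct (_ <? _); regs; auto. }
    apply Fin.
    + destruct (o2 <? g3 sRes); scratch.
    + eapply search_regs_scratch; [|apply HR].
      destruct (o2 <? g3 sRes); scratch.
    + unfold g3. destruct (o2 <? _), (o1 <? _); regs; auto.
    + unfold g3. destruct (o2 <? _), (o1 <? _); regs; auto.
    + unfold g3. destruct (o2 <? _), (o1 <? _); regs; auto.
    + unfold g3. destruct (o2 <? _), (o1 <? _); regs; auto.
    + replace ((if o2 <? g3 sRes then upd (upd g3 sTmp o2) sRes o2 else upd g3 sTmp o2) sRes)
        with (Nat.min (Nat.min (g sRes) o1) o2).
      * eapply between_at_lt; eauto.
      * rewrite <- W, <- min_if. destruct (o2 <? g3 sRes); regs; auto.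
  - assert (Heq : a / m ^ S h = e / m ^ S h).
    { pose proof (Nat.Div0.div_le_mono a e (m ^ S h) ltac:(lia)). lia. }
    apply (wp_emit sS1 (g sS1) _ _ (ka + 1) ke); auto;
      try (cbn [safe ev eval_binop binop_of]; rewrite ?V4; auto; lia).
    set (o1 := st_out N m NONE ub ib vl th (g sS1) (ka + 1) ke c).
    cbv zeta.
    apply Fin.
    + destruct (_ <? _); scratch.
    + eapply search_regs_scratch; [|apply HR].
      destruct (_ <? _); scratch.
    + destruct (_ <? _); regs; auto.
    + destruct (_ <? _); regs; auto.
    + destruct (_ <? _); regs; auto.
    + destruct (_ <? _); regs; auto.
    + replace ((if o1 <? g2 sRes then upd (upd g2 sTmp o1) sRes o1 else upd g2 sTmp o1) sRes)
        with (Nat.min (g sRes) o1).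
      * eapply between_at_eq; eauto.
      * rewrite <- V3, <- min_if. destruct (_ <? _); regs; auto.
Qed.

Lemma scratch_trans g1 g2 g3 : scratch_only g1 g2 -> scratch_only g2 g3 -> scratch_only g1 g3.
Proof. intros A B r Hr. rewrite B, A; auto. Qed.

Lemma wp_search_loop h : forall g (Q : (nat -> nat) -> (nat -> nat) -> Prop),
  h <= D -> search_regs g -> loop_inv h g ->
  (forall g', scratch_only g g' -> loop_inv 0 g' -> Q g' hp) ->
  wp heap0 Sz (search_loop h) Q g hp.
Proof.
  induction h as [|h IH]; intros g Q Hh HR HI HQ.
  - cbn. apply HQ; auto. intros r Hr; auto.
  - apply wp_seq. apply wp_search_body; auto.
    intros g' Hg' HI'. apply IH; auto; [lia|eapply search_regs_scratch; eauto|].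
    intros g'' Hg'' HI''. apply HQ; auto. eapply scratch_trans; eauto.
Qed.

Lemma wp_search g (Q : (nat -> nat) -> (nat -> nat) -> Prop) :
  search_regs g ->
  (forall g', scratch_only g g' ->
     ismin NONE (between_at N m ub ib vl 0 a e b) (th c) (g' sRes) -> Q g' hp) ->
  wp heap0 Sz (search D) Q g hp.
Proof.
  intros HR HQ. pose proof HR as (E1 & E2 & E3 & E4 & E5 & E6 & E7 & E8 & E9).
  unfold search. cbn [wp safe ev eval_binop binop_of]. rewrite E8, E9.
  unfold tables_end in Hhi. rewrite (proj1 Htab) by auto.
  split; [repeat split; auto; lia|]. regs. split; auto. split; auto. rewrite E2.
  apply wp_search_loop; auto.
  - unfold loop_inv. regs.
    rewrite (Nat.div_small a), (Nat.div_small e) by lia.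
    assert (HB : state_id N m ub ib vl D 0 b < num_states).
    { apply state_id_bound; auto; lia. }
    assert (HDn : denotes N m ub ib vl (state_id N m ub ib vl D 0 b) D 0 b).
    { apply state_id_denotes; auto; lia. }
    split; [auto|]. split; [auto|]. split; [auto|]. split; [auto|].
    apply between_at_top; lia.
  - intros g' Hg' (_ & _ & _ & _ & HI). apply HQ; auto.
    eapply scratch_trans; [|apply Hg'].
    scratch.
Qed.

End Search.

(** * Coordinates on the cycle *)

Definition zidx (N : nat) (z : Z) : nat := Z.to_nat (z mod Z.of_nat N).

Definition zlabels (N : nat) (ub ib : nat -> bool) (vl kc : nat -> nat) : labels :=
  Labels (fun z => ub (zidx N z)) (fun z => ib (zidx N z))
         (fun z => vl (zidx N z)) (fun z => kc (zidx N z)).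

Definition reversed {X} (N : nat) (f : nat -> X) (j : nat) : X := f ((N - j) mod N).

Section Coordinates.
Variable N : nat.
Hypothesis HN : 1 <= N.

Lemma zidx_lt z : zidx N z < N.
Proof. unfold zidx. pose proof (Z.mod_pos_bound z (Z.of_nat N)). lia. Qed.

Lemma zidx_Z z : Z.of_nat (zidx N z) = (z mod Z.of_nat N)%Z.
Proof. unfold zidx. pose proof (Z.mod_pos_bound z (Z.of_nat N)). lia. Qed.

Lemma zidx_sub x y : (zidx N x + N - zidx N y) mod N = zidx N (x - y).
Proof.
  apply Nat2Z.inj. rewrite zidx_Z, Nat2Z.inj_mod.
  pose proof (zidx_lt y). rewrite Nat2Z.inj_sub by lia. rewrite Nat2Z.inj_add, !zidx_Z.
  rewrite (Zminus_mod x y).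
  replace (x mod Z.of_nat N + Z.of_nat N - y mod Z.of_nat N)%Z
    with ((x mod Z.of_nat N - y mod Z.of_nat N) + 1 * Z.of_nat N)%Z by lia.
  apply Z_mod_plus_full.
Qed.

Lemma zidx_opp z : zidx N (- z) = (N - zidx N z) mod N.
Proof.
  replace (- z)%Z with (0 - z)%Z by lia. rewrite <- zidx_sub.
  unfold zidx at 1. rewrite Z.mod_0_l by lia. f_equal.
Qed.

Lemma zidx_small z : (0 <= z < Z.of_nat N)%Z -> zidx N z = Z.to_nat z.
Proof. intros H. unfold zidx. rewrite Z.mod_small; auto. Qed.

Lemma zidx_eq x y : (Z.abs (x - y) < Z.of_nat N)%Z -> zidx N x = zidx N y -> x = y.
Proof.
  intros H E. apply (f_equal Z.of_nat) in E. rewrite !zidx_Z in E.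
  pose proof (Z.div_mod x (Z.of_nat N) ltac:(lia)) as Hx.
  pose proof (Z.div_mod y (Z.of_nat N) ltac:(lia)) as Hy.
  set (qx := (x / Z.of_nat N)%Z) in *. set (qy := (y / Z.of_nat N)%Z) in *.
  assert (D : (x - y = Z.of_nat N * (qx - qy))%Z) by lia.
  assert (qx - qy = 0)%Z by nia. rewrite H0 in D. lia.
Qed.

Lemma zidx_period z : zidx N (z + Z.of_nat N) = zidx N z.
Proof. unfold zidx. f_equal. rewrite <- (Z_mod_plus_full z 1). f_equal. lia. Qed.

Lemma zlabels_periodic ub ib vl kc : periodic (zlabels N ub ib vl kc) (Z.of_nat N).
Proof. intros z. simpl. rewrite zidx_period. auto. Qed.

Lemma opp_zlabels ub ib vl kc :
  opp_labels (zlabels N ub ib vl kc) =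
  zlabels N (reversed N ub) (reversed N ib) (reversed N vl) (reversed N kc).
Proof.
  unfold opp_labels, zlabels, reversed. simpl. f_equal;
    apply functional_extensionality; intros z; rewrite zidx_opp; auto.
Qed.

Lemma opp_opp L : opp_labels (opp_labels L) = L.
Proof.
  destruct L. unfold opp_labels. simpl. f_equal;
    apply functional_extensionality; intros z; rewrite Z.opp_involutive; auto.
Qed.

(* For [d = 1] this is [- a] modulo [N]; adding [N] first keeps the subtraction exact for [a <= N]. *)
Definition orient_nat (d a : nat) : nat := (N + a - 2 * d * a) mod N.

(** Node at coordinate [z] when the coordinates are reflected iff [d = 1]. Negating [z] and flipping
    [d] give the same node, so stored nodes survive a turn unchanged. *)
Definition npos (d : nat) (z : Z) : nat := if d =? 0 then zidx N z else zidx N (- z).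

Lemma pos_lt d z : npos d z < N.
Proof. unfold npos. destruct (d =? 0); apply zidx_lt. Qed.

Lemma orient_pos d z : d <= 1 -> orient_nat d (npos d z) = zidx N z.
Proof.
  intros Hd. unfold orient_nat, npos. destruct d as [|[|d]]; [| |lia]; simpl (_ =? _); cbn iota.
  - replace (N + zidx N z - 2 * 0 * zidx N z) with (zidx N z + 1 * N) by lia.
    rewrite Nat.Div0.mod_add. apply Nat.mod_small, zidx_lt.
  - pose proof (zidx_lt (- z)).
    replace (N + zidx N (- z) - 2 * 1 * zidx N (- z)) with (N - zidx N (- z)) by lia.
    rewrite <- zidx_opp. f_equal. lia.
Qed.

Lemma orient_zidx d z : d <= 1 -> orient_nat d (zidx N z) = npos d z.
Proof.
  intros Hd. destruct d as [|[|d]]; [| |lia].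
  - apply (orient_pos 0 z); lia.
  - unfold npos. simpl. rewrite <- (Z.opp_involutive z) at 1.
    apply (orient_pos 1 (- z)%Z). lia.
Qed.

Lemma pos_flip d z : d <= 1 -> npos (1 - d) (- z) = npos d z.
Proof.
  intros Hd. destruct d as [|[|d]]; [| |lia]; unfold npos; simpl; auto.
  f_equal. lia.
Qed.

Lemma pos_eq d x y : (Z.abs (x - y) < Z.of_nat N)%Z -> npos d x = npos d y -> x = y.
Proof.
  unfold npos. intros H E. destruct (d =? 0); apply zidx_eq in E; lia.
Qed.

(* [base v] is the multiple of N that brings [v] to the coordinate [zidx N v + N]. *)
Definition base (v : Z) : Z := (Z.of_nat (zidx N v + N) - v)%Z.

Lemma base_mult v : exists q, base v = (Z.of_nat N * q)%Z.
Proof.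
  exists (1 - v / Z.of_nat N)%Z. unfold base. rewrite Nat2Z.inj_add, zidx_Z.
  pose proof (Z.div_mod v (Z.of_nat N)). lia.
Qed.

Lemma unwrap_self v : zidx N v + N = Z.to_nat (v + base v).
Proof. unfold base. lia. Qed.

(** A residue determines the coordinate because it is known to lie less than one turn behind [v]. *)
Lemma unwrap_behind v e : (0 <= v - e < Z.of_nat N)%Z ->
  zidx N v + N - (zidx N v + N - zidx N e) mod N = Z.to_nat (e + base v).
Proof.
  intros H. rewrite zidx_sub, (zidx_small (v - e)) by lia. unfold base. lia.
Qed.

Lemma unwrap_ahead v t : (0 <= t - v < Z.of_nat N)%Z ->
  zidx N v + N + (zidx N t + N - zidx N v) mod N = Z.to_nat (t + base v).
Proof.
  intros H. rewrite zidx_sub, (zidx_small (t - v)) by lia. unfold base. lia.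
Qed.

Lemma zidx_shift (z : nat) q : zidx N (Z.of_nat z - Z.of_nat N * q) = z mod N.
Proof.
  apply Nat2Z.inj. rewrite zidx_Z, Nat2Z.inj_mod.
  replace (Z.of_nat z - Z.of_nat N * q)%Z with (Z.of_nat z + (- q) * Z.of_nat N)%Z by lia.
  apply Z_mod_plus_full.
Qed.

(** The automaton lives on naturals, the walk on Z; a shift by a multiple of [N] changes no label
    and connects them. *)
Lemma between_zlabels m ub ib vl kc K q a e b r :
  K = (Z.of_nat N * q)%Z -> (0 <= a + K)%Z -> (0 <= b + K)%Z ->
  let L := zlabels N ub ib vl kc in
  between_at N m ub ib vl 0 (Z.to_nat (a + K)) (Z.to_nat (e + K)) (Z.to_nat (b + K)) r <->
  exists z, (a < z < e)%Z /\
    (li L z = true /\ forall z', (z < z' <= b)%Z -> ~ occurs L z' (lv L z)) /\ lv L z = r.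
Proof.
  intros -> Ha Hb L. rewrite between_at_0. set (K := (Z.of_nat N * q)%Z) in *.
  assert (SH : forall z : nat, zidx N (Z.of_nat z - K) = z mod N) by (intros; apply zidx_shift).
  assert (GD : forall z : nat, good N ub ib vl z (Z.to_nat (b + K)) = true <->
    (li L (Z.of_nat z - K) = true /\
     forall z', (Z.of_nat z - K < z' <= b)%Z -> ~ occurs L z' (lv L (Z.of_nat z - K)))).
  { intros z. unfold good. rewrite andb_true_iff. unfold occurs, L, zlabels. simpl.
    rewrite !SH. split; intros [H1 H2]; split; auto.
    - rewrite nohit_spec in H2. intros z' Hz' [O1 O2].
      specialize (H2 (Z.to_nat (z' + K)) ltac:(lia)). unfold hit in H2.
      rewrite <- SH in H2. rewrite Z2Nat.id in H2 by lia.
      replace (z' + K - K)%Z with z' in H2 by lia.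
      rewrite O1, O2, Nat.eqb_refl in H2. discriminate.
    - apply nohit_spec. intros z' Hz'.
      specialize (H2 (Z.of_nat z' - K)%Z ltac:(lia)). rewrite SH in H2.
      unfold hit. destruct (ub (z' mod N)); simpl; auto.
      apply Nat.eqb_neq. intros E. apply H2. auto. }
  split.
  - intros (z & Hz & Hg & Hv). exists (Z.of_nat z - K)%Z. apply GD in Hg.
    split; [lia|split; auto]. unfold L. simpl. rewrite SH. auto.
  - intros (z & Hz & Hg & Hv). exists (Z.to_nat (z + K)).
    assert (E : (Z.of_nat (Z.to_nat (z + K)) - K)%Z = z) by lia.
    split; [lia|]. split.
    + apply GD. rewrite E. auto.
    + rewrite <- SH, E. auto.
Qed.

End Coordinates.

(** * Queries on one cycle *)

Lemma ev_agree bd g g' h e : wfe bd e = true -> (forall r, r < bd -> g' r = g r) ->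
  ev g' h e = ev g h e.
Proof.
  intros Hw Hg. induction e; simpl in *; auto.
  - apply Nat.ltb_lt in Hw. auto.
  - apply andb_true_iff in Hw. rewrite IHe1, IHe2; tauto.
Qed.

Lemma safe_agree bd lo S g g' h e : wfe bd e = true -> (forall r, r < bd -> g' r = g r) ->
  safe lo S g h e -> safe lo S g' h e.
Proof.
  intros Hw Hg. induction e; simpl in *; auto.
  - apply andb_true_iff in Hw. tauto.
  - rewrite (ev_agree bd g g'); tauto.
Qed.

Lemma wp_set_min heap0 S r e (Q : (nat -> nat) -> (nat -> nat) -> Prop) g h v :
  safe heap0 S g h e -> ev g h e = v ->
  (forall g', (forall r', r' <> r -> g' r' = g r') -> g' r = Nat.min (g r) v -> Q g' h) ->
  wp heap0 S (set_min r e) Q g h.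
Proof.
  intros Hs He HQ. unfold set_min.
  apply wp_if with (x := v) (y := g r); [apply Hs|exact I|apply He|reflexivity| |]; intros Hlt.
  - eapply wp_set; [apply Hs|apply He|]. apply HQ.
    + intros; apply upd_other; auto.
    + rewrite upd_same. lia.
  - apply HQ; auto. lia.
Qed.

Definition orient (e : expr) : expr := ((rN + e - EK 2 * rDir * e) mod rN)%E.
(** Absolute difference by truncated subtraction; equality is tested as a distance below 1. *)
Definition distance (a b : expr) : expr := ((a - b) + (b - a))%E.
Definition stack_cell (k : expr) : expr := (rB + EK 4 * rN + k)%E.
Definition row_cell (k : expr) : expr := (rB + EK 5 * rN + (k * rM + rC))%E.

(* The block of an instance at address [rB]: direction (2 if never visited), current node, start
   of the current run, number of turning points; the stack of turning points from offset [4 N],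
   the rows of stored minima from [5 N], then the tables for the two directions. *)
Definition tail_code : cmd :=
  CSto (rB + EK 1)%E rX ;;;
  CIf (EK 0) rK
    (CIf (distance (EL (stack_cell (rK - EK 1)%E)) rX) (EK 1)
       (CIf (EK 1) rK
          (CSto (rB + EK 2)%E (EL (stack_cell (rK - EK 2)%E)) ;;; CSet rK (rK - EK 2)%E)
          (CSet rK (EK 0)))
       CSkip)
    CSkip ;;;
  CSto (rB + EK 3)%E rK.

(** [rD] is 1 for a step in the current direction and [N - 1] for a step back. Forward, the start of
    the run advances if the walker has come full circle. Backward, the old start is pushed unless
    the run has only one node, and the direction flips. *)
Definition move_code : cmd :=
  CSet rXo (orient rX) ;;;
  CSet rVo (orient rV) ;;;
  CSet rD ((rXo + rN - rVo) mod rN)%E ;;;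
  CIf rD (EK 2)
    (CIf (distance rE rX) (EK 1)
       (CSto (rB + EK 2)%E (orient ((orient rE + EK 1) mod rN)%E)) CSkip)
    (CIf (EK 0) (distance rE rV)
       (CSto (stack_cell rK) rE ;;; CSet rK (rK + EK 1)%E) CSkip ;;;
     CSto (rB + EK 2)%E rV ;;;
     CSto rB (EK 1 - rDir)%E) ;;;
  tail_code.

(** The walk can come back to the last visited member without meeting another one, since the nodes
    in between may be no members; the block then stays as it is. *)
Definition arrive_code : cmd :=
  CSet rDir (EL rB) ;;;
  CIf (EK 1) rDir
    (CSto rB (EK 0) ;;; CSto (rB + EK 1)%E rX ;;; CSto (rB + EK 2)%E rX ;;;
     CSto (rB + EK 3)%E (EK 0))
    (CSet rV (EL (rB + EK 1)%E) ;;; CSet rE (EL (rB + EK 2)%E) ;;; CSet rK (EL (rB + EK 3)%E) ;;;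
     CIf (EK 0) (distance rV rX) move_code CSkip).

Definition search_in (D : nat) (dir a e b : expr) : cmd :=
  CSet qSide (rB + (EK 5 + rM) * rN + dir * rSize)%E ;;;
  CSet qA a ;;; CSet qE e ;;; CSet qB b ;;; search D.

Definition behind (e : expr) : expr := (rPos - (rVo + rN - orient e) mod rN)%E.
Definition ahead (e : expr) : expr := (rPos + (orient e + rN - rVo) mod rN)%E.

(* The least active value is sought in the current run, in the run before it (mirrored, with the
   other tables), and among the values on neither of them. The last part combines what
   remains of the run preceding these two with the row stored during the run before the current
   one. *)
Definition query_code (D : nat) : cmd :=
  CSet rDir (EL rB) ;;; CSet rE (EL (rB + EK 2)%E) ;;; CSet rK (EL (rB + EK 3)%E) ;;;
  CSet rVo (orient rX) ;;;
  CSet rPos (rVo + rN)%E ;;;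
  CSet rEpos (behind rE) ;;;
  search_in D rDir (rEpos - EK 1)%E (rPos + EK 1)%E rPos ;;;
  CSet rOut sRes ;;;
  CIf (EK 0) rK
    (CSet rT1 (ahead (EL (stack_cell (rK - EK 1)%E))) ;;;
     search_in D (EK 1 - rDir)%E (EK 3 * rN - rT1 - EK 1)%E (EK 3 * rN - rPos)%E
       (EK 3 * rN - rEpos)%E ;;;
     set_min rOut sRes ;;;
     CIf (EK 1) rK
       (search_in D rDir (behind (EL (stack_cell (rK - EK 2)%E)) - EK 1)%E rEpos rT1 ;;;
        CSet rD (EL (row_cell (rK - EK 1)%E)) ;;;
        set_min sRes rD ;;;
        CSto (row_cell rK) sRes ;;;
        set_min rOut sRes)
       CSkip)
    CSkip.

Definition kept (g g' : nat -> nat) : Prop :=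
  forall r, r <= rC \/ rBest <= r <= rRec -> g' r = g r.

Lemma kept_refl g : kept g g.
Proof. intros r Hr; auto. Qed.

Lemma kept_trans g1 g2 g3 : kept g1 g2 -> kept g2 g3 -> kept g1 g3.
Proof. intros A C r Hr. rewrite C, A; auto. Qed.

Lemma kept_upd g g' r v : rC < r < rBest \/ rRec < r -> kept g g' -> kept g (upd g' r v).
Proof. intros Hr H r' Hr'. rewrite upd_other by (unfold rC, rBest, rRec in *; lia). apply H; auto. Qed.

Section Instance.
Variables (Sz D N m NONE B : nat) (ub ib : nat -> bool) (vl kc th : nat -> nat).
Hypothesis HN : 1 <= N.
Hypothesis Hm : 2 <= m.
Hypothesis Hib : forall j, ib j = true -> ub j = true.
Hypothesis Hvl : forall j, vl j < NONE.
Hypothesis Hkc : forall j, kc j < m.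
Hypothesis HD : 3 * N <= m ^ D.
Hypothesis HNN : N <= NONE.

Definition side_size : nat := 3 * N + num_states D N * rec_size m.
Definition side_base (d : nat) : nat := B + (5 + m) * N + d * side_size.

Hypothesis HB : heap0 + cPow D < B.
Hypothesis HBe : side_base 2 <= Sz.

Definition sided {X} (d : nat) (f : nat -> X) : nat -> X := if d =? 0 then f else reversed N f.

Definition side_labels (d : nat) : labels :=
  if d =? 0 then zlabels N ub ib vl kc else opp_labels (zlabels N ub ib vl kc).

Lemma side_labels_eq d :
  side_labels d = zlabels N (sided d ub) (sided d ib) (sided d vl) (sided d kc).
Proof.
  unfold side_labels, sided. destruct (d =? 0); auto. apply opp_zlabels; auto.
Qed.

Lemma opp_side_labels d : d <= 1 -> opp_labels (side_labels d) = side_labels (1 - d).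
Proof.
  intros Hd. unfold side_labels. destruct d as [|[|d]]; [| |lia]; simpl; auto.
  apply opp_opp.
Qed.

Lemma sided_forall {X} (P : X -> Prop) d f : (forall j, P (f j)) -> forall j, P (sided d f j).
Proof. intros H j. unfold sided, reversed. destruct (d =? 0); auto. Qed.

Lemma sided_ib d j : sided d ib j = true -> sided d ub j = true.
Proof. unfold sided, reversed. destruct (d =? 0); auto. Qed.

Lemma side_labels_ins d z : li (side_labels d) z = true -> lu (side_labels d) z = true.
Proof. rewrite side_labels_eq. simpl. apply sided_ib. Qed.

Lemma side_periodic d : periodic (side_labels d) (Z.of_nat N).
Proof. rewrite side_labels_eq. apply zlabels_periodic; auto. Qed.

Lemma lu_pos d z : lu (side_labels d) z = ub (npos N d z).
Proof. unfold side_labels, npos. destruct (d =? 0); auto. Qed.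
Lemma li_pos d z : li (side_labels d) z = ib (npos N d z).
Proof. unfold side_labels, npos. destruct (d =? 0); auto. Qed.
Lemma lv_pos d z : lv (side_labels d) z = vl (npos N d z).
Proof. unfold side_labels, npos. destruct (d =? 0); auto. Qed.
Lemma lk_pos d z : lk (side_labels d) z = kc (npos N d z).
Proof. unfold side_labels, npos. destruct (d =? 0); auto. Qed.

Definition step_idx (x : nat) (A : nat -> Prop) (y : nat) : Prop :=
  ((ub x = true /\ vl x = y) /\ ib x = true) \/ (~ (ub x = true /\ vl x = y) /\ A y).

Lemma step_act_idx d v A y : step_act (side_labels d) v A y <-> step_idx (npos N d v) A y.
Proof. unfold step_act, step_idx, occurs. rewrite lu_pos, li_pos, lv_pos. reflexivity. Qed.

Definition static_ok (hp : nat -> nat) : Prop :=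
  (forall h, h <= D -> hp (heap0 + cPow h) = m ^ h) /\
  forall d, d <= 1 ->
    tables_at D N m NONE (sided d ub) (sided d ib) (sided d vl) th hp (side_base d).

Lemma side_end d : d <= 1 -> side_base 0 <= side_base d /\
  tables_end D N m (side_base d) <= side_base 2.
Proof. unfold tables_end, side_base, side_size. intros. nia. Qed.

Lemma static_frame hp hp' :
  (forall h, h <= D -> hp' (heap0 + cPow h) = hp (heap0 + cPow h)) ->
  (forall a, side_base 0 <= a < side_base 2 -> hp' a = hp a) -> static_ok hp -> static_ok hp'.
Proof.
  intros H1 H2 [A1 A2]. split.
  - intros h Hh. rewrite H1; auto.
  - intros d Hd. pose proof (side_end d Hd).
    apply (tables_at_frame D N m NONE (sided d ub) (sided d ib) (sided d vl) th HN Hm HD hp hp'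
        (side_base d)); [|apply A2; auto].
    intros a Ha. apply H2. lia.
Qed.

(** Row [j] belongs to a run with [j] turning points before it. For [j <= 1] no value is [old], so
    these rows hold [NONE] forever. *)
Definition rows (hp : nat -> nat) (j c : nat) : nat :=
  if (c <? m) && (j <? N) then hp (B + 5 * N + (j * m + c)) else NONE.

Fixpoint stack_at (hp : nat -> nat) (d : nat) (T : list Z) : Prop :=
  match T with
  | [] => True
  | x :: l => hp (B + 4 * N + length l) = npos N d x /\ stack_at hp d l
  end.

Lemma stack_frame hp hp' d T :
  (forall a, B + 4 * N <= a < B + 4 * N + length T -> hp' a = hp a) ->
  stack_at hp d T -> stack_at hp' d T.
Proof.
  induction T as [|x l IH]; simpl; intros H HS; auto. destruct HS as [H1 H2]. split.
  - rewrite H by lia. auto.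
  - apply IH; auto. intros; apply H; lia.
Qed.

Lemma stack_flip hp d T : d <= 1 -> stack_at hp d T -> stack_at hp (1 - d) (map Z.opp T).
Proof.
  intros Hd. induction T as [|x l IH]; cbn [stack_at map]; auto. intros [H1 H2]. split; auto.
  rewrite length_map, pos_flip; auto.
Qed.

Record block (hp : nat -> nat) (A : nat -> Prop) (x d : nat) (e v : Z) (T : list Z) : Prop := {
  b_dir : d <= 1;
  b_pos : npos N d v = x;
  b_hd : hp B = d;
  b_hx : hp (B + 1) = x;
  b_he : hp (B + 2) = npos N d e;
  b_hk : hp (B + 3) = length T;
  b_hs : stack_at hp d T;
  b_ghost : ghost (side_labels d) (Z.of_nat N) A e v T;
  b_low : forall j c, j <= 1 -> rows hp j c = NONE }.

(** State between arrival and query: the row entry for the walker's own class is still open. The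
    query writes it, which is why it runs at every visit, whatever the operation. *)
Definition block_pre hp A x d e v T : Prop :=
  block hp A x d e v T /\ rows_pre (side_labels d) NONE th (rows hp) e v T.

Definition block_full hp A x d e v T : Prop :=
  block hp A x d e v T /\ rows_ok (side_labels d) NONE th (rows hp) v (e :: T).

Definition inst_regs (x : nat) (g : nat -> nat) : Prop :=
  g rM = m /\ g rNone = NONE /\ g rB = B /\ g rN = N /\ g rX = x /\ g rC = kc x /\
  g rRec = rec_size m /\ g rSize = side_size.

Lemma inst_regs_kept x g g' : kept g g' -> inst_regs x g -> inst_regs x g'.
Proof. unfold kept, inst_regs. intros H. rewrite !H by (cbv; lia). auto. Qed.

Lemma block_len hp A x d e v T : block hp A x d e v T -> length T < N.
Proof.
  intros H. pose proof (g_alt _ _ _ _ _ _ (b_ghost _ _ _ _ _ _ _ H)) as Ha.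
  pose proof (g_le _ _ _ _ _ _ (b_ghost _ _ _ _ _ _ _ H)) as Hl.
  apply alternating_bound in Ha. lia.
Qed.

Lemma block_gap hp A x d e v T : block hp A x d e v T -> (0 <= v - e < Z.of_nat N)%Z.
Proof.
  intros H. pose proof (g_alt _ _ _ _ _ _ (b_ghost _ _ _ _ _ _ _ H)) as Ha.
  pose proof (g_le _ _ _ _ _ _ (b_ghost _ _ _ _ _ _ _ H)) as Hl.
  apply alternating_len in Ha. lia.
Qed.

Lemma wp_search_in x d (dir a e b : expr) g hp (za ze zb K q : Z) c
  (Q : (nat -> nat) -> (nat -> nat) -> Prop) :
  static_ok hp -> inst_regs x g -> d <= 1 -> g rC = c -> c < m ->
  wfe qA dir = true -> wfe qA a = true -> wfe qA e = true -> wfe qA b = true ->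
  safe heap0 Sz g hp dir -> safe heap0 Sz g hp a -> safe heap0 Sz g hp e -> safe heap0 Sz g hp b ->
  ev g hp dir = d ->
  ev g hp a = Z.to_nat (za + K) -> ev g hp e = Z.to_nat (ze + K) ->
  ev g hp b = Z.to_nat (zb + K) ->
  K = (Z.of_nat N * q)%Z ->
  (0 <= za + K)%Z -> (za < ze)%Z -> (ze + K < 3 * Z.of_nat N)%Z ->
  (0 <= zb + K < 3 * Z.of_nat N)%Z ->
  (forall g', (forall r, r < qA -> g' r = g r) ->
     ismin NONE (fun r => exists z, (za < z < ze)%Z /\
       (li (side_labels d) z = true /\
        forall z', (z < z' <= zb)%Z -> ~ occurs (side_labels d) z' (lv (side_labels d) z)) /\
       lv (side_labels d) z = r) (th c) (g' sRes) -> Q g' hp) ->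
  wp heap0 Sz (search_in D dir a e b) Q g hp.
Proof.
  intros HS HR Hd Hc Hcm Wd Wa We Wb Sd Sa Se Sb Ed Ea Ee Eb HK Ha Hae He Hb HQ.
  destruct HR as (R1 & R2 & R3 & R4 & R5 & R6 & R7 & R8).
  unfold search_in. apply wp_seq.
  apply wp_set with (v := side_base d).
  { cbn [safe]. repeat split; auto. }
  { cbn [ev eval_binop binop_of]. rewrite R1, R3, R4, R8, Ed. reflexivity. }
  assert (AG : forall r, r < qA -> upd g qSide (side_base d) r = g r).
  { intros r Hr. apply upd_other. unfold qA, qSide in *; lia. }
  apply wp_seq. apply wp_set with (v := Z.to_nat (za + K)).
  { eapply safe_agree; eauto. }
  { rewrite (ev_agree qA g); auto. }
  set (g1 := upd g qSide (side_base d)) in *.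
  assert (AG2 : forall r, r < qA -> upd g1 qA (Z.to_nat (za + K)) r = g r).
  { intros r Hr. rewrite upd_other by (unfold qA in *; lia). auto. }
  apply wp_seq. apply wp_set with (v := Z.to_nat (ze + K)).
  { eapply safe_agree; eauto. }
  { rewrite (ev_agree qA g); auto. }
  set (g2 := upd g1 qA _) in *.
  assert (AG3 : forall r, r < qA -> upd g2 qE (Z.to_nat (ze + K)) r = g r).
  { intros r Hr. rewrite upd_other by (unfold qA, qE in *; lia). auto. }
  apply wp_seq. apply wp_set with (v := Z.to_nat (zb + K)).
  { eapply safe_agree; eauto. }
  { rewrite (ev_agree qA g); auto. }
  set (g3 := upd g2 qE _) in *.
  assert (AG4 : forall r, r < qA -> upd g3 qB (Z.to_nat (zb + K)) r = g r).
  { intros r Hr. rewrite upd_other by (unfold qA, qB in *; lia). auto. }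
  set (g4 := upd g3 qB _) in *.
  assert (Hse : tables_end D N m (side_base d) <= side_base 2).
  { unfold tables_end, side_base, side_size. nia. }
  eapply (wp_search Sz D N m NONE (sided d ub) (sided d ib) (sided d vl) th HN Hm (sided_ib d)
    (sided_forall (fun y => y < NONE) d vl Hvl) HD hp (side_base d)
    (Z.to_nat (za + K)) (Z.to_nat (ze + K)) (Z.to_nat (zb + K)) c); auto; try lia.
  - apply (proj2 HS); auto.
  - unfold side_base. lia.
  - intros h Hh. split; [apply (proj1 HS); auto|]. unfold side_base, cPow in *. lia.
  - unfold search_regs. rewrite !AG4 by (cbv; lia). unfold g4, g3, g2, g1. regs.
    repeat split; auto.
  - intros g' Hg' HI. apply HQ.
    + intros r Hr. rewrite Hg' by (unfold qA, sS1 in *; lia). auto.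
    + eapply ismin_ext; [|apply HI]. intros r. rewrite side_labels_eq.
      apply (between_zlabels N HN m (sided d ub) (sided d ib) (sided d vl) (sided d kc)
               K q za ze zb r); auto; lia.
Qed.

Lemma block_addr o : o < (5 + m) * N -> heap0 <= B + o < Sz.
Proof. unfold side_base, cPow in *. lia. Qed.

Lemma block_full_frame hp hp' A A' x d e v T :
  (forall a, B <= a < side_base 0 -> hp' a = hp a) -> (forall y, A y <-> A' y) ->
  block_full hp A x d e v T -> block_full hp' A' x d e v T.
Proof.
  intros H HA [HBk HR].
  pose proof (block_len _ _ _ _ _ _ _ HBk) as Hlen.
  destruct HBk as [Hd Hpos Hhd Hhx Hhe Hhk Hhs HG Hlow].
  assert (HF : forall o, o < (5 + m) * N -> hp' (B + o) = hp (B + o)).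
  { intros o Ho. apply H. unfold side_base. lia. }
  assert (HR' : forall j c, rows hp' j c = rows hp j c).
  { intros j c. unfold rows. destruct (Nat.ltb_spec c m), (Nat.ltb_spec j N); simpl; auto.
    rewrite <- Nat.add_assoc. apply HF. nia. }
  split.
  - split; auto; try (rewrite HF by nia; auto).
    + pose proof (HF 0 ltac:(nia)) as E. rewrite Nat.add_0_r in E. congruence.
    + eapply stack_frame; [|apply Hhs]. intros a Ha. apply H. unfold side_base. nia.
    + destruct HG as [G1 G2 G3 G4]. split; auto. intros y. rewrite <- HA. auto.
    + intros j c Hj. rewrite HR'; auto.
  - eapply rows_ok_frame; [|apply HR]. intros j c Hj. apply HR'.
Qed.

Lemma wp_set_gen r e (Q : (nat -> nat) -> (nat -> nat) -> Prop) g h v :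
  safe heap0 Sz g h e -> ev g h e = v ->
  (forall g', (forall r', r' <> r -> g' r' = g r') -> g' r = v -> Q g' h) ->
  wp heap0 Sz (CSet r e) Q g h.
Proof.
  intros A1 A2 A3. eapply wp_set; eauto. apply A3; [|apply upd_same].
  intros; apply upd_other; auto.
Qed.

Lemma ev_orient g h e : g rN = N -> ev g h (orient e) = orient_nat N (g rDir) (ev g h e).
Proof. intros E. cbn. rewrite E. reflexivity. Qed.

Lemma safe_orient g h e : safe heap0 Sz g h e -> safe heap0 Sz g h (orient e).
Proof. intros E. cbn. auto. Qed.

Record run_regs (x d : nat) (e v : Z) (k : nat) (g : nat -> nat) : Prop := {
  q_inst : inst_regs x g;
  q_dir : g rDir = d;
  q_e : g rE = npos N d e;
  q_k : g rK = k;
  q_vo : g rVo = zidx N v;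
  q_pos : g rPos = zidx N v + N;
  q_epos : g rEpos = Z.to_nat (e + base N v) }.

Definition stable (g g' : nat -> nat) : Prop :=
  forall r, r <= rK \/ rVo <= r <= rEpos \/ rBest <= r <= rRec -> g' r = g r.

Lemma run_regs_stable x d e v k g g' : stable g g' -> run_regs x d e v k g ->
  run_regs x d e v k g'.
Proof.
  intros H [[R1 [R2 [R3 [R4 [R5 [R6 [R7 R8]]]]]]] Q1 Q2 Q3 Q4 Q5 Q6].
  split; [unfold inst_regs; repeat split|..]; rewrite H by (cbv; lia); auto.
Qed.

Lemma stable_trans g1 g2 g3 : stable g1 g2 -> stable g2 g3 -> stable g1 g3.
Proof. intros A C r Hr. rewrite C, A; auto. Qed.

Lemma stable_low g g' : (forall r, r < qA -> g' r = g r) -> stable g g'.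
Proof.
  intros H r Hr. apply H. unfold qA, rK, rVo, rEpos, rBest, rRec in *; lia.
Qed.

Lemma stable_one g g' r : (forall r', r' <> r -> g' r' = g r') ->
  (r = rD \/ r = rT1 \/ r = rOut \/ qA <= r) -> stable g g'.
Proof.
  intros H Hr r' Hr'. apply H. unfold rD, rT1, rOut, qA, rK, rVo, rEpos, rBest, rRec in *. lia.
Qed.

Lemma ev_behind x d e v k g h E z : run_regs x d e v k g -> d <= 1 ->
  ev g h E = npos N d z -> (0 <= v - z < Z.of_nat N)%Z ->
  ev g h (behind E) = Z.to_nat (z + base N v).
Proof.
  intros R Hd HE Hz. unfold behind.
  change (ev g h _) with (g rPos - (g rVo + g rN - ev g h (orient E)) mod g rN).
  rewrite ev_orient by apply R.
  destruct R as [[R1 [R2 [R3 [R4 R5]]]] Q1 Q2 Q3 Q4 Q5 Q6].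
  rewrite HE, Q1, Q4, Q5, R4, orient_pos by auto. apply unwrap_behind; auto.
Qed.

Lemma ev_ahead x d e v k g h E z : run_regs x d e v k g -> d <= 1 ->
  ev g h E = npos N d z -> (0 <= z - v < Z.of_nat N)%Z ->
  ev g h (ahead E) = Z.to_nat (z + base N v).
Proof.
  intros R Hd HE Hz. unfold ahead.
  change (ev g h _) with (g rPos + (ev g h (orient E) + g rN - g rVo) mod g rN).
  rewrite ev_orient by apply R.
  destruct R as [[R1 [R2 [R3 [R4 R5]]]] Q1 Q2 Q3 Q4 Q5 Q6].
  rewrite HE, Q1, Q4, Q5, R4, orient_pos by auto. apply unwrap_ahead; auto.
Qed.

Lemma base_bound v : (Z.of_nat N <= v + base N v < 2 * Z.of_nat N)%Z.
Proof. unfold base. pose proof (zidx_lt N HN v). lia. Qed.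

Lemma rows_read hp j c : j < N -> c < m -> hp (B + 5 * N + (j * m + c)) = rows hp j c.
Proof.
  intros H1 H2. unfold rows. rewrite (proj2 (Nat.ltb_lt c m)), (proj2 (Nat.ltb_lt j N)); auto.
Qed.

Lemma row_upd hp j c w j' c' : j < N -> c < m ->
  rows (upd hp (B + 5 * N + (j * m + c)) w) j' c' =
  if (j' =? j) && (c' =? c) then w else rows hp j' c'.
Proof.
  intros Hj Hc. unfold rows. destruct (Nat.ltb_spec j' N) as [Hj'|Hj'].
  2:{ rewrite andb_false_r. destruct (Nat.eqb_spec j' j); [lia|]. auto. }
  rewrite andb_true_r. destruct (Nat.ltb_spec c' m) as [Hc'|Hc'].
  - destruct (Nat.eqb_spec j' j) as [->|Hne]; simpl.
    + destruct (Nat.eqb_spec c' c) as [->|Hne']; [apply upd_same|]. apply upd_other. lia.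
    + apply upd_other. intros E.
      assert (j' * m + c' = j * m + c) by lia.
      assert (j' < j \/ j < j') as [|] by lia; nia.
  - destruct (Nat.eqb_spec c' c); [lia|]. rewrite andb_false_r. auto.
Qed.

Lemma run_c x d e v k g : run_regs x d e v k g -> g rC = kc x.
Proof. intros [[R1 [R2 [R3 [R4 [R5 [R6 R7]]]]]] _ _ _ _ _ _]. auto. Qed.

Ltac search_side R :=
  first [exact (q_inst _ _ _ _ _ _ R) | exact (run_c _ _ _ _ _ _ R) | exact I
        | exact (q_dir _ _ _ _ _ _ R) | assumption | reflexivity
        | (cbn [safe]; repeat split; solve [auto]) | lia].

Lemma wp_query hp A x d e v T g (Q : (nat -> nat) -> (nat -> nat) -> Prop) :
  static_ok hp -> block_pre hp A x d e v T -> inst_regs x g ->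
  (forall g' hp', kept g g' -> block_full hp' A x d e v T ->
     ismin NONE A (th (kc x)) (g' rOut) ->
     (forall a, a < B \/ side_base 0 <= a -> hp' a = hp a) ->
     (forall a, hp' a <= Nat.max (hp a) NONE) -> Q g' hp') ->
  wp heap0 Sz (query_code D) Q g hp.
Proof.
  intros HS [HBk HP] HI HQ.
  pose proof (block_len _ _ _ _ _ _ _ HBk) as Hlen.
  pose proof (block_gap _ _ _ _ _ _ _ HBk) as Hgap.
  destruct HBk as [Hd Hpos Hhd Hhx Hhe Hhk Hhs HG Hlow].
  pose proof (base_mult N HN v) as [q HK]. set (K := base N v) in *.
  pose proof (base_bound v) as HV. fold K in HV.
  assert (Hkcx : kc x = lk (side_labels d) v) by (rewrite lk_pos, Hpos; auto).
  assert (Hcx : kc x < m) by auto.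
  assert (A0 : heap0 <= B < Sz) by (pose proof (block_addr 0); nia).
  assert (A2 : heap0 <= B + 2 < Sz) by (apply block_addr; lia).
  assert (A3 : heap0 <= B + 3 < Sz) by (apply block_addr; lia).
  pose proof HI as (R1 & R2 & R3 & R4 & R5 & R6 & R7 & R8).
  unfold query_code.
  apply wp_seq. apply wp_set_gen with (v := d).
  { cbn [safe ev]. rewrite R3. auto. }
  { cbn [ev]. rewrite R3. auto. }
  intros ga Fa Va.
  apply wp_seq. apply wp_set_gen with (v := npos N d e).
  { cbn [safe ev eval_binop binop_of]. rewrite Fa, R3 by discriminate. auto. }
  { cbn [ev eval_binop binop_of]. rewrite Fa, R3 by discriminate. auto. }
  intros gb Fb Vb.
  apply wp_seq. apply wp_set_gen with (v := length T).
  { cbn [safe ev eval_binop binop_of]. rewrite Fb, Fa, R3 by discriminate. auto. }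
  { cbn [ev eval_binop binop_of]. rewrite Fb, Fa, R3 by discriminate. auto. }
  intros gc Fc Vc.
  apply wp_seq. apply wp_set_gen with (v := zidx N v).
  { apply safe_orient. exact I. }
  { rewrite ev_orient by (rewrite Fc, Fb, Fa by discriminate; auto). cbn [ev].
    rewrite Fc, Fb, Va, Fc, Fb, Fa, R5 by discriminate. rewrite <- Hpos. apply orient_pos; auto. }
  intros gd Fd Vd.
  apply wp_seq. apply wp_set_gen with (v := zidx N v + N).
  { cbn [safe]. auto. }
  { cbn [ev eval_binop binop_of]. rewrite Vd, Fd, Fc, Fb, Fa, R4 by discriminate. auto. }
  intros ge Fe Ve.
  apply wp_seq. apply wp_set_gen with (v := Z.to_nat (e + K)).
  { unfold behind. cbn [safe]. repeat split; auto. }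
  { unfold behind.
    change (ev ge hp _) with (ge rPos - (ge rVo + ge rN - ev ge hp (orient rE)) mod ge rN).
    rewrite ev_orient by (rewrite Fe, Fd, Fc, Fb, Fa by discriminate; auto). cbn [ev].
    rewrite Ve. rewrite (Fe rVo), Vd by discriminate.
    rewrite (Fe rN), Fd, Fc, Fb, Fa, R4 by discriminate.
    rewrite (Fe rDir), Fd, Fc, Fb, Va by discriminate.
    rewrite (Fe rE), Fd, Fc, Vb by discriminate. rewrite orient_pos by auto.
    apply unwrap_behind; auto. }
  intros g1 F1 V1.
  assert (K1 : kept g g1).
  { intros r Hr. rewrite F1, Fe, Fd, Fc, Fb, Fa; auto;
      unfold rC, rBest, rRec, rDir, rE, rK, rVo, rPos, rEpos in *; lia. }
  assert (RR : run_regs x d e v (length T) g1).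
  { split; [eapply inst_regs_kept; eauto|..]; auto.
    - rewrite F1, Fe, Fd, Fc, Fb by discriminate. auto.
    - rewrite F1, Fe, Fd, Fc by discriminate. auto.
    - rewrite F1, Fe, Fd by discriminate. auto.
    - rewrite F1, Fe by discriminate. auto.
    - rewrite F1 by discriminate. auto. }
  clear Fa Va Fb Vb Fc Vc Fd Vd Fe Ve ga gb gc gd ge F1 V1.
  assert (KS : forall g', stable g1 g' -> kept g g').
  { intros g' Hg' r Hr. rewrite Hg', K1; auto. unfold rC, rBest, rRec, rK in *; lia. }
  apply wp_seq.
  apply (wp_search_in x d _ _ _ _ _ _ (e - 1) (v + 1) v K q (kc x)); try (search_side RR).
  { cbn [ev eval_binop binop_of]. rewrite (q_epos _ _ _ _ _ _ RR). fold K. lia. }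
  { cbn [ev eval_binop binop_of]. rewrite (q_pos _ _ _ _ _ _ RR), unwrap_self by auto. fold K. lia. }
  { cbn [ev eval_binop binop_of]. rewrite (q_pos _ _ _ _ _ _ RR), unwrap_self by auto. auto. }
  intros g2 F2 HI2. apply wp_seq. apply wp_set_gen with (v := g2 sRes); [exact I|reflexivity|].
  intros g3 F3 V3.
  set (L := side_labels d) in *.
  assert (Hins : forall z, li L z = true -> lu L z = true) by (intros z; apply side_labels_ins).
  assert (HR0 : ismin NONE (near L v e) (th (kc x)) (g3 rOut)).
  { rewrite V3. eapply ismin_ext; [|apply HI2]. intros r.
    rewrite near_left by (auto; lia). reflexivity. }
  assert (S3 : stable g1 g3).
  { eapply stable_trans; [apply stable_low, F2|]. eapply stable_one; eauto. }
  clear HI2 F2 F3 V3 g2.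
  pose proof (run_regs_stable _ _ _ _ _ _ _ S3 RR) as RR3.
  destruct HG as [G1 G2 G3 G4].
  assert (HFull : forall T0, T = T0 -> length T0 <= 1 ->
    rows_ok L NONE th (rows hp) v (e :: T)).
  { intros T0 -> HT0. apply rows_ok_short; auto. simpl. lia. }
  destruct T as [|t1 T].
  { apply wp_if with (x := 0) (y := 0); [exact I|exact I|reflexivity|apply RR3|lia|intros _].
    apply HQ; auto.
    - split; [split; auto; split; auto|]. eapply HFull; eauto.
    - eapply ismin_ext; [|apply HR0]. intros r. rewrite G4, act_cases0. tauto.
    - lia. }
  simpl in G2. destruct G2 as [G2a G2b].
  pose proof (alternating_len _ _ _ _ _ G2b) as Hspan.
  cbn [stack_at] in Hhs. destruct Hhs as [Hs1 Hs2].
  apply wp_if with (x := 0) (y := S (length T)); [exact I|exact I|reflexivity|apply RR3| |lia].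
  intros _.
  assert (HST : forall g0, run_regs x d e v (S (length T)) g0 -> forall i,
    ev g0 hp (stack_cell (rK - EK i)%E) = B + 4 * N + (S (length T) - i)).
  { intros g0 R0 i. cbn [ev stack_cell eval_binop binop_of].
    rewrite (q_k _ _ _ _ _ _ R0). destruct (q_inst _ _ _ _ _ _ R0) as (U1 & U2 & -> & -> & _). auto. }
  assert (HSS : forall g0, run_regs x d e v (S (length T)) g0 -> forall i,
    safe heap0 Sz g0 hp (EL (stack_cell (rK - EK i)%E))).
  { intros g0 R0 i. change (safe heap0 Sz g0 hp (EL (stack_cell (rK - EK i)%E)))
      with (safe heap0 Sz g0 hp (stack_cell (rK - EK i)%E) /\
            heap0 <= ev g0 hp (stack_cell (rK - EK i)%E) < Sz).
    rewrite HST by auto. split; [cbn; auto 10|].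
    rewrite <- Nat.add_assoc. apply block_addr. simpl in Hlen. nia. }
  apply wp_seq. apply wp_set_gen with (v := Z.to_nat (t1 + K)).
  { unfold ahead. cbn [safe]. repeat split; auto; apply HSS; auto. }
  { eapply ev_ahead; eauto; [|lia].
    change (hp (ev g3 hp (stack_cell (rK - EK 1)%E)) = npos N d t1). rewrite HST by auto.
    rewrite <- Hs1. f_equal. lia. }
  intros g4 F4 V4.
  assert (S4 : stable g1 g4).
  { eapply stable_trans; [apply S3|]. eapply stable_one; eauto. }
  pose proof (run_regs_stable _ _ _ _ _ _ _ S4 RR) as RR4.
  assert (W4 : g4 rOut = g3 rOut) by (apply F4; discriminate).
  apply wp_seq.
  (* The part of the previous run beyond [v], reflected: [- z] sits at [3 N - (z + K)], so the shift
     is [3 N - K]. Time [- e] demands absence from the current run as well. *)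
  apply (wp_search_in x (1 - d) _ _ _ _ _ _ (- t1 - 1) (- v) (- e) (3 * Z.of_nat N - K)
           (3 - q) (kc x)); try (search_side RR4).
  { cbn [ev eval_binop binop_of]. rewrite (q_dir _ _ _ _ _ _ RR4). auto. }
  { cbn [ev eval_binop binop_of]. rewrite V4.
    destruct (q_inst _ _ _ _ _ _ RR4) as (U1 & U2 & U3 & -> & _). lia. }
  { cbn [ev eval_binop binop_of]. rewrite (q_pos _ _ _ _ _ _ RR4), unwrap_self by auto. fold K.
    destruct (q_inst _ _ _ _ _ _ RR4) as (U1 & U2 & U3 & -> & _). lia. }
  { cbn [ev eval_binop binop_of]. rewrite (q_epos _ _ _ _ _ _ RR4). fold K.
    destruct (q_inst _ _ _ _ _ _ RR4) as (U1 & U2 & U3 & -> & _). lia. }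
  intros g5 F5 HI5.
  apply wp_seq. apply wp_set_min with (v := g5 sRes); [exact I|reflexivity|].
  intros g6 F6 V6.
  assert (HR1 : ismin NONE (fun y => near L v e y \/ (free L v e y /\ near L v t1 y))
                  (th (kc x)) (g6 rOut)).
  { rewrite V6. apply ismin_or.
    - rewrite F5, W4 by (cbv; lia). auto.
    - eapply ismin_ext; [|apply HI5]. intros r. rewrite near_right by (auto; lia).
      rewrite <- (opp_side_labels d Hd). fold L. split.
      + intros (z & Hz & [Z1 Z2] & Z3). exists (- z)%Z. split; [lia|]. split; auto. split; auto.
        intros z' Hz' Ho. apply (Z2 (- z')%Z); [lia|]. unfold occurs in *. simpl.
        rewrite Z.opp_involutive. auto.
      + intros (z & Hz & [Z1 Z2] & Z3). exists (- z)%Z. simpl. rewrite Z.opp_involutive.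
        split; [lia|]. split; auto. split; auto.
        intros z' Hz' Ho. apply (Z2 (- z')%Z); [lia|]. unfold occurs in *. simpl in Ho. auto. }
  assert (S6 : stable g1 g6).
  { eapply stable_trans; [apply S4|]. eapply stable_trans; [apply stable_low, F5|].
    eapply stable_one; eauto. }
  pose proof (run_regs_stable _ _ _ _ _ _ _ S6 RR) as RR6.
  assert (T6 : g6 rT1 = Z.to_nat (t1 + K)).
  { rewrite F6, F5 by (cbv; try lia; discriminate). auto. }
  clear HI5 V6 F5 F6 g5.
  destruct T as [|t2 T].
  { apply wp_if with (x := 1) (y := 1); [exact I|exact I|reflexivity|apply RR6|lia|intros _].
    apply HQ; auto.
    - split; [split; cbn [stack_at]; auto; split; auto; simpl; auto|]. eapply HFull; eauto.
    - eapply ismin_ext; [|apply HR1]. intros r. rewrite G4, act_cases by lia. simpl. tauto.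
    - lia. }
  simpl in G2b. destruct G2b as [G2b G2c].
  pose proof (alternating_len _ _ _ _ _ G2c) as Hspan2.
  cbn [stack_at] in Hs2. destruct Hs2 as [Hs2 Hs3].
  apply wp_if with (x := 1) (y := S (S (length T))); [exact I|exact I|reflexivity|apply RR6| |lia].
  intros _.
  apply wp_seq.
  (* The time is [t1], not [v]: a value of [[t2, e)] must be absent up to the end [t1] of its
     run. *)
  apply (wp_search_in x d _ _ _ _ _ _ (t2 - 1) e t1 K q (kc x)); try (search_side RR6).
  { unfold behind. cbn [safe]. repeat split; auto; apply HSS; auto. }
  { change (ev g6 hp (behind (EL (stack_cell (rK - EK 2)%E))) - 1 = Z.to_nat (t2 - 1 + K)).
    rewrite (ev_behind _ _ _ _ _ _ _ _ t2 RR6); auto; [fold K; lia| |lia].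
    change (hp (ev g6 hp (stack_cell (rK - EK 2)%E)) = npos N d t2). rewrite HST by auto.
    rewrite <- Hs2. f_equal. simpl. lia. }
  { apply RR6. }
  intros g7 F7 HI7.
  set (k := S (S (length T))) in *.
  pose proof (run_regs_stable _ _ _ _ _ _ _ (stable_low _ _ F7) RR6) as RR7.
  assert (Hlen' : k < N) by (simpl in Hlen; unfold k; lia).
  assert (RA : forall j, j < N -> heap0 <= B + 5 * N + (j * m + kc x) < Sz).
  { intros j Hj. rewrite <- Nat.add_assoc. apply block_addr. nia. }
  assert (EC : forall g0 i, run_regs x d e v k g0 ->
     ev g0 hp (row_cell (rK - EK i)%E) = B + 5 * N + ((k - i) * m + kc x)).
  { intros g0 i R0. cbn [ev row_cell eval_binop binop_of]. rewrite (q_k _ _ _ _ _ _ R0).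
    destruct (q_inst _ _ _ _ _ _ R0) as (-> & U2 & -> & -> & U5 & -> & _). auto. }
  apply wp_seq. apply wp_set_gen with (v := rows hp (k - 1) (kc x)).
  { change (safe heap0 Sz g7 hp (row_cell (rK - EK 1)%E) /\
            heap0 <= ev g7 hp (row_cell (rK - EK 1)%E) < Sz).
    rewrite EC by auto. split; [cbn; auto 10|]. apply RA. lia. }
  { change (hp (ev g7 hp (row_cell (rK - EK 1)%E)) = rows hp (k - 1) (kc x)).
    rewrite EC by auto. apply rows_read; auto. lia. }
  intros g8 F8 V8.
  apply wp_seq. apply wp_set_min with (v := rows hp (k - 1) (kc x)); [exact I|cbn; auto|].
  intros g9 F9 V9. rewrite F8 in V9 by discriminate.
  destruct HP as [HP1 HP2].
  assert (HOld : ismin NONE (old L (e :: t1 :: t2 :: T)) (th (kc x)) (g9 sRes)).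
  { rewrite V9. eapply ismin_ext; [|apply ismin_or; [apply HI7|]].
    - intros r. rewrite old_cases by (auto; lia). reflexivity.
    (* The walker stands in [[e, t1)], on nodes visited by the previous run, so that run has filled
       the entry of this class. *)
    - destruct HP2 as [HP2 _]. rewrite Hkcx. apply HP2. lia. }
  assert (S9 : stable g1 g9).
  { eapply stable_trans; [apply S6|]. eapply stable_trans; [apply stable_low, F7|].
    eapply stable_trans; [eapply stable_one; [apply F8|auto]|].
    eapply stable_one; [apply F9|]. cbv; lia. }
  pose proof (run_regs_stable _ _ _ _ _ _ _ S9 RR) as RR9.
  assert (W9 : g9 rOut = g6 rOut).
  { rewrite F9, F8, F7 by (cbv; try lia; discriminate). auto. }
  apply wp_seq. eapply wp_sto with (x := B + 5 * N + (k * m + kc x)) (v := g9 sRes).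
  { cbn; auto 10. } { exact I. }
  { cbn [ev row_cell eval_binop binop_of]. rewrite (q_k _ _ _ _ _ _ RR9).
    destruct (q_inst _ _ _ _ _ _ RR9) as (-> & U2 & -> & -> & U5 & -> & _). auto. }
  { reflexivity. }
  { apply RA. lia. }
  set (hp' := upd hp _ _).
  apply wp_set_min with (v := g9 sRes); [exact I|reflexivity|].
  intros g10 F10 V10.
  assert (FR : forall a, a < B + 5 * N -> hp' a = hp a).
  { intros a Ha. apply upd_other. lia. }
  assert (S10 : stable g1 g10).
  { eapply stable_trans; [apply S9|]. eapply stable_one; eauto. }
  assert (RU : forall j c, rows hp' j c = if (j =? k) && (c =? kc x) then g9 sRes else rows hp j c).
  { intros j c. apply row_upd; auto. }
  apply HQ; auto.
  - split.
    + split; auto; try (rewrite FR by lia; auto).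
      * cbn [stack_at]. rewrite !FR by (simpl in Hlen; simpl; lia). split; [auto|split; auto].
        eapply stack_frame; [|apply Hs3]. intros a Ha. apply FR. simpl in Hlen. lia.
      * split; auto. simpl. auto.
      * intros j c Hj. rewrite RU. destruct (Nat.eqb_spec j k); [unfold k in *; lia|].
        simpl. auto.
    + split.
      * intros u Hu. change (length (t1 :: t2 :: T)) with k. rewrite RU, Nat.eqb_refl. simpl.
        (* A class met again gets the same minimum, since [old] does not depend on [v]; the entries
           of other classes date from earlier positions of this run. *)
        fold L. destruct (Nat.eqb_spec (lk L u) (kc x)) as [E|Hne].
        { rewrite E. apply HOld. }
        assert (u <> v) by congruence. apply HP1. lia.
      * eapply rows_ok_frame; [|apply HP2]. intros j c Hj. rewrite RU.
        change (length (t1 :: t2 :: T)) with k in Hj.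
        destruct (Nat.eqb_spec j k); [lia|]. auto.
  - rewrite V10, W9. eapply ismin_ext; [|apply ismin_or; [apply HR1|apply HOld]].
    intros r. rewrite G4, act_cases by lia. tauto.
  - intros a Ha. apply upd_other. unfold side_base in Ha. nia.
  - intros a. unfold hp', upd. destruct (_ =? _); [|lia]. destruct HOld as [HO _]. lia.
Qed.

End Instance.

(** * Moves on one cycle *)

(* A turning point that has just been reached again is dropped: the two runs meeting there merge. *)
Definition settle (v e : Z) (U : list Z) : Z * list Z :=
  match U with
  | [] => (e, [])
  | t :: l => if (t =? v)%Z then match l with [] => (e, []) | t2 :: l' => (t2, l') end else (e, U)
  end.

Lemma ghost_ext L N A A' e v T : (forall y, A y <-> A' y) -> ghost L N A e v T -> ghost L N A' e v T.
Proof. intros H [G1 G2 G3 G4]. split; auto. intros y. rewrite <- H. auto. Qed.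

Section Settle.
Variables (L : labels) (N : Z) (NONE : nat) (th : nat -> nat) (F : nat -> nat -> nat).
Variables (A : nat -> Prop) (e v : Z) (T : list Z).
Hypothesis Hper : periodic L N.
Hypothesis HF : forall j c, (j <= 1)%nat -> F j c = NONE.
Hypothesis HG : ghost L N A e v T.
Hypothesis HR : rows_ok L NONE th F v (e :: T).
Hypothesis HN : (2 <= N)%Z.

Lemma rows_pre_short e' v' : rows_pre L NONE th F e' v' [].
Proof. apply rows_ok_pre. apply rows_ok_short; auto. Qed.

(** Forgetting the start after a full turn and popping exclude each other: turning points on the
    stack keep the run shorter than one turn. *)
Lemma settle_forward :
  let e1 := if (v + 1 =? e + N)%Z then (e + 1)%Z else e in
  let (e', T') := settle (v + 1) e1 T in
  ghost L N (step_act L (v + 1) A) e' (v + 1) T' /\ rows_pre L NONE th F e' (v + 1) T'.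
Proof.
  destruct T as [|t l]; simpl.
  - split; [|apply rows_pre_short]. apply forward_none; auto.
  - pose proof (g_alt _ _ _ _ _ _ HG) as Ha. pose proof (g_le _ _ _ _ _ _ HG) as Hl.
    simpl in Ha. destruct Ha as [Ha1 Ha2]. apply alternating_len in Ha2.
    destruct (Z.eqb_spec (v + 1) (e + N)); [lia|].
    destruct (Z.eqb_spec t (v + 1)) as [->|Hne].
    + destruct l as [|t2 l].
      * split; [|apply rows_pre_short]. apply forward_pop_last; auto.
      * split; [eapply forward_pop; eauto|]. eapply rows_pop; eauto.
    + split; [apply forward_stay; auto|]. split; [|apply HR].
      destruct HR as [HR1 _]. intros u Hu. apply HR1. lia.
Qed.

End Settle.

Section SettleBackward.
Variables (L : labels) (N : Z) (NONE : nat) (th : nat -> nat) (F : nat -> nat -> nat).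
Variables (A : nat -> Prop) (e v : Z) (T : list Z).
Hypothesis HF : forall j c, (j <= 1)%nat -> F j c = NONE.
Hypothesis HG : ghost L N A e v T.
Hypothesis HR : rows_ok L NONE th F v (e :: T).
Hypothesis HN : (2 <= N)%Z.

(** If [e = v], nothing was traversed in the current direction, so turning leaves no entry on the
    stack. *)
Lemma settle_backward :
  let v' := (- (v - 1))%Z in
  let (e', T') := settle v' (- v) (if (e =? v)%Z then [] else map Z.opp (e :: T)) in
  ghost (opp_labels L) N (step_act (opp_labels L) v' A) e' v' T' /\
  rows_pre (opp_labels L) NONE th F e' v' T'.
Proof.
  intros v'. pose proof (g_le _ _ _ _ _ _ HG) as Hl.
  destruct (Z.eqb_spec e v) as [E|E].
  - simpl. split; [|apply rows_pre_short; auto]. eapply backward_single; eauto.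
  - simpl map. unfold settle. destruct (Z.eqb_spec (- e) v') as [E'|E'].
    + destruct T as [|t l]; simpl.
      * split; [|apply rows_pre_short; auto].
        apply (backward_pop_last L N A e v [] HG); auto. unfold v' in *; lia.
      * split; [apply (backward_pop L N A e v (t :: l) HG); auto; unfold v' in *; lia|].
        replace e with (v - 1)%Z in HR by (unfold v' in *; lia).
        apply rows_turn_pop; auto.
    + split; [apply (backward_stay L N A e v T HG); unfold v' in *; lia|].
      apply rows_turn; auto.
Qed.

End SettleBackward.

Lemma succ_inj N i j : i < N -> j < N -> (i + 1) mod N = (j + 1) mod N -> i = j.
Proof.
  intros Hi Hj E.
  assert (M : forall k, k < N -> (k + 1) mod N = if k + 1 =? N then 0 else k + 1).
  { intros k Hk. destruct (Nat.eqb_spec (k + 1) N) as [->|]; [apply Nat.Div0.mod_same|].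
    apply Nat.mod_small. lia. }
  rewrite !M in E by auto. destruct (Nat.eqb_spec (i + 1) N), (Nat.eqb_spec (j + 1) N); lia.
Qed.

(** * Correctness of the arrival code *)

Section Arrive.
Variables (Sz D N m NONE B : nat) (ub ib : nat -> bool) (vl kc th : nat -> nat).
Hypothesis HN : 1 <= N.
Hypothesis Hm : 2 <= m.
Hypothesis Hib : forall j, ib j = true -> ub j = true.
Hypothesis HD : 3 * N <= m ^ D.
Hypothesis HNN : N <= NONE.
Hypothesis HB : heap0 + cPow D < B.
Hypothesis HBe : side_base D N m B 2 <= Sz.

Notation block := (block N m NONE B ub ib vl kc).
Notation block_pre := (block_pre N m NONE B ub ib vl kc th).
Notation block_full := (block_full N m NONE B ub ib vl kc th).
Notation inst_regs := (inst_regs D N m NONE B kc).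
Notation SL := (side_labels N ub ib vl kc).

Lemma arrive_addr o : o < (5 + m) * N -> heap0 <= B + o < Sz.
Proof. apply (block_addr Sz D N m NONE B); auto. Qed.

Record tail_regs (x k : nat) (g : nat -> nat) : Prop := {
  t_b : g rB = B; t_n : g rN = N; t_x : g rX = x; t_k : g rK = k }.

Definition low_frame (hp hp' : nat -> nat) : Prop :=
  forall a, a < B \/ B + 5 * N <= a -> hp' a = hp a.

Lemma ev_stack_cell x k g h i : tail_regs x k g ->
  ev g h (stack_cell (rK - EK i)%E) = B + 4 * N + (k - i).
Proof. intros [U1 U2 U3 U4]. cbn. rewrite U1, U2, U4. auto. Qed.

Lemma safe_stack_cell x k g h i : tail_regs x k g -> k - i < N ->
  safe heap0 Sz g h (EL (stack_cell (rK - EK i)%E)).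
Proof.
  intros Hr Hk. change (safe heap0 Sz g h (stack_cell (rK - EK i)%E) /\
                        heap0 <= ev g h (stack_cell (rK - EK i)%E) < Sz).
  rewrite (ev_stack_cell x k) by auto. split; [cbn; auto 10|].
  rewrite <- Nat.add_assoc. apply arrive_addr. nia.
Qed.

(** The code compares nodes, [settle] compares coordinates. The hypothesis on the top of [U] makes
    this equivalent, as it lies less than one turn from [v]. *)
Lemma wp_tail hp d x v e U g (Q : (nat -> nat) -> (nat -> nat) -> Prop) :
  d <= 1 -> x < N -> npos N d v = x -> hp B = d -> hp (B + 2) = npos N d e ->
  stack_at N B hp d U -> length U < N -> tail_regs x (length U) g ->
  (forall t l, U = t :: l -> (Z.abs (t - v) < Z.of_nat N)%Z) ->
  (forall g' hp', kept g g' -> low_frame hp hp' -> (forall a, hp' a <= Nat.max (hp a) N) ->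
     let (e', T') := settle v e U in
     hp' B = d -> hp' (B + 1) = x -> hp' (B + 2) = npos N d e' -> hp' (B + 3) = length T' ->
     stack_at N B hp' d T' -> Q g' hp') ->
  wp heap0 Sz tail_code Q g hp.
Proof.
  intros Hd Hx Hv HhB Hhe Hst Hlen Hr Hnear HQ.
  pose proof Hr as [U1 U2 U3 U4].
  assert (A1 : heap0 <= B + 1 < Sz) by (apply arrive_addr; lia).
  assert (A2 : heap0 <= B + 2 < Sz) by (apply arrive_addr; lia).
  assert (A3 : heap0 <= B + 3 < Sz) by (apply arrive_addr; lia).
  unfold tail_code. apply wp_seq. apply wp_sto with (x := B + 1) (v := x); auto;
    [cbn; auto|exact I|cbn; rewrite U1; auto|].
  set (hp1 := upd hp (B + 1) x).
  assert (Fin : forall g2 hp2 T' e', kept g g2 -> tail_regs x (length T') g2 ->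
     length T' < N ->
     settle v e U = (e', T') ->
     hp2 B = d -> hp2 (B + 1) = x -> hp2 (B + 2) = npos N d e' -> stack_at N B hp2 d T' ->
     low_frame hp hp2 -> (forall a, hp2 a <= Nat.max (hp a) N) ->
     wp heap0 Sz (CSto (rB + EK 3)%E rK) Q g2 hp2).
  { intros g2 hp2 T' e' K2 R2 HT2 ES HB2 HX2 HE2 HS2 HL2 HM2.
    pose proof R2 as [W1 W2 W3 W4].
    apply wp_sto with (x := B + 3) (v := length T'); auto;
      [cbn; auto|exact I|cbn; rewrite W1; auto|].
    specialize (HQ g2 (upd hp2 (B + 3) (length T')) K2). rewrite ES in HQ. apply HQ.
    - intros a Ha. rewrite upd_other by lia. apply HL2; auto.
    - intros a. unfold upd. destruct (_ =? _); auto. lia.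
    - rewrite upd_other by lia. auto.
    - rewrite upd_other by lia. auto.
    - rewrite upd_other by lia. auto.
    - apply upd_same.
    - eapply (stack_frame Sz D N m NONE B HN Hm HD HNN HB HBe); [|apply HS2]. intros a Ha. rewrite
        upd_other; auto. lia. }
  assert (S1 : stack_at N B hp1 d U).
  { eapply (stack_frame Sz D N m NONE B HN Hm HD HNN HB HBe); [|apply Hst]. intros a Ha. apply
      upd_other. lia. }
  assert (L1 : low_frame hp hp1).
  { intros a Ha. apply upd_other. lia. }
  assert (M1 : forall a, hp1 a <= Nat.max (hp a) N).
  { intros a. unfold hp1, upd. destruct (_ =? _); lia. }
  assert (B1 : hp1 B = d) by (unfold hp1; rewrite upd_other by lia; auto).
  assert (X1 : hp1 (B + 1) = x) by (apply upd_same).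
  assert (E1 : hp1 (B + 2) = npos N d e) by (unfold hp1; rewrite upd_other by lia; auto).
  apply wp_seq.
  apply wp_if with (x := 0) (y := length U); [exact I|exact I|reflexivity|apply U4| |].
  2:{ intros H. destruct U as [|t l]; [|simpl in H; lia]. apply (Fin g hp1 [] e); auto using kept_refl. }
  intros Hpos. destruct U as [|t l]; [simpl in Hpos; lia|]. clear Hpos.
  cbn [stack_at] in S1. destruct S1 as [S1 S2].
  assert (Htop : ev g hp1 (EL (stack_cell (rK - EK 1)%E)) = npos N d t).
  { change (hp1 (ev g hp1 (stack_cell (rK - EK 1)%E)) = npos N d t).
    rewrite (ev_stack_cell x (length (t :: l))) by auto. rewrite <- S1. f_equal. simpl. lia. }
  apply wp_if with (x := (npos N d t - x) + (x - npos N d t)) (y := 1).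
  { cbn [safe distance]. pose proof (safe_stack_cell x (length (t :: l)) g hp1 1 Hr ltac:(lia)).
    auto. }
  { exact I. }
  { change (ev g hp1 (distance (EL (stack_cell (rK - EK 1)%E)) rX)) with
      ((ev g hp1 (EL (stack_cell (rK - EK 1)%E)) - g rX) +
       (g rX - ev g hp1 (EL (stack_cell (rK - EK 1)%E)))).
    rewrite Htop, U3. auto. }
  { reflexivity. }
  2:{ intros H. assert (t <> v) by (intros ->; lia).
      apply (Fin g hp1 (t :: l) e); auto using kept_refl; [|cbn [stack_at]; auto].
      unfold settle. destruct (Z.eqb_spec t v); [contradiction|auto]. }
  intros H. assert (t = v).
  { apply (pos_eq N HN d); [apply (Hnear t l); auto|]. lia. }
  subst t.
  apply wp_if with (x := 1) (y := length (v :: l)); [exact I|exact I|reflexivity|apply U4| |].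
  2:{ intros H1. destruct l as [|t2 l]; [|simpl in H1; lia].
      apply wp_set with (v := 0); [exact I|reflexivity|].
      apply (Fin _ hp1 [] e); auto.
      - apply kept_upd; [cbv; lia|apply kept_refl].
      - split; try rewrite upd_other by discriminate; auto.
      - simpl. rewrite Z.eqb_refl. auto. }
  intros H1. destruct l as [|t2 l]; [simpl in H1; lia|]. clear H1.
  cbn [stack_at] in S2. destruct S2 as [S2 S3].
  apply wp_seq. apply wp_sto with (x := B + 2) (v := npos N d t2); auto.
  { cbn; auto. }
  { apply (safe_stack_cell x (length (v :: t2 :: l))); auto. lia. }
  { cbn. rewrite U1. auto. }
  { change (hp1 (ev g hp1 (stack_cell (rK - EK 2)%E)) = npos N d t2).
    rewrite (ev_stack_cell x (length (v :: t2 :: l))) by auto. rewrite <- S2. f_equal. simpl. lia. }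
  apply wp_set with (v := length l); [cbn; auto|cbn; rewrite U4; simpl; lia|].
  apply (Fin _ _ l t2).
  - apply kept_upd; [cbv; lia|apply kept_refl].
  - split; try rewrite upd_other by discriminate; eauto. 
  - simpl in Hlen. lia.
  - simpl. rewrite Z.eqb_refl. auto.
  - rewrite upd_other by lia. auto.
  - rewrite upd_other by lia. auto.
  - apply upd_same.
  - eapply (stack_frame Sz D N m NONE B HN Hm HD HNN HB HBe); [|apply S3]. intros a Ha. apply
      upd_other. lia.
  - intros a Ha. rewrite upd_other by lia. apply L1; auto.
  - intros a. unfold upd at 1. destruct (_ =? _); auto. pose proof (pos_lt N HN d t2). lia.
Qed.

Lemma zidx_succ z : (zidx N z + 1) mod N = zidx N (z + 1).
Proof.
  apply Nat2Z.inj. rewrite zidx_Z, Nat2Z.inj_mod, Nat2Z.inj_add, zidx_Z by auto.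
  rewrite Zplus_mod_idemp_l. auto.
Qed.

Lemma adjacent_pos d v x : d <= 1 -> x < N ->
  (x = (npos N d v + 1) mod N \/ npos N d v = (x + 1) mod N) ->
  x = npos N d (v + 1) \/ x = npos N d (v - 1).
Proof.
  intros Hd Hx H. unfold npos in *. destruct (d =? 0).
  - destruct H as [->|H]; [left; apply zidx_succ|right].
    apply (succ_inj N); auto using zidx_lt. rewrite <- H, zidx_succ. f_equal. lia.
  - destruct H as [->|H].
    + right. rewrite zidx_succ. f_equal. lia.
    + left. apply (succ_inj N); auto using zidx_lt. rewrite <- H, zidx_succ. f_equal. lia.
Qed.

Lemma npos_period d z : npos N d (z + Z.of_nat N) = npos N d z.
Proof.
  unfold npos. destruct (d =? 0); [apply zidx_period; auto|].
  rewrite <- (zidx_period N HN (- (z + Z.of_nat N))). f_equal. lia.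
Qed.

(** A move writes below offset [5 N] of the block, so the rows carry over. *)
Lemma block_finish hp hp' A x d e v T :
  low_frame hp hp' -> d <= 1 -> npos N d v = x ->
  (forall j c, j <= 1 -> rows N m NONE B hp j c = NONE) ->
  hp' B = d -> hp' (B + 1) = x -> hp' (B + 2) = npos N d e -> hp' (B + 3) = length T ->
  stack_at N B hp' d T ->
  ghost (SL d) (Z.of_nat N) (step_act (SL d) v A) e v T ->
  rows_pre (SL d) NONE th (rows N m NONE B hp) e v T ->
  block_pre hp' (step_idx ub ib vl x A) x d e v T.
Proof.
  intros HF Hd Hv Hlow H1 H2 H3 H4 H5 H6 H7.
  assert (E : rows N m NONE B hp' = rows N m NONE B hp).
  { apply functional_extensionality; intros j. apply functional_extensionality; intros c.
    unfold rows. destruct ((c <? m) && (j <? N)); auto. apply HF. lia. }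
  split; [split; auto|rewrite E; auto].
  - eapply ghost_ext; [|apply H6]. intros y. rewrite step_act_idx, Hv. tauto.
  - rewrite E. auto.
Qed.

Lemma ev_distance g h a b : ev g h (distance a b) = (ev g h a - ev g h b) + (ev g h b - ev g h a).
Proof. reflexivity. Qed.

Lemma wp_move hp A x0 x d e v T g (Q : (nat -> nat) -> (nat -> nat) -> Prop) :
  block_full hp A x0 d e v T -> x < N -> x <> x0 ->
  (x = (x0 + 1) mod N \/ x0 = (x + 1) mod N) ->
  tail_regs x (length T) g -> g rDir = d -> g rV = x0 -> g rE = npos N d e ->
  (forall g' hp', kept g g' -> low_frame hp hp' -> (forall a, hp' a <= Nat.max (hp a) N) ->
     (exists d e v T, block_pre hp' (step_idx ub ib vl x A) x d e v T) -> Q g' hp') ->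
  wp heap0 Sz move_code Q g hp.
Proof.
  intros [HBk HR] Hx Hne Hadj Hr HgD HgV HgE HQ.
  pose proof (block_len Sz D N m NONE B ub ib vl kc HN Hm HD HNN HB HBe _ _ _ _ _ _ _ HBk) as Hlen.
  pose proof (block_gap Sz D N m NONE B ub ib vl kc HN Hm HD HNN HB HBe _ _ _ _ _ _ _ HBk) as Hgap.
  destruct HBk as [Hd Hpos Hhd Hhx Hhe Hhk Hhs HG Hlow].
  pose proof Hr as [U1 U2 U3 U4].
  assert (HN2 : 2 <= N).
  { pose proof (pos_lt N HN d v). lia. }
  assert (HN2' : (2 <= Z.of_nat N)%Z) by lia.
  rewrite <- Hpos in Hadj. apply adjacent_pos in Hadj; auto.
  assert (A0 : heap0 <= B < Sz) by (pose proof (arrive_addr 0); nia).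
  assert (A2 : heap0 <= B + 2 < Sz) by (apply arrive_addr; lia).
  assert (Hper := side_periodic N ub ib vl kc HN d).
  assert (HX : exists w, x = npos N d w) by (destruct Hadj; eauto).
  destruct HX as [w Hw].
  unfold move_code.
  apply wp_seq. apply wp_set_gen with (v := zidx N w).
  { apply safe_orient. exact I. }
  { rewrite (ev_orient N) by auto. cbn [ev]. rewrite HgD, U3, Hw. apply orient_pos; auto. }
  intros g1 F1 V1.
  apply wp_seq. apply wp_set_gen with (v := zidx N v).
  { apply safe_orient. exact I. }
  { rewrite (ev_orient N) by (rewrite F1 by discriminate; auto). cbn [ev].
    rewrite !F1 by discriminate. rewrite HgD, HgV, <- Hpos. apply orient_pos; auto. }
  intros g2 F2 V2.
  apply wp_seq. apply wp_set_gen with (v := zidx N (w - v)).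
  { cbn; auto. }
  { cbn [ev eval_binop binop_of]. rewrite V2, (F2 rXo), V1, F2, F1, U2 by discriminate.
    apply zidx_sub; auto. }
  intros g3 F3 V3.
  assert (Fg : forall r, r <> rXo -> r <> rVo -> r <> rD -> g3 r = g r).
  { intros r H1 H2 H3. rewrite F3, F2, F1; auto. }
  assert (K3 : kept g g3).
  { intros r Hr'. apply Fg; unfold rC, rBest, rRec, rXo, rVo, rD in *; lia. }
  assert (Q3 : forall g' hp', kept g3 g' -> low_frame hp hp' -> (forall a, hp' a <= Nat.max (hp a) N) ->
     (exists d e v T, block_pre hp' (step_idx ub ib vl x A) x d e v T) -> Q g' hp').
  { intros g' hp' Hk. apply HQ. eapply kept_trans; eauto. }
  assert (R3 : tail_regs x (length T) g3) by (split; rewrite Fg by discriminate; auto).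
  assert (G3D : g3 rDir = d) by (rewrite Fg by discriminate; auto).
  assert (G3V : g3 rV = npos N d v) by (rewrite Fg by discriminate; congruence).
  assert (G3E : g3 rE = npos N d e) by (rewrite Fg by discriminate; auto).
  clear F1 V1 F2 V2 F3 g1 g2 Fg Hr U1 U2 U3 U4 HQ K3 HgD HgV HgE g.
  pose proof R3 as [U1 U2 U3 U4].
  assert (Z1 : zidx N 1 = 1) by (rewrite zidx_small; lia).
  assert (Zm1 : zidx N (-1) = N - 1).
  { replace (-1)%Z with (- (1))%Z by lia. rewrite zidx_opp, Z1 by auto. apply Nat.mod_small. lia. }
  assert (HWV : zidx N (w - v) = 1 /\ x = npos N d (v + 1) \/
                zidx N (w - v) = N - 1 /\ x = npos N d (v - 1)).
  { destruct Hadj as [E|E]; [left|right]; (split; [|auto]).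
    - rewrite <- Z1. rewrite <- zidx_sub by auto. replace 1%Z with (v + 1 - v)%Z by lia.
      rewrite <- zidx_sub by auto. do 2 f_equal. f_equal.
      apply (f_equal (orient_nat N d)) in E. rewrite Hw, !orient_pos in E; auto.
    - rewrite <- Zm1. rewrite <- zidx_sub by auto. replace (-1)%Z with (v - 1 - v)%Z by lia.
      rewrite <- zidx_sub by auto. do 2 f_equal. f_equal.
      apply (f_equal (orient_nat N d)) in E. rewrite Hw, !orient_pos in E; auto. }
  apply wp_seq. apply wp_if with (x := zidx N (w - v)) (y := 2); [exact I|exact I|apply
      V3|reflexivity| |].
  - intros H2.
    (* For [N = 2] the two neighbours coincide, and a step back is treated as a step forward. *)
    assert (Ex : x = npos N d (v + 1)).
    { destruct HWV as [[_ E]|[E1 E]]; auto. rewrite E.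
      rewrite <- npos_period. f_equal. lia. }
    set (e1 := if (v + 1 =? e + Z.of_nat N)%Z then (e + 1)%Z else e).
    assert (Hnear : forall t l, T = t :: l -> (Z.abs (t - (v + 1)) < Z.of_nat N)%Z).
    { intros t l ->. pose proof (g_alt _ _ _ _ _ _ HG) as Ha. simpl in Ha.
      destruct Ha as [Ha1 Ha2]. apply alternating_len in Ha2. lia. }
    assert (HSet := settle_forward (SL d) (Z.of_nat N) NONE th (rows N m NONE B hp) A e v T
       Hper Hlow HG HR HN2').
    cbv zeta in HSet. fold e1 in HSet.
    assert (Fin : forall hp1, hp1 B = d -> hp1 (B + 2) = npos N d e1 -> stack_at N B hp1 d T ->
       low_frame hp hp1 -> (forall a, hp1 a <= Nat.max (hp a) N) -> wp heap0 Sz tail_code Q g3 hp1).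
    { intros hp1 P1 P2 P3 P4 P5. eapply (wp_tail hp1 d x (v + 1) e1 T); auto.
      intros g' hp' K' L' M'. destruct (settle (v + 1) e1 T) as [e' T'].
      intros W1 W2 W3 W4 W5. destruct HSet as [HS1 HS2].
      assert (LF : low_frame hp hp') by (intros a Ha; rewrite L', P4; auto).
      apply Q3; auto.
      - intros a. specialize (M' a). specialize (P5 a). lia.
      - exists d, e', (v + 1)%Z, T'. eapply block_finish; eauto. }
    apply wp_if with (x := (npos N d e - x) + (x - npos N d e)) (y := 1);
      [cbn; auto|exact I|rewrite ev_distance; cbn [ev]; rewrite G3E, U3; auto|reflexivity| |].
    + intros H.
      (* [v + 1] and [e] are the same node at a distance between 1 and [N], hence one full turn
         apart. *)
      assert (E : (v + 1 = e + Z.of_nat N)%Z).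
      { apply (pos_eq N HN d); [lia|]. rewrite npos_period. lia. }
      apply wp_sto with (x := B + 2) (v := npos N d (e + 1)); auto.
      { cbn; auto. }
      { cbn; auto 20. }
      { cbn. rewrite U1. auto. }
      { rewrite (ev_orient N) by auto.
        change (ev g3 hp ((orient rE + EK 1) mod rN)%E) with ((ev g3 hp (orient rE) + 1) mod g3 rN).
        rewrite (ev_orient N) by auto. cbn [ev]. rewrite G3D, G3E, U2, orient_pos by auto.
        rewrite zidx_succ. apply orient_zidx; auto. }
      apply Fin.
      * rewrite upd_other by lia. auto.
      * rewrite upd_same. unfold e1. rewrite (proj2 (Z.eqb_eq _ _) E). auto.
      * eapply (stack_frame Sz D N m NONE B HN Hm HD HNN HB HBe); [|apply Hhs].
        intros a Ha. apply upd_other. lia.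
      * intros a Ha. apply upd_other. lia.
      * intros a. unfold upd. destruct (_ =? _); [|lia]. pose proof (pos_lt N HN d (e + 1)). lia.
    + intros H. apply Fin; auto; [|intros a Ha; auto|intros a; lia].
      rewrite Hhe. unfold e1. destruct (Z.eqb_spec (v + 1) (e + Z.of_nat N)) as [E|E]; auto.
      exfalso. rewrite Ex, E, npos_period in H. lia.
  - intros H2.
    assert (Ex : x = npos N d (v - 1)).
    { destruct HWV as [[E1 E]|[E1 E]]; auto. lia. }
    set (v' := (- (v - 1))%Z).
    set (U := if (e =? v)%Z then [] else map Z.opp (e :: T)).
    assert (HSet := settle_backward (SL d) (Z.of_nat N) NONE th (rows N m NONE B hp) A e v T
       Hlow HG HR HN2').
    cbv zeta in HSet. fold v' U in HSet.
    rewrite (opp_side_labels Sz D N m NONE B ub ib vl kc HN Hm HD HNN HB HBe d Hd) in HSet.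
    assert (Hx' : npos N (1 - d) v' = x).
    { unfold v'. rewrite pos_flip by auto. auto. }
    assert (Hnear : forall t l, U = t :: l -> (Z.abs (t - v') < Z.of_nat N)%Z).
    { intros t l. unfold U, v'. destruct (Z.eqb_spec e v) as [E|E]; [discriminate|].
      simpl. intros EU. injection EU as <- _. lia. }
    assert (HlenU : length U < N).
    { unfold U. destruct (Z.eqb_spec e v) as [E|E]; [simpl; lia|].
      simpl. rewrite length_map.
      pose proof (alternating_bound _ _ _ _ _ (g_alt _ _ _ _ _ _ HG)). lia. }
    assert (Fin : forall g4 hp1, kept g3 g4 -> tail_regs x (length U) g4 ->
       hp1 B = 1 - d -> hp1 (B + 2) = npos N d v -> stack_at N B hp1 (1 - d) U ->
       low_frame hp hp1 -> (forall a, hp1 a <= Nat.max (hp a) N) -> wp heap0 Sz tail_code Q g4 hp1).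
    { intros g4 hp1 K4 R4 P1 P2 P3 P4 P5. eapply (wp_tail hp1 (1 - d) x v' (- v) U); auto; try lia.
      { rewrite P2. symmetry. apply pos_flip; auto. }
      intros g' hp' K' L' M'. destruct (settle v' (- v) U) as [e' T'].
      intros W1 W2 W3 W4 W5. destruct HSet as [HS1 HS2].
      assert (LF : low_frame hp hp') by (intros a Ha; rewrite L', P4; auto).
      apply Q3; auto.
      - eapply kept_trans; eauto.
      - intros a. specialize (M' a). specialize (P5 a). lia.
      - exists (1 - d), e', v', T'. eapply block_finish; eauto. lia. }
    assert (Mid : forall g4 hp1, kept g3 g4 -> tail_regs x (length U) g4 ->
       g4 rV = npos N d v -> g4 rDir = d -> stack_at N B hp1 (1 - d) U ->
       low_frame hp hp1 -> (forall a, hp1 a <= Nat.max (hp a) N) ->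
       wp heap0 Sz (CSto (rB + EK 2)%E rV ;;; CSto rB (EK 1 - rDir)%E)
         (wp heap0 Sz tail_code Q) g4 hp1).
    { intros g4 hp1 K4 R4 GV GD P3 P4 P5. pose proof R4 as [W1 W2 W3 W4].
      apply wp_seq. apply wp_sto with (x := B + 2) (v := npos N d v); auto;
        [cbn; auto|exact I|cbn; rewrite W1; auto|].
      apply wp_sto with (x := B) (v := 1 - d); auto;
        [exact I|cbn; auto|cbn [ev eval_binop binop_of]; rewrite GD; auto|].
      apply Fin; auto.
      - apply upd_same.
      - rewrite upd_other by lia. apply upd_same.
      - eapply (stack_frame Sz D N m NONE B HN Hm HD HNN HB HBe); [|apply P3].
        intros a Ha. rewrite !upd_other by lia. auto.
      - intros a Ha. rewrite !upd_other by lia. apply P4; auto.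
      - intros a. pose proof (pos_lt N HN d v). specialize (P5 a). unfold upd.
        destruct (a =? B); [lia|]. destruct (a =? B + 2); lia. }
    apply wp_seq.
    apply wp_if with (x := 0) (y := (npos N d e - npos N d v) + (npos N d v - npos N d e));
      [exact I|cbn; auto|reflexivity|rewrite ev_distance; cbn [ev]; rewrite G3E, G3V; auto| |].
    + intros H.
      assert (E : e <> v) by (intros ->; lia).
      assert (EU : U = map Z.opp (e :: T)).
      { unfold U. destruct (Z.eqb_spec e v); [contradiction|auto]. }
      assert (Hk : length T + 1 < N) by (rewrite EU, length_map in HlenU; simpl in HlenU; lia).
      apply wp_seq. apply wp_sto with (x := B + 4 * N + length T) (v := npos N d e); auto.
      { cbn; auto 10. }
      { exact I. }
      { cbn. rewrite U1, U2, U4. auto. }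
      { rewrite <- Nat.add_assoc. apply arrive_addr. nia. }
      apply wp_set with (v := length U); [cbn; auto| |].
      { cbn [ev eval_binop binop_of]. rewrite U4, EU, length_map. simpl. lia. }
      apply Mid; try rewrite upd_other by discriminate; auto.
      * apply kept_upd; [cbv; lia|apply kept_refl].
      * split; try rewrite upd_other by discriminate; auto. 
      * rewrite EU. apply stack_flip; auto. cbn [stack_at]. split; [apply upd_same|].
        eapply (stack_frame Sz D N m NONE B HN Hm HD HNN HB HBe); [|apply Hhs].
        intros a Ha. apply upd_other. lia.
      * intros a Ha. apply upd_other. lia.
      * intros a. unfold upd. destruct (_ =? _); [|lia]. pose proof (pos_lt N HN d e). lia.
    + intros H.
      assert (E : e = v) by (apply (pos_eq N HN d); lia).
      assert (ET : T = []) by (apply (g_single _ _ _ _ _ _ HG); auto).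
      assert (EU : U = []).
      { unfold U. destruct (Z.eqb_spec e v); [auto|contradiction]. }
      apply Mid; auto using kept_refl; try (rewrite EU; simpl; auto; fail).
      * rewrite EU. rewrite ET in R3. auto.
      * intros a Ha; auto.
      * intros a; lia.
Qed.

Definition block_fresh (hp : nat -> nat) : Prop :=
  hp B = 2 /\ forall j c, j <= 1 -> rows N m NONE B hp j c = NONE.

Lemma wp_arrive_fresh hp A x g (Q : (nat -> nat) -> (nat -> nat) -> Prop) :
  block_fresh hp -> (forall y, ~ A y) -> x < N -> inst_regs x g ->
  (forall g' hp', kept g g' -> low_frame hp hp' -> (forall a, hp' a <= Nat.max (hp a) N) ->
     (exists d e v T, block_pre hp' (step_idx ub ib vl x A) x d e v T) -> Q g' hp') ->
  wp heap0 Sz arrive_code Q g hp.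
Proof.
  intros [Hh Hlow] HA Hx (R1 & R2 & R3 & R4 & R5 & R6 & R7 & R8) HQ.
  assert (A0 : heap0 <= B < Sz) by (pose proof (arrive_addr 0); nia).
  assert (A1 : heap0 <= B + 1 < Sz) by (apply arrive_addr; lia).
  assert (A2 : heap0 <= B + 2 < Sz) by (apply arrive_addr; lia).
  assert (A3 : heap0 <= B + 3 < Sz) by (apply arrive_addr; lia).
  unfold arrive_code. apply wp_seq. apply wp_set with (v := 2).
  { cbn [safe ev]. rewrite R3. auto. }
  { cbn [ev]. rewrite R3. auto. }
  assert (K1 : kept g (upd g rDir 2)) by (apply kept_upd; [cbv; lia|apply kept_refl]).
  set (g1 := upd g rDir 2) in *.
  assert (E3 : g1 rB = B) by (rewrite K1 by (cbv; lia); auto).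
  assert (E5 : g1 rX = x) by (rewrite K1 by (cbv; lia); auto).
  apply wp_if with (x := 1) (y := 2); [exact I|exact I|reflexivity|apply upd_same| |lia].
  intros _.
  apply wp_seq. apply wp_sto with (x := B) (v := 0); auto; [exact I|exact I|].
  apply wp_seq. apply wp_sto with (x := B + 1) (v := x); auto; [cbn; auto|exact I|cbn [ev eval_binop
      binop_of]; rewrite E3; auto|].
  apply wp_seq. apply wp_sto with (x := B + 2) (v := x); auto; [cbn; auto|exact I|cbn [ev eval_binop
      binop_of]; rewrite E3; auto|].
  apply wp_sto with (x := B + 3) (v := 0); auto; [cbn; auto|exact I|cbn [ev eval_binop binop_of];
      rewrite E3; auto|].
  assert (Ex : npos N 0 (Z.of_nat x) = x).
  { unfold npos. simpl. rewrite zidx_small by (auto; lia). lia. }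
  apply HQ; auto.
  - intros a Ha. rewrite !upd_other by lia. auto.
  - intros a. unfold upd. repeat destruct (_ =? _); lia.
  - exists 0, (Z.of_nat x), (Z.of_nat x), [].
    eapply (block_finish hp); auto.
    + intros a Ha. rewrite !upd_other by lia. auto.
    + rewrite !upd_other by lia. apply upd_same.
    + rewrite !upd_other by lia. apply upd_same.
    + rewrite upd_other by lia. rewrite upd_same. auto.
    + apply upd_same.
    + exact I.
    + apply ghost_init; auto. lia.
    + apply rows_pre_short; auto.
Qed.

Lemma wp_arrive hp A x0 x d e v T g (Q : (nat -> nat) -> (nat -> nat) -> Prop) :
  block_full hp A x0 d e v T -> x < N ->
  (x = x0 \/ x = (x0 + 1) mod N \/ x0 = (x + 1) mod N) -> inst_regs x g ->
  (forall g' hp', kept g g' -> low_frame hp hp' -> (forall a, hp' a <= Nat.max (hp a) N) ->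
     (exists d e v T, block_pre hp' (step_idx ub ib vl x A) x d e v T) -> Q g' hp') ->
  wp heap0 Sz arrive_code Q g hp.
Proof.
  intros HF Hx Hadj (R1 & R2 & R3 & R4 & R5 & R6 & R7 & R8) HQ.
  assert (A0 : heap0 <= B < Sz) by (pose proof (arrive_addr 0); nia).
  assert (A1 : heap0 <= B + 1 < Sz) by (apply arrive_addr; lia).
  assert (A2 : heap0 <= B + 2 < Sz) by (apply arrive_addr; lia).
  assert (A3 : heap0 <= B + 3 < Sz) by (apply arrive_addr; lia).
  pose proof HF as [HBk HR]. destruct HBk as [Hd Hpos Hhd Hhx Hhe Hhk Hhs HG Hlow].
  unfold arrive_code. apply wp_seq. apply wp_set_gen with (v := d).
  { cbn [safe ev]. rewrite R3. auto. }
  { cbn [ev]. rewrite R3. auto. }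
  intros g1 F1 V1.
  apply wp_if with (x := 1) (y := d); [exact I|exact I|reflexivity|apply V1|lia|intros _].
  apply wp_seq. apply wp_set_gen with (v := x0).
  { cbn [safe ev eval_binop binop_of]. rewrite F1, R3 by discriminate. auto. }
  { cbn [ev eval_binop binop_of]. rewrite F1, R3 by discriminate. auto. }
  intros g2 F2 V2.
  apply wp_seq. apply wp_set_gen with (v := npos N d e).
  { cbn [safe ev eval_binop binop_of]. rewrite F2, F1, R3 by discriminate. auto. }
  { cbn [ev eval_binop binop_of]. rewrite F2, F1, R3 by discriminate. auto. }
  intros g3 F3 V3.
  apply wp_seq. apply wp_set_gen with (v := length T).
  { cbn [safe ev eval_binop binop_of]. rewrite F3, F2, F1, R3 by discriminate. auto. }
  { cbn [ev eval_binop binop_of]. rewrite F3, F2, F1, R3 by discriminate. auto. }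
  intros g4 F4 V4.
  assert (K4 : kept g g4).
  { intros r Hr. rewrite F4, F3, F2, F1; auto; unfold rC, rBest, rRec, rDir, rV, rE, rK in *; lia. }
  assert (G4 : g4 rV = x0) by (rewrite F4, F3 by discriminate; auto).
  assert (G5 : g4 rE = npos N d e) by (rewrite F4 by discriminate; auto).
  assert (G6 : g4 rDir = d) by (rewrite F4, F3, F2 by discriminate; auto).
  assert (G7 : g4 rX = x) by (rewrite K4 by (cbv; lia); auto).
  apply wp_if with (x := 0) (y := (x0 - x) + (x - x0)); [exact I|cbn; auto|reflexivity| | |].
  { rewrite ev_distance. cbn [ev]. rewrite G4, G7. auto. }
  - intros Hlt. eapply wp_move; eauto; try lia.
    { split; auto; rewrite K4 by (cbv; lia); auto. }
    intros g' hp' K' L' M' E'. apply HQ; auto. eapply kept_trans; eauto.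
  - intros Hge. assert (Exx : x = x0) by lia. rewrite Exx in HQ. apply HQ; auto; [intros a Ha;
      auto|intros a; lia|].
    exists d, e, v, T. split.
    + split; auto; try congruence.
      eapply ghost_ext; [|apply ghost_same; apply HG]. intros y. rewrite step_act_idx.
      rewrite Hpos. tauto.
    + apply rows_ok_pre. auto.
Qed.

End Arrive.

(** * The trie of ranks *)

Section Levels.
Variables (n m : nat) (rk : nat -> nat).
Hypothesis Hm : 2 <= m.
Hypothesis Hrk : forall v, rk v < n.

Definition memb (q tau u : nat) : bool := rk u / m ^ q =? tau.
Definition members (q tau : nat) : list nat := filter (memb q tau) (seq 0 n).
Definition size (q tau : nat) : nat := length (members q tau).
Definition node (q tau i : nat) : nat := nth i (members q tau) 0.
Definition index (q tau v : nat) : nat := length (filter (memb q tau) (seq 0 v)).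
Definition cls (q v : nat) : nat :=
  match q with 0 => 0 | S q' => (rk v / m ^ q') mod m end.
(* A query at a node of class [c] looks, among the ranks with [y / m ^ q = tau], for those in a
   later child than its own; at the leaves [q = 0] its own rank is allowed. *)
Definition thr (q tau c : nat) : nat :=
  match q with 0 => tau | S q' => (tau * m + c + 1) * m ^ q' end.
Definition class_of (q v : nat) : nat := rk v / m ^ q.

Lemma memb_class q v : memb q (class_of q v) v = true.
Proof. apply Nat.eqb_refl. Qed.

Lemma memb_false q tau v : memb q tau v = false <-> class_of q v <> tau.
Proof. apply Nat.eqb_neq. Qed.

Lemma size_le q tau : size q tau <= n.
Proof.
  unfold size, members. etransitivity; [apply filter_length_le|]. rewrite length_seq. auto.
Qed.

Lemma class_lt q v : class_of q v < n.
Proof.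
  unfold class_of. eapply Nat.le_lt_trans; [|apply (Hrk v)].
  apply Nat.Div0.div_le_upper_bound. assert (m ^ q <> 0) by (apply Nat.pow_nonzero; lia). nia.
Qed.

Lemma index_S q tau v : index q tau (S v) = index q tau v + if memb q tau v then 1 else 0.
Proof.
  unfold index. rewrite seq_S, filter_app, length_app. simpl.
  destruct (memb q tau v); auto.
Qed.

Lemma index_mono q tau v k : index q tau v <= index q tau (k + v).
Proof. induction k as [|k IH]; simpl; auto. rewrite index_S. lia. Qed.

Lemma index_le q tau v : v <= n -> index q tau v <= size q tau.
Proof.
  intros H. change (index q tau v <= index q tau n).
  replace n with (n - v + v) by lia. apply index_mono.
Qed.

Lemma index_lt q tau v : v < n -> memb q tau v = true -> index q tau v < size q tau.
Proof.
  intros H E. pose proof (index_le q tau (S v) H) as Hl. rewrite index_S, E in Hl. lia.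
Qed.

Lemma node_index q tau v : v < n -> memb q tau v = true -> node q tau (index q tau v) = v.
Proof.
  intros H E. unfold node, members.
  replace n with (v + S (n - v - 1)) by lia. rewrite seq_app, filter_app.
  rewrite app_nth2 by (unfold index; lia). unfold index. rewrite Nat.sub_diag.
  simpl. rewrite E. auto.
Qed.

(** Cyclic index of the first member at or after [x]; the remainder wraps around behind the last
    member. *)
Definition place (q tau x : nat) : nat := index q tau x mod size q tau.

Lemma place_memb q tau v : v < n -> memb q tau v = true -> place q tau v = index q tau v.
Proof. intros. apply Nat.mod_small, index_lt; auto. Qed.

Lemma place_succ q tau x : x < n -> 1 <= size q tau ->
  place q tau ((x + 1) mod n) =
  if memb q tau x then (place q tau x + 1) mod size q tau else place q tau x.
Proof.
  intros Hx HN. unfold place.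
  assert (E : index q tau ((x + 1) mod n) mod size q tau = index q tau (S x) mod size q tau).
  { destruct (Nat.eq_dec (x + 1) n) as [E|E].
    - rewrite E, Nat.Div0.mod_same. replace (S x) with n by lia.
      change (index q tau n) with (size q tau). rewrite Nat.Div0.mod_same.
      apply Nat.Div0.mod_0_l.
    - rewrite (Nat.mod_small (x + 1)) by lia. do 2 f_equal. lia. }
  rewrite E, index_S. destruct (memb q tau x).
  - rewrite Nat.Div0.add_mod_idemp_l. auto.
  - f_equal. lia.
Qed.

(* [j] may be the cyclic index of the last visited member when the walker is at [x]. *)
Definition last_seen (q tau x j : nat) : Prop :=
  j < size q tau /\
  (j = place q tau x \/ (memb q tau x = false /\ (j + 1) mod size q tau = place q tau x)).

Lemma last_seen_here q tau v : v < n -> memb q tau v = true ->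
  last_seen q tau v (index q tau v).
Proof. intros H E. split; [apply index_lt; auto|]. left. rewrite place_memb; auto. Qed.

Lemma last_seen_stay q tau x x' j : x < n -> x' < n -> cycle_adj n x x' ->
  last_seen q tau x j -> memb q tau x' = false -> last_seen q tau x' j.
Proof.
  intros Hx Hx' Ha [Hj H] E. assert (HN : 1 <= size q tau) by lia. split; auto.
  destruct Ha as [-> | ->].
  - rewrite E. rewrite place_succ by auto. destruct (memb q tau x) eqn:Ex.
    + destruct H as [->|[? _]]; [auto|discriminate].
    + destruct H as [H|[_ H]]; auto.
  - rewrite place_succ, E in H by auto. destruct H as [H|[_ H]]; auto.
Qed.

(** Without visiting a member the walker cannot leave the gap next to the last member seen. The next
    member visited is thus that one or a neighbour of it on the shorter cycle. *)
Lemma last_seen_step q tau x x' j : x < n -> x' < n -> cycle_adj n x x' ->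
  last_seen q tau x j -> memb q tau x' = true ->
  let i := index q tau x' in let N := size q tau in
  i = j \/ i = (j + 1) mod N \/ j = (i + 1) mod N.
Proof.
  intros Hx Hx' Ha [Hj H] E i N. assert (HN : 1 <= size q tau) by lia.
  unfold i. rewrite <- place_memb by auto.
  destruct Ha as [Ea|Ea].
  - rewrite Ea, place_succ by auto. destruct (memb q tau x) eqn:Ex.
    + destruct H as [->|[? _]]; [auto|discriminate].
    + destruct H as [H|[_ H]]; auto.
  - rewrite Ea, place_succ, E in H by auto. destruct H as [H|[_ H]]; auto.
    left. symmetry. apply (succ_inj (size q tau)); auto.
    rewrite place_memb by auto. apply index_lt; auto.
Qed.

Lemma cls_lt q v : cls q v < m.
Proof. destruct q; simpl; [lia|apply Nat.mod_upper_bound; lia]. Qed.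

(** The threshold is the first rank after the child block that contains [rk v]; it depends on the
    child only, so a trie node has just [m] of them. *)
Lemma thr_class q v : thr (S q) (class_of (S q) v) (cls (S q) v) = (rk v / m ^ q + 1) * m ^ q.
Proof.
  unfold thr, class_of, cls. do 2 f_equal.
  rewrite Nat.pow_succ_r', (Nat.mul_comm m), <- Nat.Div0.div_div.
  pose proof (Nat.div_mod_eq (rk v / m ^ q) m). lia.
Qed.

Lemma thr_sound q v y : thr q (class_of q v) (cls q v) <= y -> rk v <= y.
Proof.
  destruct q as [|q].
  - unfold thr, class_of. change (m ^ 0) with 1. rewrite Nat.div_1_r. auto.
  - rewrite thr_class. intros H.
    assert (Hp : m ^ q <> 0) by (apply Nat.pow_nonzero; lia).
    pose proof (Nat.mul_succ_div_gt (rk v) (m ^ q) Hp). nia.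
Qed.

(** Take the lowest common ancestor of [y] and [rk v]: either they are equal, or [y] lies in a later
    child there and passes the threshold. *)
Lemma thr_complete v y q : y / m ^ q = class_of q v -> rk v <= y ->
  exists q', q' <= q /\ y / m ^ q' = class_of q' v /\ thr q' (class_of q' v) (cls q' v) <= y.
Proof.
  intros H Hy. induction q as [|q IH].
  - exists 0. split; auto. split; auto. unfold thr. rewrite <- H.
    change (m ^ 0) with 1. rewrite Nat.div_1_r. auto.
  - destruct (Nat.eq_dec (y / m ^ q) (class_of q v)) as [E|E].
    + destruct (IH E) as (q' & H1 & H2). exists q'. split; auto.
    + exists (S q). split; auto. split; auto. rewrite thr_class.
      assert (Hp : m ^ q <> 0) by (apply Nat.pow_nonzero; lia).
      pose proof (Nat.Div0.div_le_mono (rk v) y (m ^ q) Hy). unfold class_of in E.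
      assert (rk v / m ^ q + 1 <= y / m ^ q) by lia.
      pose proof (Nat.Div0.mul_div_le y (m ^ q)). nia.
Qed.

Lemma class_top d y : n <= m ^ d -> y < n -> y / m ^ d = 0.
Proof. intros. apply Nat.div_small. lia. Qed.

End Levels.

Lemma ismin_above NONE P t r : ismin NONE P t r -> ismin NONE (fun y => P y /\ t <= y) 0 r.
Proof.
  intros (A & B & C). split; [auto|split].
  - destruct B as [|[]]; auto. right. split; auto. lia.
  - intros r' [] _. auto.
Qed.

(** Each node belongs to exactly one trie node per level. This is why a whole level costs no more
    than one cycle of length n. *)
Lemma sum_sizes n m rk q : (forall v, rk v < n) -> 2 <= m ->
  list_sum (map (size n m rk q) (seq 0 n)) = n.
Proof.
  intros Hrk Hm. unfold size, members.
  assert (G : forall l, (forall v, In v l -> class_of m rk q v < n) ->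
    list_sum (map (fun tau => length (filter (memb m rk q tau) l)) (seq 0 n)) = length l).
  { induction l as [|u l IH]; intros Hl.
    - simpl. clear. induction (seq 0 n); simpl; auto.
    - assert (Hu : class_of m rk q u < n) by (apply Hl; simpl; auto).
      transitivity (list_sum (map (fun tau => (if tau =? class_of m rk q u then 1 else 0)
         + length (filter (memb m rk q tau) l)) (seq 0 n))).
      + f_equal. apply map_ext. intros tau. simpl. unfold memb at 1.
        change (rk u / m ^ q) with (class_of m rk q u). rewrite Nat.eqb_sym.
        destruct (tau =? _); auto.
      + assert (Add : forall (f g : nat -> nat) L,
          list_sum (map (fun t => f t + g t) L) = list_sum (map f L) + list_sum (map g L)).
        { intros f g L. induction L; simpl; auto. lia. }
        rewrite Add, IH by (intros; apply Hl; simpl; auto). simpl. f_equal.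
        assert (One : forall k s, list_sum (map (fun tau => if tau =? class_of m rk q u then 1 else 0)
           (seq s k)) = if (s <=? class_of m rk q u) && (class_of m rk q u <? s + k) then 1 else 0).
        { induction k as [|k IHk]; intros s; simpl.
          - destruct (Nat.leb_spec s (class_of m rk q u)); simpl; auto.
            destruct (Nat.ltb_spec (class_of m rk q u) (s + 0)); auto; lia.
          - rewrite IHk. destruct (Nat.eqb_spec s (class_of m rk q u)),
              (Nat.leb_spec (S s) (class_of m rk q u)), (Nat.leb_spec s (class_of m rk q u)),
              (Nat.ltb_spec (class_of m rk q u) (S s + k)), (Nat.ltb_spec (class_of m rk q u) (s + S k));
              simpl; auto; lia. }
        rewrite One. simpl. apply Nat.ltb_lt in Hu. rewrite Hu. auto. }
  rewrite G.
  - apply length_seq.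
  - intros v _. apply class_lt; auto.
Qed.

(** * Memory layout *)

Fixpoint off (sz : nat -> nat) (j : nat) : nat :=
  match j with 0 => 0 | S j => off sz j + sz j end.

Lemma off_mono sz j k : j < k -> off sz j + sz j <= off sz k.
Proof.
  intros H. induction H as [|k H IH]; simpl; auto. lia.
Qed.

Lemma off_le sz j k : j <= k -> off sz j <= off sz k.
Proof.
  intros H. destruct (Nat.eq_dec j k) as [->|]; auto.
  pose proof (off_mono sz j k). lia.
Qed.

(** Consecutive regions do not overlap, so the initial memory can be prescribed region by region. *)
Lemma alloc (sz : nat -> nat) (cnt : nat -> nat -> nat) (bd J : nat) :
  (forall j i, j < J -> i < sz j -> cnt j i <= bd) ->
  exists h, (forall j i, j < J -> i < sz j -> h (off sz j + i) = cnt j i) /\ forall a, h a <= bd.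
Proof.
  induction J as [|J IH]; intros Hb.
  - exists (fun _ => 0). split; intros; lia.
  - destruct IH as (h & H1 & H2); [intros; apply Hb; lia|].
    exists (fun a => if (off sz J <=? a) && (a <? off sz (S J)) then cnt J (a - off sz J) else h a).
    split.
    + intros j i Hj Hi. destruct (Nat.eq_dec j J) as [->|Hne].
      * rewrite (proj2 (Nat.leb_le _ _)) by lia. rewrite (proj2 (Nat.ltb_lt _ _)) by (simpl; lia).
        simpl. f_equal. lia.
      * pose proof (off_mono sz j J ltac:(lia)).
        rewrite (proj2 (Nat.leb_gt _ _)) by lia. simpl. apply H1; lia.
    + intros a. destruct (Nat.leb_spec (off sz J) a), (Nat.ltb_spec a (off sz (S J))); simpl; auto.
      apply Hb; auto. simpl in *. lia.
Qed.

Lemma div_mod_unique_pair a b q r : r < b -> a = q * b + r -> a / b = q /\ a mod b = r.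
Proof.
  intros Hr ->. rewrite Nat.div_add_l by lia. rewrite Nat.div_small by auto.
  rewrite (Nat.add_comm (q * b)), Nat.Div0.mod_add, Nat.mod_small by auto. lia.
Qed.

(** * Initial contents of one instance *)

Section Content.
Variables (D N m NONE : nat) (ub ib : nat -> bool) (vl th : nat -> nat).
Hypothesis HN : 1 <= N.
Hypothesis Hm : 2 <= m.
Hypothesis Hvl : forall j, vl j < NONE.

Notation SS := (side_size D N m).

Definition side_content (ub ib : nat -> bool) (vl : nat -> nat) (r : nat) : nat :=
  if r <? 3 * N then state_id N m ub ib vl D 0 r
  else
    let s := (r - 3 * N) / rec_size m in
    let f := (r - 3 * N) mod rec_size m in
    if f <? m then
      let v := st_trans N m ub ib vl s f in if v <? num_states D N then v else 0
    else
      let lh := (f - m) / m in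
      st_out N m NONE ub ib vl th s (lh / (m + 1)) (lh mod (m + 1)) ((f - m) mod m).

Definition inst_content (o : nat) : nat :=
  if o =? 0 then 2
  else if o <? 5 * N then 0
  else if o <? (5 + m) * N then NONE
  else
    let o' := o - (5 + m) * N in
    let d := o' / SS in
    side_content (sided N d ub) (sided N d ib) (sided N d vl) (o' mod SS).

Lemma side_content_tables hp SB ub' ib' vl' :
  (forall r, r < SS -> hp (SB + r) = side_content ub' ib' vl' r) ->
  tables_at D N m NONE ub' ib' vl' th hp SB.
Proof.
  intros H.
  assert (REC : forall s o, s < num_states D N -> o < rec_size m -> 3 * N + (s * rec_size m + o) < SS).
  { intros s o Hs Ho. unfold side_size. nia. }
  split; [|split].
  - intros b Hb. rewrite H by (unfold side_size; nia). unfold side_content.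
    rewrite (proj2 (Nat.ltb_lt b (3 * N))) by auto. auto.
  - intros s k Hs Hk Ht.
    assert (Hk' : k < rec_size m) by (unfold rec_size; lia).
    replace (SB + 3 * N + s * rec_size m + k) with (SB + (3 * N + (s * rec_size m + k))) by lia.
    rewrite H by (apply REC; auto). unfold side_content.
    rewrite (proj2 (Nat.ltb_ge _ (3 * N))) by lia.
    destruct (div_mod_unique_pair (3 * N + (s * rec_size m + k) - 3 * N) (rec_size m) s k Hk' ltac:(lia))
      as [-> ->].
    rewrite (proj2 (Nat.ltb_lt k m)) by auto. cbv zeta.
    rewrite (proj2 (Nat.ltb_lt _ (num_states D N))) by auto. auto.
  - intros s lo hi c Hs Hl Hh Hc.
    assert (Ho : m + ((lo * (m + 1) + hi) * m + c) < rec_size m) by (unfold rec_size; nia).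
    set (o := m + ((lo * (m + 1) + hi) * m + c)) in *.
    replace (SB + 3 * N + s * rec_size m + o) with (SB + (3 * N + (s * rec_size m + o))) by lia.
    rewrite H by (apply REC; auto). unfold side_content.
    rewrite (proj2 (Nat.ltb_ge _ (3 * N))) by lia.
    destruct (div_mod_unique_pair (3 * N + (s * rec_size m + o) - 3 * N) (rec_size m) s o Ho ltac:(lia))
      as [-> ->].
    rewrite (proj2 (Nat.ltb_ge o m)) by (unfold o; lia).
    destruct (div_mod_unique_pair (o - m) m (lo * (m + 1) + hi) c Hc ltac:(unfold o; lia)) as [-> ->].
    destruct (div_mod_unique_pair (lo * (m + 1) + hi) (m + 1) lo hi ltac:(lia) eq_refl) as [-> ->].
    auto.
Qed.

Lemma least_bound t l : least NONE t l <= NONE.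
Proof. induction l as [|x l IH]; simpl; auto. destruct (t <=? x); lia. Qed.

Lemma side_content_bound ub' ib' vl' r : side_content ub' ib' vl' r <= Nat.max NONE (num_states D N).
Proof.
  unfold side_content. destruct (Nat.ltb_spec r (3 * N)).
  - pose proof (state_id_bound N m ub' ib' vl' HN Hm D 0 r ltac:(lia) ltac:(lia)).
    unfold num_states. lia.
  - destruct (_ <? m); cbv zeta.
    + destruct (Nat.ltb_spec (st_trans N m ub' ib' vl' ((r - 3 * N) / rec_size m)
        ((r - 3 * N) mod rec_size m)) (num_states D N)); lia.
    + unfold st_out. pose proof least_bound. etransitivity; [apply least_bound|]. lia.
Qed.

Lemma inst_content_bound o : inst_content o <= Nat.max 2 (Nat.max NONE (num_states D N)).
Proof.
  unfold inst_content. destruct (o =? 0); [lia|]. destruct (o <? 5 * N); [lia|].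
  destruct (o <? (5 + m) * N); [lia|]. etransitivity; [apply side_content_bound|]. lia.
Qed.

Definition inst_size : nat := (5 + m) * N + 2 * SS.

Lemma inst_content_ok hp B :
  (forall h, h <= D -> hp (heap0 + cPow h) = m ^ h) ->
  (forall o, o < inst_size -> hp (B + o) = inst_content o) ->
  static_ok D N m NONE B ub ib vl th hp /\ block_fresh N m NONE B hp.
Proof.
  intros Hp H. split; [split; [exact Hp|]|split].
  - intros d Hd. apply side_content_tables. intros r Hr.
    unfold side_base. replace (B + (5 + m) * N + d * SS + r) with (B + ((5 + m) * N + (d * SS + r)))
        by lia.
    rewrite H.
    2:{ unfold inst_size. nia. }
    unfold inst_content. rewrite (proj2 (Nat.eqb_neq _ 0)) by nia.
    rewrite (proj2 (Nat.ltb_ge _ (5 * N))) by nia. rewrite (proj2 (Nat.ltb_ge _ ((5 + m) * N))) by nia.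
    destruct (div_mod_unique_pair ((5 + m) * N + (d * SS + r) - (5 + m) * N) SS d r Hr ltac:(lia))
      as [-> ->]. auto.
  - specialize (H 0). rewrite Nat.add_0_r in H. apply H. unfold inst_size. nia.
  - intros j c Hj. unfold rows. destruct (Nat.ltb_spec c m), (Nat.ltb_spec j N); simpl; auto.
    rewrite <- Nat.add_assoc. rewrite H by (unfold inst_size; nia).
    unfold inst_content. rewrite (proj2 (Nat.eqb_neq _ 0)) by nia.
    rewrite (proj2 (Nat.ltb_ge _ (5 * N))) by nia. rewrite (proj2 (Nat.ltb_lt _ ((5 + m) * N))) by nia.
    auto.
Qed.

End Content.

(** * One step of the walk *)

(** [rNone] holds [n], which serves both as the infinite rank and as the row length of this
    table. *)
Definition info_cell (q f : nat) : expr :=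
  EL (const cInfo + (EK q * rNone + rNode) * EK 4 + EK f)%E.

Definition level_code (D q : nat) : cmd :=
  CSet rB (info_cell q 0) ;;;
  CSet rN (info_cell q 1) ;;;
  CSet rX (info_cell q 2) ;;;
  CSet rC (info_cell q 3) ;;;
  CSet rSize (EK 3 * rN + (EK (D + 1) * (EK 2 * (EK 3 * rN))) * rRec)%E ;;;
  arrive_code ;;;
  query_code D ;;;
  set_min rBest rOut.

Fixpoint levels_code (D k : nat) : cmd :=
  match k with
  | 0 => CSkip
  | S k => levels_code D k ;;; level_code D k
  end.

(* Clearing the registers makes every step start from the same bound on all cells. *)
Fixpoint zero_code (k : nat) : cmd :=
  match k with
  | 0 => CSkip
  | S k => zero_code k ;;; CSet (2 + k) (EK 0)
  end.

(** The least rank over all levels is turned into a node by the table at [cNodes], whose entry for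
    rank [n] is [n], the code of infinity. *)
Definition main_code (d : nat) : cmd :=
  CSet rNone (const cN) ;;;
  CSet rM (const cM) ;;;
  CSet rRec (rM + (rM + EK 1) * (rM + EK 1) * rM)%E ;;;
  CSet rBest rNone ;;;
  levels_code (d + 2) (d + 1) ;;;
  CSet rAns (EL (const cNodes + rBest)%E) ;;;
  zero_code 38.

(** The check cannot compute through [search_loop D] for a variable [D]; with that part as a
    hypothesis the rest is evaluation. *)
Lemma levels_wf D k : wfc T0 TN (search_loop D) = true -> wfc T0 TN (levels_code D k) = true.
Proof.
  intros H. induction k as [|k IH]; [reflexivity|].
  change (wfc T0 TN (levels_code D k) && wfc T0 TN (level_code D k) = true).
  rewrite IH. cbn [andb]. unfold level_code, query_code, search_in, search, arrive_code, move_code,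
      tail_code.
  cbn [wfc]. rewrite H. reflexivity.
Qed.

Lemma search_loop_wf h : wfc T0 TN (search_loop h) = true.
Proof.
  induction h as [|h IH]; [reflexivity|].
  change (wfc T0 TN (search_body h) && wfc T0 TN (search_loop h) = true).
  rewrite IH. reflexivity.
Qed.

Lemma main_code_wf d : wfc T0 TN (main_code d) = true.
Proof.
  unfold main_code. cbn [wfc]. rewrite levels_wf by apply search_loop_wf. reflexivity.
Qed.


(** * The invariant of all instances along the walk *)

Section Main.
Variables (n m d Sz A0 infoB nodeB : nat) (rk rn : nat -> nat) (uf inf : nat -> bool)
  (ibase : nat -> nat -> nat) (w : nat -> nat).
Hypothesis Hn : 1 <= n.
Hypothesis Hm : 2 <= m.
Hypothesis Hnm : n <= m ^ d.
Hypothesis Hrk : forall v, rk v < n.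
Hypothesis Hinf : forall v, inf v = true -> uf v = true.
Hypothesis Hw : forall t, w t < n.
Hypothesis Hadj : forall t, cycle_adj n (w t) (w (S t)).

(** Two levels more than the trie: a window has at most [3 n] positions, and [m ^ 2 >= 4]. *)
Definition digits := d + 2.

Notation size := (size n m rk).
Notation node := (node n m rk).
Notation index := (index m rk).
Notation cls := (cls m rk).
Notation thr := (thr m).
Notation class_of := (class_of m rk).
Notation memb := (memb m rk).

Definition iub q tau i := uf (node q tau i).
Definition iib q tau i := inf (node q tau i).
Definition ivl q tau i := rk (node q tau i).
Definition ikc q tau i := cls q (node q tau i).
Definition ith q tau := thr q tau.

Definition isize q tau := inst_size digits (size q tau) m.

Hypothesis HA0 : heap0 + cPow digits < A0.
Hypothesis HA0S : A0 <= Sz.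
Hypothesis Hib : forall q tau, A0 <= ibase q tau.
Hypothesis Hie : forall q tau, q <= d -> tau < n -> ibase q tau + isize q tau <= Sz.
Hypothesis Hdis : forall q tau q' tau', q <= d -> tau < n -> q' <= d -> tau' < n ->
  (q, tau) <> (q', tau') ->
  ibase q tau + isize q tau <= ibase q' tau' \/ ibase q' tau' + isize q' tau' <= ibase q tau.
Hypothesis HnodeB : heap0 <= nodeB /\ nodeB + n < A0.
Hypothesis HinfoB : heap0 <= infoB /\ infoB + 4 * ((d + 1) * n) <= A0.

Definition const_ok (hp : nat -> nat) : Prop :=
  hp (heap0 + cN) = n /\ hp (heap0 + cM) = m /\ hp (heap0 + cInfo) = infoB /\ hp (heap0 + cNodes) =
      nodeB /\
  (forall h, h <= digits -> hp (heap0 + cPow h) = m ^ h) /\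
  (forall q v, q <= d -> v < n ->
     hp (infoB + (q * n + v) * 4 + 0) = ibase q (class_of q v) /\
     hp (infoB + (q * n + v) * 4 + 1) = size q (class_of q v) /\
     hp (infoB + (q * n + v) * 4 + 2) = index q (class_of q v) v /\
     hp (infoB + (q * n + v) * 4 + 3) = cls q v) /\
  (forall r, r <= n -> hp (nodeB + r) = rn r).

Lemma info_addr q v f : q <= d -> v < n -> f < 4 -> infoB + (q * n + v) * 4 + f < A0.
Proof. intros. nia. Qed.

Lemma const_frame hp hp' : (forall a, a < A0 -> hp' a = hp a) -> const_ok hp -> const_ok hp'.
Proof.
  intros H (C1 & C2 & C3 & C4 & C5 & C6 & C7). unfold cPow in *.
  unfold const_ok. rewrite !(H (heap0 + _)) by (unfold cN, cM, cInfo, cNodes; lia).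
  repeat split; auto.
  - intros h Hh. rewrite H; auto. clear -HA0 Hh. unfold cPow in *. lia.
  - rewrite H by (apply info_addr; auto; lia). apply C6; auto.
  - rewrite H by (apply info_addr; auto; lia). apply C6; auto.
  - rewrite H by (apply info_addr; auto; lia). apply C6; auto.
  - rewrite H by (apply info_addr; auto; lia). apply C6; auto.
  - intros r Hr. rewrite H; auto. clear -HnodeB Hr. lia.
Qed.

Fixpoint active (t : nat) (y : nat) : Prop :=
  match t with
  | 0 => False
  | S t => ((uf (w t) = true /\ rk (w t) = y) /\ inf (w t) = true) \/
           (~ (uf (w t) = true /\ rk (w t) = y) /\ active t y)
  end.

Definition iact q tau t y := active t y /\ y / m ^ q = tau.

(** The block describes time [t] although its last visit may be long past: steps outside the trie
    node do not change which of its ranks are active. [j] is the member visited last. *)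
Definition IP (hp : nat -> nat) (q tau t : nat) : Prop :=
  let N := size q tau in let B := ibase q tau in
  static_ok digits N m n B (iub q tau) (iib q tau) (ivl q tau) (ith q tau) hp /\
  ((block_fresh N m n B hp /\ forall i, i < t -> memb q tau (w i) = false) \/
   (exists j dd e v T,
      block_full N m n B (iub q tau) (iib q tau) (ivl q tau) (ikc q tau) (ith q tau) hp
        (iact q tau t) j dd e v T /\
      1 <= t /\ last_seen n m rk q tau (w (t - 1)) j)).

Lemma isize_end q tau : side_base digits (size q tau) m (ibase q tau) 2 = ibase q tau + isize q tau.
Proof. unfold side_base, isize, inst_size. lia. Qed.

Lemma size_pow q tau : 3 * size q tau <= m ^ digits.
Proof.
  pose proof (size_le n m rk q tau) as Hs. unfold digits. rewrite Nat.pow_add_r.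
  assert (Hsq : 4 <= m ^ 2) by (change (m ^ 2) with (m * (m * 1)); clear -Hm; nia).
  clear -Hs Hsq Hnm. nia.
Qed.

Lemma active_lt t y : active t y -> y < n.
Proof. induction t as [|t IH]; simpl; [tauto|]. intros [[[_ <-] _]|[_ H]]; auto. Qed.

Lemma iact_other q tau t y : memb q tau (w t) = false -> iact q tau (S t) y <-> iact q tau t y.
Proof.
  intros H. unfold iact. simpl. split; intros [H1 H2]; split; auto.
  - destruct H1 as [[[_ E] _]|[_ H1]]; auto. exfalso. apply memb_false in H.
    apply H. rewrite <- E in H2. exact H2.
  - right. split; auto. intros [_ E]. apply memb_false in H. apply H. rewrite <- E in H2. exact H2.
Qed.

Lemma iact_fresh q tau t y : (forall i, i < t -> memb q tau (w i) = false) -> ~ iact q tau t y.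
Proof.
  induction t as [|t IH]; intros H Hy.
  - destruct Hy as [[] _].
  - apply (proj1 (iact_other q tau t y (H t ltac:(auto)))) in Hy. apply IH in Hy; auto.
Qed.

Lemma iact_step q t y : let v := w t in let tau := class_of q v in
  iact q tau (S t) y <->
  step_idx (iub q tau) (iib q tau) (ivl q tau) (index q tau v) (iact q tau t) y.
Proof.
  intros v tau. unfold step_idx, iub, iib, ivl.
  rewrite (node_index n m rk Hm q tau v (Hw t) (memb_class m rk q v)).
  unfold iact. simpl. fold v.
  assert (E : uf v = true /\ rk v = y -> y / m ^ q = tau) by (intros [_ <-]; auto).
  tauto.
Qed.

Lemma IP_frame hp hp' q tau t : q <= d -> tau < n -> 1 <= size q tau ->
  const_ok hp' ->
  (forall a, ibase q tau <= a < ibase q tau + isize q tau -> hp' a = hp a) ->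
  IP hp q tau t -> IP hp' q tau t.
Proof.
  intros Hq Ht HN HC HF [HS HI]. pose proof (isize_end q tau) as HE.
  pose proof (size_pow q tau) as HD'.
  assert (Hlow : side_base digits (size q tau) m (ibase q tau) 0 <= ibase q tau + isize q tau).
  { unfold side_base, isize, inst_size. nia. }
  assert (HBS : heap0 + cPow digits < ibase q tau) by (specialize (Hib q tau); lia).
  assert (HBe : side_base digits (size q tau) m (ibase q tau) 2 <= Sz) by (rewrite HE; auto).
  assert (HST : static_ok digits (size q tau) m n (ibase q tau) (iub q tau) (iib q tau) (ivl q tau)
      (ith q tau) hp').
  { apply (static_frame Sz digits (size q tau) m n (ibase q tau) (iub q tau) (iib q tau) (ivl q tau)
      (ith q tau)
      HN Hm HD' (size_le n m rk q tau) HBS HBe hp); auto.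
    - intros h Hh. destruct HC as (_ & _ & _ & _ & HC & _). rewrite HC by auto.
      symmetry. apply HS; auto.
    - intros a Ha. apply HF. rewrite HE in Ha. unfold side_base in Ha. lia. }
  split; [exact HST|].
  destruct HI as [[[HF1 HF2] HV]|(j & dd & e & v & T & HB & H1 & HL)].
  - left. split; [split|auto].
    + rewrite HF; auto. unfold isize, inst_size. nia.
    + intros j c Hj. etransitivity; [|apply (HF2 j c Hj)]. unfold rows.
      destruct (Nat.ltb_spec c m) as [Hc|]; [|reflexivity].
      destruct (Nat.ltb_spec j (size q tau)) as [Hjs|]; [|reflexivity]. cbn [andb].
      apply HF. unfold isize, inst_size. clear -Hc Hjs. nia.
  - right. exists j, dd, e, v, T. split; auto.
    apply (block_full_frame Sz digits (size q tau) m n (ibase q tau) (iub q tau) (iib q tau) (ivl q tau)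
      (ikc q tau) (ith q tau) HN Hm HD' (size_le n m rk q tau) HBS HBe hp hp' (iact q tau t)); auto;
          [|tauto].
    intros a Ha. apply HF. lia.
Qed.

Lemma IP_stay hp q tau t : q <= d -> tau < n -> 1 <= size q tau ->
  memb q tau (w t) = false -> IP hp q tau t -> IP hp q tau (S t).
Proof.
  intros Hq Ht HN Hmb [HS HI]. pose proof (isize_end q tau) as HE.
  pose proof (size_pow q tau) as HD'.
  assert (HBS : heap0 + cPow digits < ibase q tau) by (specialize (Hib q tau); lia).
  assert (HBe : side_base digits (size q tau) m (ibase q tau) 2 <= Sz) by (rewrite HE; auto).
  split; [exact HS|].
  destruct HI as [[HF HV]|(j & dd & e & v & T & HB & H1 & HL)].
  - left. split; auto. intros i Hi. destruct (Nat.eq_dec i t) as [->|]; auto. apply HV. lia.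
  - right. exists j, dd, e, v, T. split; [|split; [lia|]].
    + apply (block_full_frame Sz digits (size q tau) m n (ibase q tau) (iub q tau) (iib q tau) (ivl q tau)
        (ikc q tau) (ith q tau) HN Hm HD' (size_le n m rk q tau) HBS HBe hp hp (iact q tau t)); auto.
      intros y. symmetry. apply iact_other; auto.
    + replace (S t - 1) with t by lia. destruct t as [|t]; [lia|].
      replace (S t - 1) with t in HL by lia.
      apply (last_seen_stay n m rk Hm q tau (w t)); auto.
Qed.

Definition base_regs (v : nat) (g : nat -> nat) : Prop :=
  g rNode = v /\ g rM = m /\ g rNone = n /\ g rRec = rec_size m.

Lemma ev_info q f g hp v : const_ok hp -> base_regs v g ->
  ev g hp (info_cell q f) = hp (infoB + (q * n + v) * 4 + f).
Proof.
  intros (C1 & C2 & C3 & _) (R1 & R2 & R3 & R4). unfold info_cell, const.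
  cbn [ev eval_binop binop_of]. rewrite C3, R1, R3. auto.
Qed.

Lemma safe_info q f g hp v : const_ok hp -> base_regs v g -> q <= d -> v < n -> f < 4 ->
  safe heap0 Sz g hp (info_cell q f).
Proof.
  intros (C1 & C2 & C3 & _) (R1 & R2 & R3 & R4) Hq Hv Hf. unfold info_cell, const.
  cbn [safe ev eval_binop binop_of]. rewrite C3, R1, R3.
  pose proof (info_addr q v f Hq Hv Hf). unfold cPow, cInfo in *. repeat split; lia.
Qed.

Lemma base_regs_upd v g g' r : rC < r \/ r = rB \/ r = rN \/ r = rX \/ r = rC -> r <> rRec ->
  (forall r', r' <> r -> g' r' = g r') -> base_regs v g -> base_regs v g'.
Proof.
  intros Hr Hr' H (R1 & R2 & R3 & R4).
  unfold base_regs, rC, rB, rN, rX, rRec, rNode, rM, rNone in *.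
  rewrite !H by lia. auto.
Qed.

Lemma wp_level q t hp g (Q : (nat -> nat) -> (nat -> nat) -> Prop) :
  let v := w t in let tau := class_of q v in
  q <= d -> const_ok hp -> base_regs v g -> IP hp q tau t ->
  (forall g' hp' r, base_regs v g' -> g' rBest = Nat.min (g rBest) r ->
     ismin n (iact q tau (S t)) (thr q tau (cls q v)) r -> IP hp' q tau (S t) ->
     (forall a, a < ibase q tau \/ ibase q tau + isize q tau <= a -> hp' a = hp a) ->
     (forall a, hp' a <= Nat.max (hp a) n) -> Q g' hp') ->
  wp heap0 Sz (level_code digits q) Q g hp.
Proof.
  intros v tau Hq HC HR [HS HI] HQ.
  assert (Hv : v < n) by apply Hw.
  assert (Htau : tau < n) by (apply (class_lt n m rk Hm Hrk); auto).
  assert (Hmb : memb q tau v = true) by apply memb_class.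
  set (x := index q tau v).
  assert (Hx : x < size q tau) by (apply (index_lt n m rk Hm); auto).
  assert (HN : 1 <= size q tau) by lia.
  assert (Hnx : node q tau x = v) by (apply (node_index n m rk Hm); auto).
  pose proof (isize_end q tau) as HE. pose proof (size_pow q tau) as HD'.
  assert (HBS : heap0 + cPow digits < ibase q tau) by (specialize (Hib q tau); lia).
  assert (HBe : side_base digits (size q tau) m (ibase q tau) 2 <= Sz) by (rewrite HE; auto).
  pose proof HC as (_ & _ & _ & _ & _ & HC6 & _).
  destruct (HC6 q v Hq Hv) as (I0 & I1 & I2 & I3).
  unfold level_code.
  apply wp_seq. apply wp_set_gen with (v := ibase q tau).
  { eapply safe_info; eauto. }
  { rewrite (ev_info q 0 g hp v); auto. }
  intros g1 F1 V1. assert (R1 : base_regs v g1) by (eapply base_regs_upd; [| |apply F1|]; auto;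
      discriminate).
  apply wp_seq. apply wp_set_gen with (v := size q tau).
  { eapply safe_info; eauto. }
  { rewrite (ev_info q 1 g1 hp v); auto. }
  intros g2 F2 V2. assert (R2 : base_regs v g2) by (eapply base_regs_upd; [| |apply F2|]; auto;
      discriminate).
  apply wp_seq. apply wp_set_gen with (v := x).
  { eapply safe_info; eauto. }
  { rewrite (ev_info q 2 g2 hp v); auto. }
  intros g3 F3 V3. assert (R3 : base_regs v g3) by (eapply base_regs_upd; [| |apply F3|]; auto;
      discriminate).
  apply wp_seq. apply wp_set_gen with (v := cls q v).
  { eapply safe_info; eauto. }
  { rewrite (ev_info q 3 g3 hp v); auto. }
  intros g4 F4 V4. assert (R4 : base_regs v g4) by (eapply base_regs_upd; [| |apply F4|]; auto 10;
      discriminate).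
  apply wp_seq. apply wp_set_gen with (v := side_size digits (size q tau) m).
  { cbn [safe]. repeat split; auto. }
  { cbn [ev eval_binop binop_of]. rewrite F4, F3, V2 by discriminate.
    destruct R4 as (_ & _ & _ & ->). reflexivity. }
  intros g5 F5 V5.
  assert (R5 : base_regs v g5).
  { apply (base_regs_upd v g4 g5 rSize); auto; left; cbv; lia. }
  assert (HIR : inst_regs digits (size q tau) m n (ibase q tau) (ikc q tau) x g5).
  { destruct R5 as (U1 & U2 & U3 & U4). unfold inst_regs. repeat split; auto.
    - rewrite F5, F4, F3, F2 by discriminate. auto.
    - rewrite F5, F4, F3 by discriminate. auto.
    - rewrite F5, F4 by discriminate. auto.
    - rewrite F5 by discriminate. unfold ikc. rewrite Hnx. auto. }
  assert (B5 : g5 rBest = g rBest) by (rewrite F5, F4, F3, F2, F1 by discriminate; auto).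
  apply wp_seq.
  assert (HPost : forall g' hp', kept g5 g' -> low_frame (size q tau) (ibase q tau) hp hp' ->
     (forall a, hp' a <= Nat.max (hp a) (size q tau)) ->
     (exists dd e z T, block_pre (size q tau) m n (ibase q tau) (iub q tau) (iib q tau) (ivl q tau)
        (ikc q tau) (ith q tau) hp'
        (step_idx (iub q tau) (iib q tau) (ivl q tau) x (iact q tau t)) x dd e z T) ->
     wp heap0 Sz (query_code digits ;;; set_min rBest rOut) Q g' hp').
  { intros g6 hp6 K6 L6 M6 (dd & e & z & T & HBP). apply wp_seq.
    assert (HS6 : static_ok digits (size q tau) m n (ibase q tau) (iub q tau) (iib q tau) (ivl q tau)
        (ith q tau) hp6).
    { eapply (static_frame Sz digits (size q tau) m n (ibase q tau) (iub q tau) (iib q tau) (ivl q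
        tau) (ith q tau)
        HN Hm HD' (size_le n m rk q tau) HBS HBe hp); auto.
      - intros h Hh. apply L6. left. unfold cPow in *. lia.
      - intros a Ha. apply L6. right. unfold side_base in Ha. nia. }
    eapply (wp_query Sz digits (size q tau) m n (ibase q tau) (iub q tau) (iib q tau) (ivl q tau)
        (ikc q tau)
      (ith q tau) HN Hm (fun j => Hinf _) (fun j => Hrk _) (fun j => cls_lt m rk Hm q _) HD'
      (size_le n m rk q tau) HBS HBe hp6); eauto.
    { apply (inst_regs_kept Sz digits (size q tau) m n (ibase q tau) (ikc q tau) HN Hm HD' (size_le n
        m rk q tau)
        HBS HBe x g5); auto. }
    intros g7 hp7 K7 HBF HMin L7 M7.
    apply wp_set_min with (v := g7 rOut); [exact I|reflexivity|].
    intros g8 F8 V8.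
    assert (FR : forall a, a < ibase q tau \/ side_base digits (size q tau) m (ibase q tau) 0 <= a ->
        hp7 a = hp a).
    { intros a Ha. rewrite L7 by auto. apply L6. unfold side_base in Ha. nia. }
    apply (HQ g8 hp7 (g7 rOut)).
    - assert (R7 : base_regs v g7).
      { destruct R5 as (U1 & U2 & U3 & U4). unfold base_regs.
        rewrite !K7, !K6 by (cbv; lia). auto. }
      apply (base_regs_upd v g7 g8 rBest); auto; [left; cbv; lia|discriminate].
    - rewrite V8, K7, K6 by (cbv; lia). rewrite B5. auto.
    - eapply ismin_ext; [|unfold ikc in HMin; rewrite Hnx in HMin; apply HMin].
      intros r. symmetry. apply (iact_step q t r).
    - split.
      + eapply (static_frame Sz digits (size q tau) m n (ibase q tau) (iub q tau) (iib q tau) (ivl q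
          tau) (ith q tau)
          HN Hm HD' (size_le n m rk q tau) HBS HBe hp); auto.
        * intros h Hh. apply FR. left. unfold cPow in *. lia.
        * intros a Ha. apply FR. right. lia.
      + right. exists x, dd, e, z, T. split; [|split; [lia|]].
        * eapply (block_full_frame Sz digits (size q tau) m n (ibase q tau) (iub q tau) (iib q tau)
            (ivl q tau)
            (ikc q tau) (ith q tau) HN Hm HD' (size_le n m rk q tau) HBS HBe hp7 hp7); [auto| |apply HBF].
          intros y. symmetry. apply (iact_step q t y).
        * replace (S t - 1) with t by lia. apply (last_seen_here n m rk Hm); auto.
    - intros a Ha. apply FR. rewrite <- HE in Ha. unfold side_base in *. nia.
    - intros a. specialize (M7 a). specialize (M6 a). pose proof (size_le n m rk q tau). lia. }
  destruct HI as [[HF HV]|(j & dd & e & z & T & HB & H1 & HL)].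
  - eapply (wp_arrive_fresh Sz digits (size q tau) m n (ibase q tau) (iub q tau) (iib q tau) (ivl q tau)
      (ikc q tau) (ith q tau) HN Hm HD' (size_le n m rk q tau) HBS HBe hp (iact q tau t) x); auto.
    intros y. apply iact_fresh; auto.
  - destruct t as [|t]; [lia|]. replace (S t - 1) with t in HL by lia.
    eapply (wp_arrive Sz digits (size q tau) m n (ibase q tau) (iub q tau) (iib q tau) (ivl q tau)
      (ikc q tau) (ith q tau) HN Hm HD' (size_le n m rk q tau) HBS HBe hp (iact q tau (S t)) j x dd e
          z T); auto.
    apply (last_seen_step n m rk Hm q tau (w t)); auto.
Qed.

(** Situation in the middle of a step: levels below [k] have already processed it, the others have
    not. *)
Definition instances_at (k t : nat) (hp : nat -> nat) : Prop :=
  forall q tau, q <= d -> tau < n -> 1 <= size q tau ->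
    IP hp q tau (if q <? k then S t else t).

Lemma wp_levels k t hp : forall g (Q : (nat -> nat) -> (nat -> nat) -> Prop),
  let v := w t in
  k <= d + 1 -> const_ok hp -> base_regs v g -> g rBest = n -> instances_at 0 t hp ->
  (forall g' hp', base_regs v g' -> const_ok hp' -> instances_at k t hp' ->
     ismin n (fun y => exists q, q < k /\ iact q (class_of q v) (S t) y /\
                thr q (class_of q v) (cls q v) <= y) 0 (g' rBest) ->
     (forall a, hp' a <= Nat.max (hp a) n) -> Q g' hp') ->
  wp heap0 Sz (levels_code digits k) Q g hp.
Proof.
  induction k as [|k IH]; intros g Q v Hk HC HR HB HI HQ.
  - apply HQ; auto; [|intros; lia]. rewrite HB. apply ismin_empty. intros r (q & Hq & _). lia.
  - apply wp_seq. apply IH; auto; [lia|]. fold v.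
    intros g1 hp1 R1 C1 I1 M1 X1.
    set (tau := class_of k v).
    assert (Htau : tau < n) by (apply (class_lt n m rk Hm Hrk); auto).
    assert (HN : 1 <= size k tau).
    { pose proof (index_lt n m rk Hm k tau v (Hw t) (memb_class m rk k v)). lia. }
    apply wp_level with (t := t); auto; [lia| |].
    { fold v tau. specialize (I1 k tau ltac:(lia) Htau HN). rewrite Nat.ltb_irrefl in I1. auto. }
    fold v tau. intros g2 hp2 r R2 V2 M2 P2 L2 X2.
    assert (C2 : const_ok hp2).
    { eapply const_frame; [|apply C1]. intros a Ha. apply L2. specialize (Hib k tau). lia. }
    apply HQ; auto.
    + intros q tau' Hq Ht' HN'.
      destruct (Nat.eq_dec q k) as [->|Hne].
      * rewrite (proj2 (Nat.ltb_lt k (S k))) by lia.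
        (* The step visits one trie node of level [k]; all others pass to time [S t] without any
           work. *)
        destruct (Nat.eq_dec tau' tau) as [->|Hne']; auto.
        specialize (I1 k tau' Hq Ht' HN'). rewrite Nat.ltb_irrefl in I1.
        apply IP_stay; auto.
        -- apply memb_false. intros E. apply Hne'. symmetry. exact E.
        -- apply (IP_frame hp1 hp2); auto. intros a Ha. apply L2.
           destruct (Hdis k tau k tau'); auto; try lia. congruence.
      * specialize (I1 q tau' Hq Ht' HN').
        replace (q <? S k) with (q <? k)
          by (destruct (Nat.ltb_spec q k), (Nat.ltb_spec q (S k)); lia || auto).
        assert (HF : forall a, ibase q tau' <= a < ibase q tau' + isize q tau' -> hp2 a = hp1 a).
        { intros a Ha. apply L2. destruct (Hdis k tau q tau'); auto; try lia. congruence. }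
        eapply IP_frame; eauto.
    + eapply ismin_ext; [|rewrite V2; apply ismin_or; [apply M1|apply ismin_above; apply M2]].
      intros y. cbv beta. split.
      * intros [(q & Hq & H)|H]; [exists q; split; auto; lia|exists k; split; auto; tauto].
      * intros (q & Hq & H1 & H2). destruct (Nat.eq_dec q k) as [->|]; [right; auto|].
        left. exists q. split; auto. lia.
    + intros a. specialize (X1 a). specialize (X2 a). lia.
Qed.

Lemma wp_zero k hp : forall g (Q : (nat -> nat) -> (nat -> nat) -> Prop),
  (forall g', (forall r, 2 <= r < 2 + k -> g' r = 0) -> (forall r, r < 2 -> g' r = g r) -> Q g' hp) ->
  wp heap0 Sz (zero_code k) Q g hp.
Proof.
  induction k as [|k IH]; intros g Q HQ.
  - apply HQ; auto. intros; lia.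
  - apply wp_seq. apply IH. intros g1 Z1 F1.
    apply wp_set with (v := 0); [exact I|reflexivity|]. apply HQ.
    + intros r Hr. destruct (Nat.eq_dec r (2 + k)) as [->|Hne]; [apply upd_same|].
      rewrite upd_other by auto. apply Z1. lia.
    + intros r Hr. rewrite upd_other by lia. auto.
Qed.

Lemma wp_main t hp g (Q : (nat -> nat) -> (nat -> nat) -> Prop) :
  g rNode = w t -> const_ok hp -> instances_at 0 t hp ->
  (forall g' hp' r, const_ok hp' -> instances_at 0 (S t) hp' ->
     ismin n (fun y => active (S t) y /\ rk (w t) <= y) 0 r -> g' rAns = rn r ->
     (forall r, 2 <= r < T0 -> g' r = 0) -> (forall a, hp' a <= Nat.max (hp a) n) -> Q g' hp') ->
  wp heap0 Sz (main_code d) Q g hp.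
Proof.
  intros Hg HC HI HQ. set (v := w t).
  pose proof HC as (C1 & C2 & C3 & C4 & C5 & C6 & C7).
  assert (HS : heap0 + 4 <= Sz) by (clear -HA0 HA0S; unfold cPow in *; lia).
  assert (SC : forall j, j < 4 -> heap0 <= heap0 + j < Sz) by (clear -HS; intros; lia).
  unfold main_code.
  apply wp_seq. apply wp_set_gen with (v := n); [split; [exact I|apply SC; cbv; lia]|exact C1|].
  intros g1 F1 V1.
  apply wp_seq. apply wp_set_gen with (v := m); [split; [exact I|apply SC; cbv; lia]|exact C2|].
  intros g2 F2 V2.
  apply wp_seq. apply wp_set_gen with (v := rec_size m).
  { cbn [safe]. repeat split. }
  { cbn [ev eval_binop binop_of]. rewrite V2. reflexivity. }
  intros g3 F3 V3.
  apply wp_seq. apply wp_set_gen with (v := n); [exact I| |].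
  { cbn [ev]. rewrite F3, F2 by discriminate. auto. }
  intros g4 F4 V4.
  apply wp_seq. apply (wp_levels (d + 1) t hp); auto.
  { unfold base_regs. rewrite !F4 by discriminate. rewrite V3. rewrite !F3 by discriminate.
    rewrite V2. rewrite !F2 by discriminate. rewrite V1. rewrite F1 by discriminate. auto. }
  intros g5 hp5 R5 C5' I5 M5 X5.
  assert (HB5 : g5 rBest <= n) by exact (proj1 M5).
  pose proof C5' as (_ & _ & _ & D4 & _ & _ & D7).
  apply wp_seq. apply wp_set_gen with (v := rn (g5 rBest)).
  { unfold const. cbn [safe ev eval_binop binop_of]. rewrite D4.
    pose proof (SC cNodes ltac:(cbv; lia)). clear -H HB5 HnodeB HA0S. repeat split; lia. }
  { unfold const. cbn [ev eval_binop binop_of]. rewrite D4. apply D7; auto. }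
  intros g6 F6 V6.
  apply wp_zero. intros g7 Z7 F7.
  apply HQ with (r := g5 rBest); auto.
  - intros q tau Hq Ht HN. specialize (I5 q tau Hq Ht HN).
    rewrite (proj2 (Nat.ltb_lt q (d + 1))) in I5 by (clear -Hq; lia). auto.
  - eapply ismin_ext; [|apply M5]. intros y. cbv beta. split.
    + intros (q & Hq & [H1 H2] & H3). split; auto.
      eapply (thr_sound m rk Hm); eauto.
    + intros [H1 H2]. destruct (thr_complete m rk Hm v y d) as (q & Hq & H3 & H4); auto.
      (* All ranks share the root at level [d], so a common ancestor exists. *)
      { rewrite (class_top n m Hm), <- (class_top n m Hm d (rk v)); auto.
        apply active_lt with (t := S t). auto. }
      exists q. split; [clear -Hq; lia|]. split; auto. split; auto.
  - rewrite F7 by (cbv; lia). auto.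
Qed.

Variables (W Bd : nat) (M0 h0 : nat -> nat).
Hypothesis HBd : 2 <= Bd /\ n <= Bd /\ cconst (main_code d) <= Bd.
Hypothesis HW : Bd ^ growth (main_code d) < W.
Hypothesis Hrn : forall r, rn r <= Bd.
Hypothesis HM0 : (forall a, a < heap0 -> M0 a = 0) /\ (forall a, heap0 <= a -> M0 a = h0 a).
Hypothesis Hh0 : (forall a, h0 a <= Bd) /\ const_ok h0 /\ instances_at 0 0 h0.

(** The same [Bd] holds at all times: a step stores only numbers up to [n] in the heap and clears
    the working registers, so growth within a step does not accumulate. *)
Definition machine_inv (t : nat) (mem : nat -> nat) : Prop :=
  exists hp, (forall a, heap0 <= a -> mem a = hp a) /\ (forall r, 2 <= r < T0 -> mem r = 0) /\
    mem rAns <= Bd /\ (forall a, hp a <= Bd) /\ const_ok hp /\ instances_at 0 t hp.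

Lemma machine_step t mem : machine_inv t mem ->
  exists mem' r,
    run (program_of T0 (main_code d)) Sz W (S (clen T0 (main_code d))) 0 (upd mem 0 (w t)) = Some mem' /\
    machine_inv (S t) mem' /\ mem' rAns = rn r /\
    ismin n (fun y => active (S t) y /\ rk (w t) <= y) 0 r.
Proof.
  intros (hp & M1 & M2 & M3 & M4 & M5 & M6).
  set (g := fun r => if r <? T0 then upd mem 0 (w t) r else 0).
  destruct (program_of_correct Sz W T0 TN (main_code d) Bd (upd mem 0 (w t)) g hp
    (fun g' hp' => exists r, (forall a, hp' a <= Bd) /\ const_ok hp' /\ instances_at 0 (S t) hp' /\
       ismin n (fun y => active (S t) y /\ rk (w t) <= y) 0 r /\ g' rAns = rn r /\
       forall r, 2 <= r < T0 -> g' r = 0))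
    as (mem' & g' & hp' & E1 & [E2 E3] & r & P1 & P2 & P3 & P4 & P5 & P6); auto; try apply HBd.
  - change (T0 + TN) with heap0. clear -HA0 HA0S. lia.
  - cbv; lia.
  - apply main_code_wf.
  - intros r. unfold g. destruct (Nat.ltb_spec r T0) as [Hr|]; [|lia].
    destruct (Nat.eq_dec r 0) as [->|H]; [rewrite upd_same|rewrite upd_other by auto].
    + specialize (Hw t). lia.
    + destruct (Nat.eq_dec r 1) as [->|]; [exact M3|]. rewrite M2 by lia. lia.
  - split.
    + intros r Hr. unfold g. rewrite (proj2 (Nat.ltb_lt _ _)) by auto. auto.
    + intros a Ha. change (heap0 <= a) in Ha.
      rewrite upd_other by (unfold heap0 in Ha; lia). auto.
  - change (T0 + TN) with heap0. apply (wp_main t); auto.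
    intros g' hp' r N1 N2 N3 N4 N5 N6. exists r.
    split; [|auto]. intros a. specialize (N6 a). specialize (M4 a). lia.
  - exists mem', r. split; auto. split; [|split; auto].
    + exists hp'. split; [exact E3|]. split; [|split; [|auto]].
      * intros r' Hr'. rewrite E2 by lia. auto.
      * rewrite E2 by (cbv; lia). rewrite P5. auto.
    + rewrite E2 by (cbv; lia). auto.
Qed.

Lemma machine_run t : exists mem,
  ds_state (program_of T0 (main_code d)) (clen T0 (main_code d)) Sz W M0 w t = Some mem /\
  machine_inv t mem.
Proof.
  induction t as [|t (mem & E & HI)].
  - exists M0. split; auto. exists h0. destruct HM0 as [Z1 Z2], Hh0 as (Z3 & Z4 & Z5).
    split; [exact Z2|]. split; [|split; [|auto]].
    + intros r Hr. apply Z1. change heap0 with (T0 + TN). lia.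
    + rewrite Z1 by (cbv; lia). lia.
  - destruct (machine_step t mem HI) as (mem' & r & E' & HI' & _).
    exists mem'. cbn [ds_state]. rewrite E. auto.
Qed.

Lemma machine_answer t : exists mem r,
  ds_state (program_of T0 (main_code d)) (clen T0 (main_code d)) Sz W M0 w (S t) = Some mem /\
  mem 1 = rn r /\ ismin n (fun y => active (S t) y /\ rk (w t) <= y) 0 r.
Proof.
  destruct (machine_run t) as (mem & E & HI).
  destruct (machine_step t mem HI) as (mem' & r & E' & _ & H1 & H2).
  exists mem', r. cbn [ds_state]. rewrite E. auto.
Qed.

End Main.

(** * Storage *)

Lemma off_add sz a k : off sz (a + k) = off sz a + list_sum (map (fun i => sz (a + i)) (seq 0 k)).
Proof.
  induction k as [|k IH].
  - rewrite Nat.add_0_r. simpl. lia.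
  - rewrite seq_S, map_app, list_sum_app, Nat.add_succ_r. simpl. rewrite IH. lia.
Qed.

(** In this order: registers, constants and the table of nodes; the info table; the instances of all
    levels. *)
Definition storage_factor (d : nat) : nat := 60 + d + 4 * (d + 1) + (d + 1) * (72 + 60 * (d + 2)).

Section Layout.
Variables (n m d : nat) (rk rn : nat -> nat) (uf inf : nat -> bool).
Hypothesis Hn : 1 <= n.
Hypothesis Hm : 2 <= m.
Hypothesis Hrk : forall v, rk v < n.
Hypothesis Hrn : forall r, rn r <= n.

Definition region_size (j : nat) : nat :=
  match j with
  | 0 => 5 + digits d
  | 1 => n + 1
  | 2 => 4 * ((d + 1) * n)
  | S (S (S k)) => isize n m d rk (k / n) (k mod n)
  end.

Definition region (j : nat) : nat := heap0 + off region_size j.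
Definition inst_base (q tau : nat) : nat := region (3 + (q * n + tau)).
Definition heap_end : nat := region (3 + (d + 1) * n).

Definition region_content (j i : nat) : nat :=
  match j with
  | 0 => match i with
         | 0 => n
         | 1 => m
         | 2 => region 2
         | 3 => region 1
         | S (S (S (S h))) => m ^ h
         end
  | 1 => rn i
  | 2 => let q := i / 4 / n in let v := (i / 4) mod n in
         match i mod 4 with
         | 0 => inst_base q (class_of m rk q v)
         | 1 => size n m rk q (class_of m rk q v)
         | 2 => index m rk q (class_of m rk q v) v
         | _ => cls m rk q v
         end
  | S (S (S k)) =>
      let q := k / n in let tau := k mod n in
      inst_content (digits d) (size n m rk q tau) m n (iub n m rk uf q tau) (iib n m rk inf q tau)
        (ivl n m rk q tau) (ith m q tau) i
  end.

Lemma inst_pos q tau : q <= d -> tau < n -> 3 + (q * n + tau) < 3 + (d + 1) * n.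
Proof. intros Hq Ht. clear -Hq Ht. nia. Qed.

Lemma region_size_inst q tau : tau < n -> region_size (3 + (q * n + tau)) = isize n m d rk q tau.
Proof.
  intros Ht. cbn [region_size Nat.add].
  destruct (div_mod_unique_pair (q * n + tau) n q tau Ht eq_refl) as [-> ->]. auto.
Qed.

Lemma region_le j k : j <= k -> region j <= region k.
Proof. intros H. pose proof (off_le region_size j k H). unfold region. lia. Qed.

Lemma region_end j k : j < k -> region j + region_size j <= region k.
Proof. intros H. pose proof (off_mono region_size j k H). unfold region. lia. Qed.

Lemma inst_base_end q tau : q <= d -> tau < n -> inst_base q tau + isize n m d rk q tau <= heap_end.
Proof.
  intros Hq Ht. rewrite <- region_size_inst by auto. apply region_end. apply inst_pos; auto.
Qed.

Lemma inst_base_disjoint q tau q' tau' : q <= d -> tau < n -> q' <= d -> tau' < n ->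
  (q, tau) <> (q', tau') ->
  inst_base q tau + isize n m d rk q tau <= inst_base q' tau' \/
  inst_base q' tau' + isize n m d rk q' tau' <= inst_base q tau.
Proof.
  intros Hq Ht Hq' Ht' Hne. rewrite <- !region_size_inst by auto.
  assert (q * n + tau <> q' * n + tau').
  { intros E. apply Hne. destruct (div_mod_unique_pair (q * n + tau) n q tau Ht eq_refl) as [A B].
    destruct (div_mod_unique_pair (q * n + tau) n q' tau' Ht' E) as [A' B']. congruence. }
  destruct (Nat.lt_gt_cases (q * n + tau) (q' * n + tau')) as [[H1|H1] _]; auto;
    [left|right]; apply region_end; lia.
Qed.

(** A record has at most 5 m^3 cells, and each of the two sides has 6 N (d + 3) states, which gives
    60 (d + 3). The missing 12 pay for the header, stack and rows (6) and for the root states of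
    both sides (6). *)
Lemma inst_size_le N : inst_size (digits d) N m <= N * (m * m * m * (72 + 60 * (d + 2))).
Proof.
  unfold inst_size, side_size, num_states, rec_size, digits.
  assert (A : (m + 1) * (m + 1) * m <= 4 * (m * m * m)) by (clear -Hm; nia).
  assert (B : m <= m * m * m) by (clear -Hm; nia).
  assert (B' : 1 <= m * m * m) by (clear -Hm; nia).
  set (c := m * m * m) in *.
  assert (A' : m + (m + 1) * (m + 1) * m <= 5 * c) by lia.
  set (u := m + (m + 1) * (m + 1) * m) in *.
  replace (N * (c * (72 + 60 * (d + 2)))) with (N * c * 72 + (d + 2 + 1) * (12 * (N * (5 * c))) - 60
      * (N * c)) by nia.
  assert (E1 : (d + 2 + 1) * (2 * (3 * N)) * u <= (d + 2 + 1) * (2 * (3 * N)) * (5 * c))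
    by (apply Nat.mul_le_mono_l; auto).
  assert (E2 : (5 + m) * N <= 6 * (N * c)) by (clear -B B'; nia).
  assert (E3 : N <= N * c) by (clear -B'; nia).
  clear -E1 E2 E3. nia.
Qed.

(** Instance sizes are linear in the number of members, and these numbers add up to n on each
    level. *)
Lemma off_levels q : q <= d + 1 ->
  off region_size (3 + q * n) <= off region_size 3 + q * (n * (m * m * m * (72 + 60 * (d + 2)))).
Proof.
  set (G := m * m * m * (72 + 60 * (d + 2))).
  induction q as [|q IH]; intros Hq; [simpl; lia|].
  replace (3 + S q * n) with (3 + q * n + n) by lia. rewrite off_add.
  assert (HL : forall l, (forall i, In i l -> i < n) ->
    list_sum (map (fun i => region_size (3 + q * n + i)) l) <= list_sum (map (size n m rk q) l) * G).
  { induction l as [|i l IHl]; intros Hl; [simpl; lia|].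
    assert (Hi : i < n) by (apply Hl; left; auto).
    cbn [map list_sum fold_right]. unfold list_sum in IHl.
    specialize (IHl (fun j Hj => Hl j (or_intror Hj))).
    rewrite <- Nat.add_assoc, region_size_inst by auto.
    pose proof (inst_size_le (size n m rk q i)) as HI. fold G in HI. unfold isize.
    fold (list_sum (map (size n m rk q) l)) in *.
    rewrite Nat.mul_add_distr_r. lia. }
  specialize (HL (seq 0 n)). rewrite (sum_sizes n m rk q Hrk Hm) in HL.
  specialize (IH ltac:(lia)).
  assert (HL' : list_sum (map (fun i => region_size (3 + q * n + i)) (seq 0 n)) <= n * G).
  { apply HL. intros i Hi. apply in_seq in Hi. lia. }
  rewrite Nat.mul_succ_l. lia.
Qed.

Lemma heap_end_le : heap_end <= storage_factor d * (n * (m * m * m)).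
Proof.
  unfold heap_end, region. pose proof (off_levels (d + 1) (le_n _)) as H.
  assert (E : off region_size 3 = 5 + digits d + (n + 1) + 4 * ((d + 1) * n)) by reflexivity.
  rewrite E in H. unfold digits in H. clear E.
  assert (B : 1 <= m * m * m) by (clear -Hm; nia).
  unfold storage_factor, heap0. set (c := m * m * m) in *. set (G := 72 + 60 * (d + 2)) in *.
  assert (E1 : n <= n * c) by (clear -B; nia).
  assert (E2 : 4 * ((d + 1) * n) <= 4 * ((d + 1) * (n * c))) by (clear -E1; nia).
  assert (E3 : d <= d * (n * c)) by (clear -E1 Hn; nia).
  replace ((60 + d + 4 * (d + 1) + (d + 1) * G) * (n * c))
    with (60 * (n * c) + d * (n * c) + 4 * ((d + 1) * (n * c)) + (d + 1) * (n * (c * G))) by (clear; nia).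
  set (z := (d + 1) * (n * (c * G))) in *. clearbody z.
  set (y := (d + 1) * (n * c)) in *. set (y' := (d + 1) * n) in *. lia.
Qed.

(** The summands cover addresses, powers of [m], ranks and nodes, classes, and state numbers. *)
Definition value_bound : nat := heap_end + m ^ digits d + n + m + (d + 3) * (2 * (3 * n)).

Lemma region_heap j : j <= 3 -> region j <= heap_end.
Proof. intros H. apply region_le. lia. Qed.

Lemma inst_base_heap q tau : q <= d -> tau < n -> inst_base q tau <= heap_end.
Proof. intros Hq Ht. pose proof (inst_base_end q tau Hq Ht). lia. Qed.

Lemma region_content_bound j i : j < 3 + (d + 1) * n -> i < region_size j ->
  region_content j i <= value_bound.
Proof.
  intros Hj Hi. unfold value_bound. destruct j as [|[|[|k]]].
  - cbn [region_content region_size] in *. destruct i as [|[|[|[|h]]]].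
    + lia.
    + lia.
    + pose proof (region_heap 2). lia.
    + pose proof (region_heap 1). lia.
    + assert (m ^ h <= m ^ digits d) by (apply Nat.pow_le_mono_r; lia). lia.
  - cbn [region_content]. specialize (Hrn i). lia.
  - cbn [region_content region_size] in *.
    assert (Hv : (i / 4) mod n < n) by (apply Nat.mod_upper_bound; lia).
    assert (Hq : i / 4 / n <= d).
    { assert (i / 4 / n < d + 1); [|lia]. apply Nat.Div0.div_lt_upper_bound.
      apply Nat.Div0.div_lt_upper_bound. lia. }
    set (q := i / 4 / n) in *. set (v := (i / 4) mod n) in *. cbv zeta.
    pose proof (class_lt n m rk Hm Hrk q v) as Hc.
    pose proof (inst_base_heap q _ Hq Hc).
    assert (Hs : size n m rk q (class_of m rk q v) <= n) by apply size_le.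
    pose proof (index_le n m rk Hm q (class_of m rk q v) v).
    pose proof (cls_lt m rk Hm q v).
    destruct (i mod 4) as [|[|[|]]]; lia.
  - cbn [region_content region_size] in *. cbv zeta.
    assert (HN : 1 <= size n m rk (k / n) (k mod n)).
    { destruct (size n m rk (k / n) (k mod n)) eqn:E; [|lia].
      unfold isize in Hi. rewrite E in Hi. exfalso. revert Hi.
      unfold inst_size, side_size, num_states. rewrite !Nat.mul_0_r. simpl. lia. }
    etransitivity; [apply inst_content_bound; auto|].
    assert (Hs : size n m rk (k / n) (k mod n) <= n) by apply size_le.
    unfold num_states, digits. replace (d + 2 + 1) with (d + 3) by lia.
    assert ((d + 3) * (2 * (3 * size n m rk (k / n) (k mod n))) <= (d + 3) * (2 * (3 * n)))
      by (apply Nat.mul_le_mono_l; lia).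
    assert (2 <= (d + 3) * (2 * (3 * n))) by (clear -Hn; nia). lia.
Qed.

Lemma layout_ok w h :
  (forall j i, j < 3 + (d + 1) * n -> i < region_size j -> h (region j + i) = region_content j i) ->
  const_ok n m d (region 2) (region 1) rk rn inst_base h /\
  instances_at n m d rk uf inf inst_base w 0 0 h.
Proof.
  intros H.
  assert (P : forall j, j <= digits d -> h (heap0 + cPow j) = m ^ j).
  { intros j Hj. apply (H 0 (4 + j)); cbn [region_size]; lia. }
  split.
  - unfold const_ok. split; [|split; [|split; [|split; [|split; [exact P|split]]]]].
    + apply (H 0 0); cbn [region_size]; lia.
    + apply (H 0 1); cbn [region_size]; lia.
    + apply (H 0 2); cbn [region_size]; lia.
    + apply (H 0 3); cbn [region_size]; lia.
    + intros q v Hq Hv.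
      assert (F : forall f, f < 4 -> h (region 2 + (q * n + v) * 4 + f) = region_content 2 ((q * n +
          v) * 4 + f)
         /\ ((q * n + v) * 4 + f) / 4 = q * n + v /\ ((q * n + v) * 4 + f) mod 4 = f).
      { intros f Hf. split; [|apply div_mod_unique_pair; auto].
        rewrite <- Nat.add_assoc. apply H; [lia|]. cbn [region_size]. clear -Hq Hv Hf. nia. }
      destruct (div_mod_unique_pair (q * n + v) n q v Hv eq_refl) as [E1 E2].
      repeat split; [destruct (F 0 ltac:(lia)) as (-> & F1 & F2)|destruct (F 1 ltac:(lia)) as (-> &
          F1 & F2)
        |destruct (F 2 ltac:(lia)) as (-> & F1 & F2)|destruct (F 3 ltac:(lia)) as (-> & F1 & F2)];
        cbn [region_content]; rewrite F1, F2, E1, E2; auto.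
    + intros r Hr. apply (H 1 r); cbn [region_size]; lia.
  - intros q tau Hq Ht HN. simpl.
    destruct (inst_content_ok (digits d) (size n m rk q tau) m n (iub n m rk uf q tau) (iib n m rk
        inf q tau)
      (ivl n m rk q tau) (ith m q tau) HN Hm h (inst_base q tau) P) as [S1 S2].
    { intros o Ho. unfold inst_base. rewrite H.
      - cbn [region_content Nat.add]. 
        destruct (div_mod_unique_pair (q * n + tau) n q tau Ht eq_refl) as [-> ->]. auto.
      - apply inst_pos; auto.
      - rewrite region_size_inst by auto. auto. }
    split; auto. left. split; auto. intros i Hi. lia.
Qed.

End Layout.

(** * Ranks of the real values *)

Lemma length_filter_le {X} (f g : X -> bool) l :
  (forall u, In u l -> f u = true -> g u = true) -> length (filter f l) <= length (filter g l).
Proof.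
  induction l as [|u l IH]; intros H; simpl; auto.
  specialize (IH (fun v Hv => H v (or_intror Hv))). specialize (H u (or_introl eq_refl)).
  destruct (f u); [rewrite H by auto; simpl; lia|]. destruct (g u); simpl; lia.
Qed.

Lemma length_filter_lt {X} (f g : X -> bool) l u :
  (forall u, In u l -> f u = true -> g u = true) -> In u l -> f u = false -> g u = true ->
  length (filter f l) < length (filter g l).
Proof.
  intros H Hu Hf Hg. apply in_split in Hu. destruct Hu as (l1 & l2 & ->).
  rewrite !filter_app, !length_app. simpl. rewrite Hf, Hg. simpl.
  assert (length (filter f l1) <= length (filter g l1))
    by (apply length_filter_le; intros v Hv; apply H, in_or_app; auto).
  assert (length (filter f l2) <= length (filter g l2))
    by (apply length_filter_le; intros v Hv; apply H, in_or_app; right; right; auto).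
  lia.
Qed.

Section Ranks.
Variables (n : nat) (op : nat -> opkind) (x : nat -> R).
Hypothesis Hn : 1 <= n.

Definition below (v u : nat) : bool := if Rlt_dec (x u) (x v) then true else false.
(** Counting strictly smaller values gives equal reals the same rank, so a deletion also acts on
    insertions made at other nodes. The remainder makes [rank v < n] true for every natural
    number. *)
Definition rank (v : nat) : nat := length (filter (below (v mod n)) (seq 0 n)).
Definition rank_node (r : nat) : nat := hd n (filter (fun v => rank v =? r) (seq 0 n)).
Definition is_update (v : nat) : bool := match op v with OpQuery => false | _ => true end.
Definition is_insert (v : nat) : bool := match op v with OpInsert => true | _ => false end.

Lemma rank_lt v : rank v < n.
Proof.
  assert (Hv : v mod n < n) by (apply Nat.mod_upper_bound; lia).
  unfold rank. apply Nat.lt_le_trans with (length (filter (fun _ => true) (seq 0 n))).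
  2:{ rewrite filter_true, length_seq. auto. }
  apply (length_filter_lt _ _ _ (v mod n)); auto.
  - apply in_seq. lia.
  - unfold below. destruct (Rlt_dec _ _); auto. lra.
Qed.

Lemma rank_mono u v : u < n -> v < n -> (x u <= x v)%R -> rank u <= rank v.
Proof.
  intros Hu Hv H. unfold rank. rewrite !Nat.mod_small by auto. apply length_filter_le.
  intros z _. unfold below. destruct (Rlt_dec (x z) (x u)), (Rlt_dec (x z) (x v)); auto. lra.
Qed.

Lemma rank_strict u v : u < n -> v < n -> (x u < x v)%R -> rank u < rank v.
Proof.
  intros Hu Hv H. unfold rank. rewrite !Nat.mod_small by auto.
  apply (length_filter_lt _ _ _ u).
  - intros z _. unfold below. destruct (Rlt_dec (x z) (x u)), (Rlt_dec (x z) (x v)); auto. lra.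
  - apply in_seq. lia.
  - unfold below. destruct (Rlt_dec _ _); auto. lra.
  - unfold below. destruct (Rlt_dec _ _); auto.
Qed.

Lemma rank_le u v : u < n -> v < n -> rank u <= rank v <-> (x u <= x v)%R.
Proof.
  intros Hu Hv. split; [|apply rank_mono; auto]. intros H.
  destruct (Rle_lt_dec (x u) (x v)) as [|Hlt]; auto.
  apply rank_strict in Hlt; auto. lia.
Qed.

Lemma rank_eq u v : u < n -> v < n -> rank u = rank v <-> x u = x v.
Proof.
  intros Hu Hv. pose proof (rank_le u v Hu Hv) as H1. pose proof (rank_le v u Hv Hu) as H2. split;
      intros E.
  - apply Rle_antisym; [apply H1|apply H2]; lia.
  - apply Nat.le_antisymm; [apply H1|apply H2]; lra.
Qed.

Lemma rank_node_cases r :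
  (rank_node r < n /\ rank (rank_node r) = r) \/
  (rank_node r = n /\ forall v, v < n -> rank v <> r).
Proof.
  unfold rank_node. destruct (filter _ _) as [|u l] eqn:E; simpl.
  - right. split; auto. intros v Hv Hr.
    assert (In v (filter (fun v => rank v =? r) (seq 0 n))).
    { apply filter_In. split; [apply in_seq; lia|apply Nat.eqb_eq; auto]. }
    rewrite E in H. auto.
  - left. assert (In u (filter (fun v => rank v =? r) (seq 0 n))) by (rewrite E; left; auto).
    apply filter_In in H. destruct H as [H1 H2]. apply in_seq in H1. apply Nat.eqb_eq in H2.
    split; auto. lia.
Qed.

Lemma rank_node_le r : rank_node r <= n.
Proof. destruct (rank_node_cases r) as [[]|[]]; lia. Qed.

Lemma rank_node_top : rank_node n = n.
Proof.
  destruct (rank_node_cases n) as [[_ H]|[]]; auto. pose proof (rank_lt (rank_node n)). lia.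
Qed.

Variable w : nat -> nat.
Hypothesis Hw : forall t, w t < n.

Notation active_rank := (active rank is_update is_insert w).

(** Ranks identify exactly the nodes with equal values, so overriding a real and overriding its rank
    amount to the same. *)
Lemma apply_op_active t (X : R -> Prop) :
  (forall y, X y <-> exists u, u < n /\ x u = y /\ active_rank t (rank u)) ->
  forall y, apply_op op x (w t) X y <-> exists u, u < n /\ x u = y /\ active_rank (S t) (rank u).
Proof.
  intros HX y. pose proof (Hw t) as Hv. unfold apply_op. cbn [active].
  unfold is_update, is_insert.
  assert (E : forall u, u < n -> rank (w t) = rank u <-> x (w t) = x u)
    by (intros; apply rank_eq; auto).
  destruct (op (w t)).
  - rewrite HX. split.
    + intros [(u & H1 & H2 & H3)|Hy].
      * exists u. split; auto. split; auto.
        destruct (Nat.eq_dec (rank (w t)) (rank u)); [left|right]; tauto.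
      * exists (w t). repeat split; auto.
    + intros (u & H1 & H2 & [H3|[_ H3]]); [right|left; eauto].
      destruct H3 as [[_ H3] _]. apply E in H3; auto. congruence.
  - rewrite HX. split.
    + intros [(u & H1 & H2 & H3) Hy]. exists u. split; auto. split; auto.
      right. split; auto. intros [_ H4]. apply Hy. apply E in H4; auto. congruence.
    + intros (u & H1 & H2 & [[_ H3]|[H3 H4]]); [discriminate|]. split; [eauto|].
      intros ->. apply H3. split; auto. apply E; auto.
  - rewrite HX. split.
    + intros (u & H1 & H2 & H3). exists u. split; auto. split; auto. right.
      split; auto. intros [H4 _]. discriminate.
    + intros (u & H1 & H2 & [[_ H3]|[_ H4]]); [discriminate|]. eauto.
Qed.

Lemma active_set_active t y :
  active_set op x w t y <-> exists u, u < n /\ x u = y /\ active_rank (S t) (rank u).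
Proof.
  revert y. induction t as [|t IH]; cbn [active_set]; intros y; apply apply_op_active; auto.
  intros z. split; [tauto|]. intros (u & _ & _ & []).
Qed.

Lemma ismin_succ_answer t r :
  ismin n (fun y => active_rank (S t) y /\ rank (w t) <= y) 0 r ->
  succ_answer n x (active_set op x w t) (x (w t)) (rank_node r).
Proof.
  intros (H1 & H2 & H3). pose proof (Hw t) as Hv. destruct H2 as [->|[[H2 H2'] _]].
  - right. split; [apply rank_node_top|]. intros y Hy.
    apply active_set_active in Hy. destruct Hy as (u & Hu & <- & Ha).
    destruct (Rlt_le_dec (x u) (x (w t))) as [|Hle]; auto.
    apply rank_mono in Hle; auto. pose proof (rank_lt u).
    specialize (H3 (rank u) (conj Ha Hle)). lia.
  (* An active rank stems from a visited node, so [rank_node r] is not the default [n]. *)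
  - assert (HE : exists v, v < n /\ rank v = r).
    { clear H2' H3. induction t as [|t IH]; cbn [active] in H2.
      - destruct H2 as [[[_ H2] _]|[_ []]]. eauto.
      - destruct H2 as [[[_ H2] _]|[_ H2]]; eauto. }
    destruct (rank_node_cases r) as [[U1 U2]|[_ U]].
    2:{ destruct HE as (v & E1 & E2). exfalso. apply (U v); auto. }
    left. split; auto. split; [|split].
    + apply active_set_active. exists (rank_node r). rewrite U2. auto.
    + apply rank_le; auto. rewrite U2. auto.
    + intros y Hy Hle. apply active_set_active in Hy. destruct Hy as (u & Hu & <- & Ha).
      apply rank_le; auto. rewrite U2. apply H3; [|lia]. split; auto. apply rank_le; auto.
Qed.

End Ranks.

(** * Choice of the branching and the final bounds *)

Lemma branching_exists n d : forall k, 2 <= k -> n <= k ^ d ->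
  exists m, 2 <= m <= k /\ n <= m ^ d /\ (m = 2 \/ (m - 1) ^ d < n).
Proof.
  induction k as [|k IH]; intros Hk H; [lia|].
  destruct (Nat.eq_dec k 1) as [->|]; [exists 2; auto|].
  destruct (Nat.lt_ge_cases (k ^ d) n) as [Hlt|Hge].
  - exists (S k). replace (S k - 1) with k by lia. auto with arith.
  - destruct IH as (m & H1 & H2); auto; [lia|]. exists m. split; auto. lia.
Qed.

Open Scope R_scope.

(** Minimality of [m] bounds [m - 1] by the d-th root of n, and [m <= 2 (m - 1)]; for [m = 2] the
    root is at least 1. *)
Lemma branching_bound n d m : (1 <= n)%nat -> (1 <= d)%nat -> (2 <= m)%nat ->
  (m = 2 \/ (m - 1) ^ d < n)%nat -> INR m <= 2 * Rpower (INR n) (/ INR d).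
Proof.
  intros Hn Hd Hm H.
  assert (Hn' : 1 <= INR n) by (apply (le_INR 1); auto).
  assert (Hd' : 0 < INR d) by (apply (lt_INR 0); lia).
  destruct H as [->|H].
  - assert (H : Rpower (INR n) 0 <= Rpower (INR n) (/ INR d)).
    { apply Rle_Rpower; auto. left. apply Rinv_0_lt_compat. auto. }
    rewrite Rpower_O in H by lra. simpl. lra.
  - assert (Hm' : 1 <= INR (m - 1)) by (apply (le_INR 1); lia).
    assert (E : INR (m - 1) = Rpower (INR (m - 1) ^ d) (/ INR d)).
    { rewrite <- Rpower_pow by lra. rewrite Rpower_mult, Rinv_r by lra.
      rewrite Rpower_1; lra. }
    assert (INR (m - 1) <= Rpower (INR n) (/ INR d)).
    { rewrite E. apply Rle_Rpower_l; [left; apply Rinv_0_lt_compat; auto|]. split.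
      - apply pow_lt. lra.
      - rewrite <- pow_INR. apply le_INR. lia. }
    assert (INR m <= 2 * INR (m - 1)).
    { change 2 with (INR 2). rewrite <- mult_INR. apply le_INR. lia. }
    lra.
Qed.

(** The cube of the bound on [m] produces the factor 8 and the exponent [3 / d]. *)
Lemma storage_bound n d m F eps : (1 <= n)%nat -> (1 <= d)%nat -> (2 <= m)%nat ->
  (m = 2 \/ (m - 1) ^ d < n)%nat -> 3 / INR d <= eps ->
  INR (F * (n * (m * m * m))) <= INR (8 * F) * Rpower (INR n) (1 + eps).
Proof.
  intros Hn Hd Hm H Heps. pose proof (branching_bound n d m Hn Hd Hm H) as HB.
  assert (Hn' : 1 <= INR n) by (apply (le_INR 1); auto).
  assert (Hm' : 0 <= INR m) by apply pos_INR.
  set (z := Rpower (INR n) (/ INR d)) in *.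
  assert (Hz : z * z * z <= Rpower (INR n) eps).
  { unfold z. rewrite <- !Rpower_plus. apply Rle_Rpower; auto. unfold Rdiv in Heps. lra. }
  assert (Hc : INR m * INR m * INR m <= 8 * Rpower (INR n) eps).
  { apply Rle_trans with (2 * z * (2 * z) * (2 * z)); [|lra].
    apply Rmult_le_compat; auto using Rmult_le_pos. apply Rmult_le_compat; auto. }
  rewrite Rpower_plus, Rpower_1 by lra. rewrite !mult_INR.
  replace (INR 8) with 8 by (simpl; lra).
  apply Rle_trans with (INR F * (INR n * (8 * Rpower (INR n) eps))); [|lra].
  apply Rmult_le_compat_l; [apply pos_INR|]. apply Rmult_le_compat_l; [lra|auto].
Qed.

Lemma levels_exist eps : 0 < eps -> exists d, (1 <= d)%nat /\ 3 / INR d <= eps.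
Proof.
  intros He. destruct (INR_unbounded (3 / eps)) as [d Hd].
  assert (He' : 0 < 3 / eps) by (apply Rdiv_lt_0_compat; lra).
  assert (Hd0 : 0 < INR d) by lra.
  exists d. split.
  - apply (INR_lt 0). auto.
  - apply Rmult_le_reg_r with (INR d); auto. unfold Rdiv. rewrite Rmult_assoc, Rinv_l by lra.
    apply Rmult_lt_compat_l with (r := eps) in Hd; auto.
    unfold Rdiv in Hd. rewrite <- Rmult_assoc, (Rmult_comm eps 3), Rmult_assoc, Rinv_r in Hd by lra.
    lra.
Qed.

Open Scope nat_scope.

(** With B = n + 1, a constant a is crudely bounded by B^a, so constants enter the exponent as
    summands: the storage factor and 4 for n m^3, [d + 2] for powers of [m], 2 for [n + m],
    [6 * (d + 3) + 1] for state numbers. [cconst] makes the bound cover the constants in the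
    program, and the last 1 pays for adding up. *)
Definition value_exponent (d : nat) : nat :=
  storage_factor d + 4 + (d + 2) + 2 + (6 * (d + 3) + 1) + cconst (main_code d) + 1.

Lemma value_bound_pow n m d rk : 3 <= n -> 2 <= m -> m <= n -> (forall v, rk v < n) ->
  value_bound n m d rk <= (n + 1) ^ value_exponent d.
Proof.
  intros Hn Hm Hmn Hrk. unfold value_bound.
  assert (HE : heap_end n m d rk <= storage_factor d * (n * (m * m * m))) by (apply heap_end_le;
      auto; lia).
  unfold value_exponent. set (F := storage_factor d) in *. set (cc := cconst (main_code d)).
  set (B := n + 1).
  set (e := F + 4 + (d + 2) + 2 + (6 * (d + 3) + 1) + cc).
  assert (P : forall a b, a <= b -> B ^ a <= B ^ b) by (intros; apply Nat.pow_le_mono_r; lia).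
  assert (L : forall a, a <= B ^ a) by (intros a; apply Nat.lt_le_incl, Nat.pow_gt_lin_r; lia).
  assert (E1 : heap_end n m d rk <= B ^ e).
  { etransitivity; [apply HE|]. etransitivity; [|apply (P (F + 4)); lia].
    rewrite Nat.pow_add_r. apply Nat.mul_le_mono; [apply L|].
    change (B ^ 4) with (B * (B * (B * (B * 1)))).
    rewrite Nat.mul_1_r. rewrite <- (Nat.mul_assoc m).
    apply Nat.mul_le_mono; [lia|]. repeat apply Nat.mul_le_mono; lia. }
  assert (E2 : m ^ digits d <= B ^ e).
  { etransitivity; [apply Nat.pow_le_mono_l with (b := B); lia|]. apply P. unfold digits. lia. }
  assert (E3 : n + m <= B ^ e).
  { etransitivity; [|apply (P 2); lia]. change (B ^ 2) with (B * (B * 1)). nia. }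
  assert (E4 : (d + 3) * (2 * (3 * n)) <= B ^ e).
  { etransitivity; [|apply (P (6 * (d + 3) + 1)); lia]. rewrite Nat.pow_add_r, Nat.pow_1_r.
    replace ((d + 3) * (2 * (3 * n))) with (6 * (d + 3) * n) by lia.
    apply Nat.mul_le_mono; [apply L|lia]. }
  rewrite (Nat.pow_add_r B e 1), Nat.pow_1_r.
  (* Four bounds are added, and [B = n + 1 >= 4]. *)
  assert (B ^ e * 4 <= B ^ e * B) by (apply Nat.mul_le_mono_l; lia). lia.
Qed.

Open Scope R_scope.

Theorem mainTheorem9 :
  forall eps : R, 0 < eps ->
  exists (P : program) (C c K : nat),
  forall (n : nat), (3 <= n)%nat ->
  forall (op : nat -> opkind) (x : nat -> R) (s : nat), (s < n)%nat ->
  exists (M0 : nat -> nat) (S : nat),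
    INR S <= INR C * Rpower (INR n) (1 + eps) /\
    (forall a, (M0 a < (n + 1) ^ K)%nat) /\
    forall w : nat -> nat, is_walk n s w ->
    forall t : nat,
      exists m : nat -> nat,
        ds_state P c S ((n + 1) ^ K) M0 w (Datatypes.S t) = Some m /\
        (op (w t) = OpQuery ->
         succ_answer n x (active_set op x w t) (x (w t)) (m 1%nat)).
Proof.
  intros eps Heps. destruct (levels_exist eps Heps) as (d & Hd & Hde).
  set (K1 := value_exponent d). set (gr := growth (main_code d)).
  exists (program_of T0 (main_code d)), (8 * storage_factor d)%nat, (clen T0 (main_code d)),
    (* Cells are at most [(n + 1) ^ K1] between steps and at most [(n + 1) ^ (K1 * gr)] during one;
       this exponent exceeds both, so the bounds become strict. *)
    (K1 * (gr + 1) + 1)%nat.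
  intros n Hn op x s _.
  (* The search for [m] starts at [n], which is large enough because [d >= 1]. *)
  destruct (branching_exists n d n) as (m & [Hm Hmn] & Hnm & Hmd).
  { lia. }
  { rewrite <- (Nat.pow_1_r n) at 1. apply Nat.pow_le_mono_r; lia. }
  assert (Hn1 : (1 <= n)%nat) by lia.
  set (rk := rank n x).
  assert (Hrk : forall v, (rk v < n)%nat) by (intros; apply rank_lt; auto).
  set (rn := rank_node n x).
  assert (Hrn : forall r, (rn r <= n)%nat) by (intros; apply rank_node_le; auto).
  set (Bd := ((n + 1) ^ K1)%nat).
  assert (HV : (value_bound n m d rk <= Bd)%nat) by (apply value_bound_pow; auto).
  destruct (alloc (region_size n m d rk)
    (region_content n m d rk rn (is_update op) (is_insert op)) Bd (3 + (d + 1) * n)) as (h & Hh1 & Hh2).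
  { intros j i Hj Hi. etransitivity; [apply region_content_bound; auto|exact HV]. }
  set (h0 := fun a => h (a - heap0)%nat).
  set (M0 := fun a => if (a <? heap0)%nat then 0%nat else h0 a).
  exists M0, (heap_end n m d rk).
  assert (HB : (2 <= n + 1)%nat) by lia.
  split; [|split].
  - eapply Rle_trans; [apply le_INR, heap_end_le; auto|]. apply (storage_bound n d); auto.
  - intros a. apply Nat.le_lt_trans with Bd.
    + unfold M0, h0. destruct (a <? heap0)%nat; [lia|apply Hh2].
    + unfold Bd. apply Nat.pow_lt_mono_r; [lia|]. rewrite Nat.mul_add_distr_l. lia.
  - intros w (_ & Hw & Hadj) t.
    destruct (layout_ok n m d rk rn (is_update op) (is_insert op) Hn1 Hm w h0) as [LC LI].
    { intros j i Hj Hi. unfold h0, region. rewrite <- Nat.add_assoc, Nat.add_comm, Nat.add_sub.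
      apply Hh1; auto. }
    assert (H03 : (region n m d rk 3 <= heap_end n m d rk)%nat) by (apply region_heap; auto).
    destruct (machine_answer n m d (heap_end n m d rk) (region n m d rk 3) (region n m d rk 2)
      (region n m d rk 1) rk rn (is_update op) (is_insert op) (inst_base n m d rk) w)
      with (W := ((n + 1) ^ (K1 * (gr + 1) + 1))%nat) (Bd := Bd) (M0 := M0) (h0 := h0) (t := t)
      as (mem & r & E1 & E2 & E3); auto.
    + intros v. unfold is_insert, is_update. destruct (op v); auto; discriminate.
    + unfold region. cbn [off region_size]. unfold cPow. lia.
    + intros q tau. apply region_le; auto. lia.
    + intros q tau Hq Ht. apply inst_base_end; auto.
    + intros. apply inst_base_disjoint; auto.
    + unfold region. cbn [off region_size]. lia.
    + unfold region. cbn [off region_size]. lia.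
    + repeat split.
      * unfold Bd. etransitivity; [exact HB|]. rewrite <- (Nat.pow_1_r (n + 1)) at 1.
        apply Nat.pow_le_mono_r; [lia|]. unfold K1, value_exponent. lia.
      * unfold value_bound in HV. lia.
      * unfold Bd. etransitivity; [apply Nat.lt_le_incl, Nat.pow_gt_lin_r, HB|].
        apply Nat.pow_le_mono_r; [lia|]. unfold K1, value_exponent. lia.
    + fold gr. unfold Bd. rewrite <- Nat.pow_mul_r. apply Nat.pow_lt_mono_r; [lia|].
      rewrite Nat.mul_add_distr_l. lia.
    + intros r. specialize (Hrn r). unfold value_bound in HV. lia.
    + unfold M0. split; intros a Ha; destruct (Nat.ltb_spec a heap0); auto; lia.
    + split; [|split; auto]. intros a. apply Hh2.
    + exists mem. split; auto. intros _. rewrite E2. apply ismin_succ_answer; auto.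
Qed.
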